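(* For $\varepsilon>0$ let $(w_1^\varepsilon,w_2^\varepsilon)$ be the solution of $$\begin{cases}\varepsilon(w_1^\varepsilon)_t+H_1(x,Dw_1^\varepsilon)+w_1^\varepsilon-w_2^\varepsilon=\varepsilon^4\Delta w_1^\varepsilon&\text{in }\mathbb{T}^n\times(0,\infty),\\ \varepsilon(w_2^\varepsilon)_t+H_2(x,Dw_2^\varepsilon)+w_2^\varepsilon-w_1^\varepsilon=\varepsilon^4\Delta w_2^\varepsilon&\text{in }\mathbb{T}^n\times(0,\infty),\\ w_i^\varepsilon(x,0)=u_{0i}(x)&\text{on }\mathbb{T}^n\text{ for } i=1,2.\end{cases}$$ Then $$\lim_{\varepsilon\to0}\max_{i=1,2}\varepsilon\|(w_i^\varepsilon)_t(\cdot,1)\|_{L^\infty(\mathbb{T}^n)}=0.$$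
   Context: $\mathbb{T}^n=\mathbb{R}^n/\mathbb{Z}^n$; $D$ and $\Delta$ act in the spatial variable $x$. Standing assumptions: for some $\theta,C_0>0$ and for $i=1,2$, $H_i\in C^2(\mathbb{T}^n\times\mathbb{R}^n)$ satisfies $D^2_{pp}H_i\ge 2\theta I_n$ ($I_n$ the identity matrix) and $|D_xH_i(x,p)|\le C_0(1+|p|^2)$ for all $(x,p)$; $u_{01},u_{02}$ are Lipschitz on $\mathbb{T}^n$; and the ergodic constant of the system equals $0$. Here the ergodic constant is the unique $c\in\mathbb{R}$ such that the system $$H_1(x,Dv_1)+v_1-v_2=c,\qquad H_2(x,Dv_2)+v_2-v_1=c\quad\text{in }\mathbb{T}^n$$ has a viscosity solution $(v_1,v_2)$ with $v_1,v_2$ Lipschitz on $\mathbb{T}^n$. The regularized solution $(w_1^\varepsilon,w_2^\varepsilon)$ is smooth for $t>0$. *)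

(* Defs.v *)
From HB Require Import structures.
From mathcomp Require Import all_boot all_order all_algebra.
From mathcomp Require Import all_classical all_reals all_analysis.
Set Implicit Arguments.
Unset Strict Implicit.
Unset Printing Implicit Defensive.
Import Order.TTheory GRing.Theory Num.Theory.
Import numFieldNormedType.Exports.
Local Open Scope classical_set_scope.
Local Open Scope ring_scope.

(* Functions on the torus T^n = R^n / Z^n are represented by their Z^n-periodic
   lifts 'rV[R]_n -> R. The library's norm `|x| on 'rV[R]_n is the max norm;
   [enorm] is the Euclidean norm. *)

Section Torus.
Context {R : realType} {n : nat}.
Local Notation vec := 'rV[R]_n.

Definition periodic (f : vec -> R) : Prop :=
  forall (x : vec) (k : 'rV[int]_n), f (x + map_mx intr k) = f x.

Definition enorm (p : vec) : R := Num.sqrt (\sum_(k < n) p 0 k ^+ 2).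

Definition e_ (k : 'I_n) : vec := delta_mx 0 k.

Definition grad (f : vec -> R) (x : vec) : vec := \row_k 'D_(e_ k) f x.

Definition hessian (f : vec -> R) (x : vec) : 'M[R]_n :=
  \matrix_(j, k) 'D_(e_ k) ('D_(e_ j) f) x.

Definition laplacian (f : vec -> R) (x : vec) : R := \tr (hessian f x).

(* the Loewner order A <= B *)
Definition loewner_le (A B : 'M[R]_n) : Prop :=
  forall xi : vec, 0 <= (xi *m (B - A) *m xi^T) 0 0.

(* Lebesgue-null sets: for every e > 0, coverable by countably many cubes
   of total volume at most e *)
Definition null_set (A : set vec) : Prop :=
  forall e : R, 0 < e ->
  exists (a : nat -> vec) (r : nat -> R),
    [/\ forall k, 0 <= r k,
        A `<=` \bigcup_k [set x | forall i, a k 0 i <= x 0 i <= a k 0 i + r k]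
      & (\sum_(0 <= k <oo) (r k ^+ n)%:E <= e%:E)%E].

(* For a periodic f, this is the L^oo norm on the torus: a periodic set is null
   in R^n iff its image is null in T^n. *)
Definition Linfty_norm (f : vec -> R) : \bar R :=
  ereal_inf [set M%:E | M in
    [set M : R | 0 <= M /\ null_set [set x | M < `|f x|]]].

End Torus.

Fixpoint class_C {R : realType} {V : normedModType R} (k : nat) (f : V -> R)
    : Prop :=
  continuous f /\
  if k is k'.+1 then
    forall v : V, (forall x, derivable f x v) /\ class_C k' ('D_v f)
  else True.

Section Equations.
Context {R : realType} {n : nat}.
Local Notation vec := 'rV[R]_n.
Implicit Types H : vec -> vec -> R.

(* H(x, p) is the Hamiltonian; periodicity is in the space variable only *)
Definition hamiltonian_assumptions (theta C0 : R) H : Prop :=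
  [/\ forall p, periodic (H ^~ p),
      class_C 2 (fun z : vec * vec => H z.1 z.2),
      forall x p, loewner_le (2 * theta)%:M (hessian (H x) p)
    & forall x p, enorm (grad (H ^~ p) x) <= C0 * (1 + enorm p ^+ 2)].

Definition lipschitz_torus (u : vec -> R) : Prop := periodic u /\ lipschitz u.

(* viscosity sub- and supersolutions of H(x, Dv) + v - g = c *)
Definition visc_sub H (g : vec -> R) (c : R) (v : vec -> R) : Prop :=
  forall (phi : vec -> R) (x : vec), class_C 1 phi ->
    (\forall y \near x, v y - phi y <= v x - phi x) ->
    H x (grad phi x) + v x - g x <= c.

Definition visc_super H (g : vec -> R) (c : R) (v : vec -> R) : Prop :=
  forall (phi : vec -> R) (x : vec), class_C 1 phi ->
    (\forall y \near x, v x - phi x <= v y - phi y) ->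
    c <= H x (grad phi x) + v x - g x.

Definition visc_sol H (g : vec -> R) (c : R) (v : vec -> R) : Prop :=
  visc_sub H g c v /\ visc_super H g c v.

Definition ergodic_solvable H1 H2 (c : R) : Prop :=
  exists v1 v2 : vec -> R,
    [/\ lipschitz_torus v1, lipschitz_torus v2,
        visc_sol H1 v2 c v1 & visc_sol H2 v1 c v2].

Definition is_ergodic_constant H1 H2 (c : R) : Prop :=
  unique (ergodic_solvable H1 H2) c.

Definition dt (w : R -> vec -> R) (t : R) (x : vec) : R := derive1 (w ^~ x) t.

Definition cont_at (w : R -> vec -> R) (t : R) (x : vec) : Prop :=
  {for (t, x), continuous (fun z : R * vec => w z.1 z.2)}.

(* C^1 in t and C^2 in x on (0, oo) x R^n *)
Definition class_C12 (w : R -> vec -> R) : Prop :=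
  forall t x, 0 < t ->
  [/\ derivable (w ^~ x) t 1,
      forall k, derivable (w t) x (e_ k),
      forall j k, derivable ('D_(e_ j) (w t)) x (e_ k)
    & [/\ cont_at w t x,
          cont_at (dt w) t x,
          forall k, cont_at (fun s => 'D_(e_ k) (w s)) t x
        & forall j k, cont_at (fun s => 'D_(e_ k) ('D_(e_ j) (w s))) t x]].

(* Smoothness for t > 0. As H1 and H2 are merely C^2, solutions need not be
   C^oo; by parabolic regularity they do have the regularity below, which
   allows the equations to be differentiated once in t or in x. *)
Definition smooth_pos (w : R -> vec -> R) : Prop :=
  [/\ class_C12 w, class_C12 (dt w)
    & forall k, class_C12 (fun t => 'D_(e_ k) (w t))].

Definition regularized_solution H1 H2 (u01 u02 : vec -> R) (eps : R)
    (w1 w2 : R -> vec -> R) : Prop :=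
  [/\ forall t, 0 <= t -> periodic (w1 t) /\ periodic (w2 t),
      {within [set z : R * vec | 0 <= z.1], continuous (fun z => w1 z.1 z.2)} /\
      {within [set z : R * vec | 0 <= z.1], continuous (fun z => w2 z.1 z.2)},
      smooth_pos w1 /\ smooth_pos w2,
      forall t x, 0 < t ->
        eps * dt w1 t x + H1 x (grad (w1 t) x) + w1 t x - w2 t x
          = eps ^+ 4 * laplacian (w1 t) x /\
        eps * dt w2 t x + H2 x (grad (w2 t) x) + w2 t x - w1 t x
          = eps ^+ 4 * laplacian (w2 t) x
    & forall x, w1 0 x = u01 x /\ w2 0 x = u02 x].

End Equations.

(* Main.v *)
Require Import Defs.
From HB Require Import structures.
From mathcomp Require Import all_boot all_order all_algebra.
From mathcomp Require Import all_classical all_reals all_analysis.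
From mathcomp Require Import ring lra.
Set Implicit Arguments.
Unset Strict Implicit.
Unset Printing Implicit Defensive.
Import Order.TTheory GRing.Theory Num.Theory.
Import numFieldNormedType.Exports.
Local Open Scope classical_set_scope.
Local Open Scope ring_scope.

(* Let [L] be the linearization of the system at [w], so that [L w_t = 0] and
   [L (s tau (t - a) w_t) = s tau eps w_t], where [s] is [1] or [-1]. Let [g]
   satisfy [eps g_t <= - (1 - s tau) (H(x, Dg) + g - g')], [g'] being the other
   component: for [s = 1] take the delayed solution [w(t - tau (t - a))], for
   [s = -1] the solution [v] of the ergodic problem. Convexity of [H] gives
     [L (w - g) >= theta |Dw - Dg|^2 - s tau (H(x, Dg) + g - g')],
   and the last term is close to [s tau eps w_t]. Hence the maximum principle
   bounds [s tau (t - a) w_t - (w - g)], so [eps w_t = O(eps / tau)] up to errors.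
   The discrepancies [tau (H(x, Dg) - H(x, Dw))], [tau eps^4 Laplacian w] and
   [tau ((g - g') - (w - w'))] are absorbed by [theta |Dw - Dg|^2] and by the
   corrections [kappa |Dw|^2 / 2] and [c (w - g)^2]. The variables of [w] and [g]
   are doubled because [v] is only a viscosity solution and [g] does not solve a
   viscous equation. The constants are uniform in [eps] thanks to an L^oo bound
   (comparison with [v]) and a gradient bound (Bernstein's method). *)

(** The weight [tau (t - a)] vanishes at [t = a], so no bound on [w_t] is needed to start: uniform
    bounds on [w] and [Dw] over [[1/2, 1]] suffice. The maximum is taken over the two components as
    well; comparing the maximal component with the other one handles the coupling. Origin of the
    corrections, with [phi = w - g] and [nu = eps^4]: the equation of [Dw] makes [kappa |Dw|^2 / 2]
    contribute [- kappa nu |D^2 w|^2], which pays for [tau nu Laplacian w] at the price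
    [nu tau^2 / kappa]; the concavity of [phi - c phi^2] contributes [- c (phi - phi')^2], which
    pays for the discrepancy of the couplings at the price [tau^2 / c]. The corrections themselves
    cost [kappa] and [c tau], and doubling with parameter [eta] costs [nu / eta] and [eta]. All
    prices are finally divided by [tau], so [tau] must be small against [c], [c] against [1], and
    [kappa], [eps], [eta], [nu / eta] against [tau]. Suitable powers of [eps] meet all constraints
    and give the rate [eps^(1/4)]. *)

Section Calculus.
Context {R : realType}.

(** * Derivatives along lines, mean value theorem, mixed derivatives *)

Lemma is_derive_affine (a h s : R) : is_derive s 1 (fun s : R => a + s * h) h.
Proof. by apply: is_derive_eq; rewrite /GRing.scale /=; ring. Qed.

Lemma is_derive_derivable {V : normedModType R} (f : V -> R) (x v : V) (d : R) :
  is_derive x v f d -> derivable f x v.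
Proof. by case. Qed.

Lemma is_derive_val {V : normedModType R} (f : V -> R) (x v : V) (d : R) :
  is_derive x v f d -> 'D_v f x = d.
Proof. by case. Qed.

Lemma is_derive_line {V : normedModType R} (f : V -> R) (x v : V) (r : R) :
  derivable f (x + r *: v) v ->
  is_derive r 1 (fun s => f (x + s *: v)) ('D_v f (x + r *: v)).
Proof.
move=> df; have E : (fun h : R => h^-1 *:
    (((fun s => f (x + s *: v)) \o shift r) (h *: 1) - f (x + r *: v))) =
    (fun h => h^-1 *: ((f \o shift (x + r *: v)) (h *: v) - f (x + r *: v))).
  apply/funext => h /=; rewrite [h%:A]mulr1 scalerDl.
  by rewrite [in RHS]addrCA.
by split; rewrite /derivable /derive E.
Qed.

Lemma line_is_derive {V : normedModType R} (f : V -> R) (x v : V) (d : R) :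
  is_derive (0 : R) 1 (fun s => f (x + s *: v)) d -> is_derive x v f d.
Proof.
move=> df; have E : (fun h : R => h^-1 *:
    (((fun s => f (x + s *: v)) \o shift 0) (h *: 1) - f (x + 0 *: v))) =
    (fun h => h^-1 *: ((f \o shift x) (h *: v) - f x)).
  apply/funext => h /=; rewrite [h%:A]mulr1 addr0 scale0r addr0.
  by rewrite [x + _]addrC.
by case: df; rewrite /derivable /derive E.
Qed.

(** Rescaling the segment to the unit interval covers every sign of [h], and [h = 0] too. *)
Lemma mvt1 (f f' : R -> R) (a h : R) :
  (forall c : R, 0 <= c <= 1 -> is_derive (a + c * h) 1 f (f' (a + c * h))) ->
  exists2 c : R, 0 <= c <= 1 & f (a + h) - f a = h * f' (a + c * h).
Proof.
move=> df; pose g s := f (a + s * h).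
have dg (s : R) : 0 <= s <= 1 -> is_derive s 1 g (h * f' (a + s * h)).
  move=> /df ds.
  by rewrite mulrC; apply: (@is_derive1_comp _ f (fun s => a + s * h)); exact: is_derive_affine.
have cg : {within `[0, 1], continuous g}.
  apply: derivable_within_continuous => s; rewrite in_itv /= => /dg ds; exact: ex_derive.
have dg' (s : R) : s \in `]0, 1[%R -> is_derive s 1 g (h * f' (a + s * h)).
  by rewrite in_itv /= => /andP[s0 s1]; apply: dg; rewrite !ltW.
have [c] := MVT ltr01 dg' cg.
rewrite in_itv /= => /andP[c0 c1] E; exists c; first by rewrite !ltW.
by move: E; rewrite /g mul1r mul0r addr0 subr0 mulr1.
Qed.

Lemma mvt_dir {V : normedModType R} (f : V -> R) (x v : V) :
  (forall c : R, 0 <= c <= 1 -> derivable f (x + c *: v) v) ->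
  exists2 c : R, 0 <= c <= 1 & f (x + v) - f x = 'D_v f (x + c *: v).
Proof.
move=> df.
have [|c c01 E] := @mvt1 (fun s => f (x + s *: v)) (fun s => 'D_v f (x + s *: v)) 0 1.
  by move=> c c01; rewrite add0r mulr1; apply/is_derive_line/df.
by exists c => //; move: E; rewrite !add0r mulr1 mul1r scale1r scale0r addr0.
Qed.

Lemma derivableZdir {V : normedModType R} (f : V -> R) (x v : V) (a : R) :
  derivable f x v -> is_derive x (a *: v) f (a * 'D_v f x).
Proof.
move=> df; apply: line_is_derive.
pose g s := f (x + s *: v).
have -> : (fun s => f (x + s *: (a *: v))) = g \o (fun s => s * a).
  by apply/funext => s /=; rewrite /g scalerA.
have dg : is_derive (0 * a) 1 g ('D_v f x).
  rewrite mul0r; have := @is_derive_line V f x v 0.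
  by rewrite scale0r addr0; apply.
have di : is_derive (0 : R) 1 (fun s : R => s * a) a.
  by apply: is_derive_eq; rewrite /GRing.scale /=; ring.
by rewrite mulrC; exact: is_derive1_comp.
Qed.

Lemma derive_dist_le (f : R -> R) (x l A e : R) : is_derive x 1 f l ->
  (\forall k \near 0^', `|k * A - (f (x + k) - f x)| <= `|k| * e) -> `|A - l| <= e.
Proof.
move=> [df <-] H.
have L : (fun h => `|A - h^-1 *: ((f \o shift x) (h *: 1) - f x)|) @ 0^'
    --> `|A - 'D_1 f x|.
  by apply: cvg_norm; apply: cvgB; [exact: cvg_cst|exact: df].
apply: (cvgr_to_le L); near=> k.
have kn0 : k != 0 by near: k; exact: nbhs_dnbhs_neq.
rewrite -(ler_pM2l (_ : 0 < `|k|)) ?normr_gt0 // -normrM mulrBr /=.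
rewrite [k%:A]mulr1 [k + x]addrC [k * (k^-1 *: _)]mulVKf //.
by near: k.
Unshelve. all: by end_near. Qed.

(* If [D_a f], [D_b f] and [D_b D_a f] exist and the last one is continuous at
   the point, then [D_a D_b f] exists there; its existence is not assumed. *)
Lemma mixed_derivative (f fa fab : R -> R -> R) (fb : R -> R) (a0 b0 d : R) :
  0 < d ->
  (forall a b : R, `|a - a0| < d -> is_derive a 1 (f ^~ b) (fa a b)) ->
  (forall a b : R, `|a - a0| < d -> is_derive b 1 (fa a) (fab a b)) ->
  (forall a : R, `|a - a0| < d -> is_derive b0 1 (f a) (fb a)) ->
  {for (a0, b0), continuous (fun z : R * R => fab z.1 z.2)} ->
  is_derive a0 1 fb (fab a0 b0).
Proof.
move=> d0 Ha Hab Hb cab.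
suff L : (fun h => h^-1 *: ((fb \o shift a0) (h *: 1) - fb a0)) @ 0^' --> fab a0 b0.
  by split; [apply/cvg_ex; exists (fab a0 b0)|exact: cvg_lim L].
apply/cvgrPdist_le => e e0.
have /cvgrPdist_le /(_ e e0) := cab.
rewrite /= => -[[A B] /= [/nbhs_ballP[dA dA0 bA] /nbhs_ballP[dB dB0 bB]] AB].
have bd : 0 < Num.min d dA by rewrite lt_min d0.
near=> h; have hn0 : h != 0 by near: h; exact: nbhs_dnbhs_neq.
have hd : `|h| < Num.min d dA.
  by near: h; apply: dnbhs0_lt.
move: hd; rewrite lt_min => /andP[hd hA].
rewrite /= [h%:A]mulr1.
have chd c : 0 <= c <= 1 -> `|a0 + c * h - a0| < d /\ `|a0 + c * h - a0| < dA.
  move=> /andP[c0 c1]; rewrite addrAC subrr add0r normrM ger0_norm //.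
  have : c * `|h| <= `|h| by rewrite ler_piMl.
  by move=> L; split; apply: le_lt_trans L _.
have h1 : `|a0 + h - a0| < d by have [|+ _] := chd 1; rewrite ?lexx ?ler01 // mul1r.
have h0 : `|a0 - a0| < d by rewrite subrr normr0.
have dD : is_derive b0 1 (fun b => f (a0 + h) b - f a0 b) (fb (a0 + h) - fb a0).
  by have := Hb _ h1; have := Hb _ h0 => ? ?; apply: is_deriveB.
have -> : h^-1 *: (fb (h + a0) - fb a0) = h^-1 * (fb (a0 + h) - fb a0).
  by rewrite [h + a0]addrC.
rewrite -(ler_pM2l (_ : 0 < `|h|)) ?normr_gt0 // -normrM mulrBr mulVKf //.
apply: (derive_dist_le dD); near=> k.
have kB : `|k| < dB by near: k; apply: dnbhs0_lt.
(* The double increment of [f] over the rectangle with sides [h] and [k] is [h k] times [fab] at an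
   intermediate point: mean value theorem in [a], then in [b]. With [h] fixed, [derive_dist_le] lets
   [k] tend to [0]. *)
have [|c c01 E1] := @mvt1 (fun a => f a (b0 + k) - f a b0)
    (fun a => fa a (b0 + k) - fa a b0) a0 h.
  move=> c /chd[cd _]; have := Ha _ (b0 + k) cd; have := Ha _ b0 cd => ? ?.
  exact: is_deriveB.
have [cd cA] := chd c c01.
have [|c' /andP[c'0 c'1] E2] := @mvt1 (fa (a0 + c * h)) (fab (a0 + c * h)) b0 k.
  by move=> c' _; exact: Hab.
have -> : f (a0 + h) (b0 + k) - f a0 (b0 + k) - (f (a0 + h) b0 - f a0 b0) =
    k * (h * fab (a0 + c * h) (b0 + c' * k)).
  by rewrite mulrCA -E2 -E1; ring.
rewrite -mulrBr -mulrBr normrM normrM ler_wpM2l // ler_wpM2l //.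
apply: (AB (_, _)); split => /=.
  by apply: bA; rewrite /ball /= distrC.
apply: bB; rewrite /ball /= opprD addrA subrr add0r normrN normrM ger0_norm //.
by apply: le_lt_trans kB; rewrite ler_piMl.
Unshelve. all: by end_near. Qed.

End Calculus.

(** * Linearity of directional derivatives in the direction *)

Section Directional.
Context {R : realType} {V : normedModType R}.

Lemma is_derive_lin2 (f g : V -> R) (x v : V) (a b df dg : R) :
  is_derive x v f df -> is_derive x v g dg ->
  is_derive x v (fun y => a * f y - b * g y) (a * df - b * dg).
Proof. by move=> Df Dg; exact: is_deriveB (is_deriveZ a Df) (is_deriveZ b Dg). Qed.

(** Directional derivatives alone need not be additive in the direction. The increment along [v]
    starts from the moving point [h u + x]; the mean value theorem turns it into [D_v f] at a point
    close to [x], where continuity applies. *)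
Lemma is_derive_dirD (f : V -> R) (x u v : V) :
  (forall y, derivable f y u) -> (forall y, derivable f y v) ->
  {for x, continuous ('D_v f)} ->
  is_derive x (u + v) f ('D_u f x + 'D_v f x).
Proof.
move=> du dv cv.
suff L : (fun h : R => h^-1 *: ((f \o shift x) (h *: (u + v)) - f x)) @ 0^'
    --> 'D_u f x + 'D_v f x.
  by split; [apply/cvg_ex; exists ('D_u f x + 'D_v f x)|exact: cvg_lim L].
have -> : (fun h : R => h^-1 *: ((f \o shift x) (h *: (u + v)) - f x)) =
  (fun h => h^-1 *: ((f \o shift x) (h *: u) - f x)) \+
  (fun h => h^-1 *: (f (h *: u + x + h *: v) - f (h *: u + x))).
  apply/funext => h /=; rewrite -scalerDr; congr (_ *: _).
  by rewrite scalerDr -addrA [h *: v + x]addrC addrA; ring.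
apply: cvgD; first exact: du.
apply/cvgrPdist_le => e e0.
have /cvgrPdist_le /(_ e e0) /nbhs_ballP[d d0 bd] := cv.
have K0 : 0 < `|u| + `|v| + 1 by rewrite ltr_wpDl // addr_ge0.
near=> h; have hn0 : h != 0 by near: h; exact: nbhs_dnbhs_neq.
have [|c /andP[c0 c1] E] := @mvt_dir _ _ f (h *: u + x) (h *: v).
  by move=> c _; exact: is_derive_derivable (derivableZdir h (dv _)).
rewrite E (is_derive_val (derivableZdir h (dv _))).
rewrite -[h^-1 *: _]/(h^-1 * _) mulKf //; apply: bd; rewrite -ball_normE /=.
rewrite [_ + x]addrC -addrA opprD addrA subrr add0r normrN scalerA.
have hd : `|h| * (`|u| + `|v| + 1) < d.
  by rewrite -ltr_pdivlMr //; near: h; apply: dnbhs0_lt; rewrite divr_gt0.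
apply: le_lt_trans hd; apply: (le_trans (ler_normD _ _)).
rewrite !normrZ -addrA mulrDr lerD2l (ger0_norm c0).
rewrite mulrDr mulr1 -[leLHS]addr0 lerD //.
by rewrite ler_wpM2r // ler_piMl.
Unshelve. all: by end_near. Qed.

Lemma class_C1_dir (f : V -> R) : class_C 1 f ->
  forall v x, derivable f x v /\ {for x, continuous ('D_v f)}.
Proof. by move=> [_ df] v x; have [dv [cv _]] := df v; split; [exact: dv|exact: cv]. Qed.

Lemma is_derive_lincomb (f : V -> R) : class_C 1 f ->
  forall (I : Type) (r : seq I) (c : I -> R) (b : I -> V) x,
  is_derive x (\sum_(i <- r) c i *: b i) f (\sum_(i <- r) c i * 'D_(b i) f x).
Proof.
move=> /class_C1_dir Cf I r c b; elim: r => [|i r IH] x.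
  by rewrite !big_nil; exact: is_derive0.
rewrite !big_cons.
have [d1 c1] := Cf (c i *: b i) x.
have [d2 c2] := Cf (\sum_(j <- r) c j *: b j) x.
have := @is_derive_dirD f x (c i *: b i) _ (fun y => (Cf _ y).1) (fun y => (Cf _ y).1) c2.
rewrite (is_derive_val (IH x)).
by rewrite (is_derive_val (derivableZdir (c i) (Cf (b i) x).1)).
Qed.

End Directional.

(** * Directional derivatives of functions on a product space *)

Section Slices.
Context {R : realType} {V W : normedModType R}.

Lemma derive_slice2 (f : V * W -> R) (x : V) (p v : W) :
  (derivable f (x, p) (0, v) <-> derivable (fun q => f (x, q)) p v) /\
  'D_v (fun q => f (x, q)) p = 'D_(0, v) f (x, p).
Proof.
have E : (fun h : R => h^-1 *: ((f \o shift (x, p)) (h *: (0, v)) - f (x, p)))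
  = (fun h => h^-1 *: (((fun q => f (x, q)) \o shift p) (h *: v) - f (x, p))).
  apply/funext => h /=; congr (_ *: (f _ - _)).
  by congr (_, _) => /=; rewrite scaler0 add0r.
by rewrite /derivable /derive E.
Qed.

Lemma derive_slice1 (f : V * W -> R) (x : V) (p : W) (v : V) :
  (derivable f (x, p) (v, 0) <-> derivable (fun y => f (y, p)) x v) /\
  'D_v (fun y => f (y, p)) x = 'D_(v, 0) f (x, p).
Proof.
have E : (fun h : R => h^-1 *: ((f \o shift (x, p)) (h *: (v, 0)) - f (x, p)))
  = (fun h => h^-1 *: (((fun y => f (y, p)) \o shift x) (h *: v) - f (x, p))).
  apply/funext => h /=; congr (_ *: (f _ - _)).
  by congr (_, _) => /=; rewrite scaler0 add0r.
by rewrite /derivable /derive E.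
Qed.

Lemma class_C_slice2 k (f : V * W -> R) (x : V) :
  class_C k f -> class_C k (fun p => f (x, p)).
Proof.
have cs (g : V * W -> R) : continuous g -> continuous (fun p => g (x, p)).
  move=> cg p; apply: (@continuous_comp _ _ _ (fun p => (x, p)) g); last exact: cg.
  by apply: cvg_pair; [exact: cvg_cst|exact: cvg_id].
elim: k f => [|k IH] f /= [cf df]; split => //; try exact: cs.
move=> v; have [dv cv] := df (0, v); split.
  by move=> p; exact: (proj1 (proj1 (derive_slice2 f x p v)) (dv _)).
have -> : 'D_v (fun p => f (x, p)) = (fun p => 'D_(0, v) f (x, p)).
  by apply/funext => p; exact: (proj2 (derive_slice2 f x p v)).
exact: (IH ('D_(0, v) f)).
Qed.

End Slices.

(** * Mean value formula and uniform convexity of the Hamiltonians *)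

Section Torus.
Context {R : realType} {n : nat}.
Local Notation vec := 'rV[R]_n.
Implicit Types (H : vec -> vec -> R) (f : vec -> R).

Lemma row_sum_e (v : vec) : v = \sum_k v 0 k *: e_ k.
Proof. exact: row_sum_delta. Qed.

Lemma derive_coord f (x v : vec) : class_C 1 f ->
  is_derive x v f (\sum_k v 0 k * 'D_(e_ k) f x).
Proof. by move=> Cf; rewrite {1}(row_sum_e v); exact: is_derive_lincomb. Qed.

Lemma class_C_le (V : normedModType R) (g : V -> R) : class_C 2 g -> class_C 1 g.
Proof.
by move=> [cg dg]; split => // v; have [dv [cv _]] := dg v.
Qed.

Lemma mean_value_pair H : class_C 1 (fun z : vec * vec => H z.1 z.2) ->
  forall x p dx dp, exists2 c : R, 0 <= c <= 1 &
    H (x + dx) (p + dp) - H x p =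
    \sum_k dx 0 k * 'D_(e_ k) (H ^~ (p + c *: dp)) (x + c *: dx) +
    \sum_k dp 0 k * 'D_(e_ k) (H (x + c *: dx)) (p + c *: dp).
Proof.
set h := fun z : vec * vec => H z.1 z.2 => Ch x p dx dp.
have [|c c01 E] := @mvt_dir _ _ h (x, p) (dx, dp).
  by move=> c _; exact: (class_C1_dir Ch _ _).1.
exists c => //; move: E; rewrite /h /= => ->.
have -> : (x, p) + c *: (dx, dp) = (x + c *: dx, p + c *: dp) by [].
have -> : (dx, dp) = (dx, 0) + (0, dp) :> vec * vec.
  by congr (_, _); rewrite /= ?addr0 ?add0r.
have C1 v z := (class_C1_dir Ch v z).1.
rewrite (is_derive_val (is_derive_dirD (C1 _) (C1 _) (class_C1_dir Ch _ _).2)).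
congr (_ + _).
  have -> : (dx, 0) = \sum_k dx 0 k *: (e_ k, 0) :> vec * vec.
    rewrite {1}(row_sum_e dx); elim/big_ind2 : _ => //.
      by move=> a a' b b' <- <-; congr (_, _); rewrite /= addr0.
    by move=> k _; congr (_, _); rewrite /= scaler0.
  rewrite (is_derive_val (is_derive_lincomb Ch _ _ _ _)).
  by apply: eq_bigr => k _; rewrite -(proj2 (derive_slice1 h _ _ _)).
have -> : (0, dp) = \sum_k dp 0 k *: (0, e_ k) :> vec * vec.
  rewrite {1}(row_sum_e dp); elim/big_ind2 : _ => //.
    by move=> a a' b b' <- <-; congr (_, _); rewrite /= addr0.
  by move=> k _; congr (_, _); rewrite /= scaler0.
rewrite (is_derive_val (is_derive_lincomb Ch _ _ _ _)).
by apply: eq_bigr => k _; rewrite -(proj2 (derive_slice2 h _ _ _)).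
Qed.

Lemma partials_continuous H : class_C 1 (fun z : vec * vec => H z.1 z.2) ->
  forall k, continuous (fun z : vec * vec => 'D_(e_ k) (H ^~ z.2) z.1) /\
            continuous (fun z : vec * vec => 'D_(e_ k) (H z.1) z.2).
Proof.
set h := fun z : vec * vec => H z.1 z.2 => Ch k; split.
  have -> : (fun z : vec * vec => 'D_(e_ k) (H ^~ z.2) z.1) = 'D_(e_ k, 0) h.
    by apply/funext => -[x p]; rewrite -(proj2 (derive_slice1 h _ _ _)).
  by move=> z; exact: (class_C1_dir Ch _ z).2.
have -> : (fun z : vec * vec => 'D_(e_ k) (H z.1) z.2) = 'D_(0, e_ k) h.
  by apply/funext => -[x p]; rewrite -(proj2 (derive_slice2 h _ _ _)).
by move=> z; exact: (class_C1_dir Ch _ z).2.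
Qed.

(** On the segment from [p] to [q] the second derivative is at least [2 theta |q - p|^2]. Hence,
    after subtracting the tangent and [theta N s^2], the remainder [m] has a nonnegative derivative
    on [[0, 1]]. *)
Lemma convex_taylor (theta : R) H x : class_C 2 (H x) ->
  (forall p, loewner_le (2 * theta)%:M (hessian (H x) p)) ->
  forall p q : vec,
    H x p + \sum_k (q 0 k - p 0 k) * 'D_(e_ k) (H x) p
      + theta * \sum_k (q 0 k - p 0 k) ^+ 2 <= H x q.
Proof.
move=> C2 hess p q; set xi := q - p.
have C1 := class_C_le C2.
have C1k k : class_C 1 ('D_(e_ k) (H x)) by case: C2 => _ /(_ (e_ k)) [].
pose g s := H x (p + s *: xi).
pose g1 s := \sum_k xi 0 k * 'D_(e_ k) (H x) (p + s *: xi).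
pose g2 s := \sum_k xi 0 k * \sum_j xi 0 j * 'D_(e_ j) ('D_(e_ k) (H x)) (p + s *: xi).
have dg (s : R) : is_derive s 1 g (g1 s).
  have D := derive_coord (p + s *: xi) xi C1.
  by rewrite /g1 -(is_derive_val (D)); apply: is_derive_line; exact: ex_derive.
have dg1 (s : R) : is_derive s 1 g1 (g2 s).
  have dk k : is_derive s 1 (fun s => xi 0 k * 'D_(e_ k) (H x) (p + s *: xi))
      (xi 0 k * \sum_j xi 0 j * 'D_(e_ j) ('D_(e_ k) (H x)) (p + s *: xi)).
    have D := derive_coord (p + s *: xi) xi (C1k k).
    rewrite -(is_derive_val D).
    have Dl := is_derive_line (is_derive_derivable D).
    exact: (@is_deriveZ R R R (fun s => 'D_(e_ k) (H x) (p + s *: xi)) (xi 0 k)).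
  have -> : g1 = \sum_k (fun s => xi 0 k * 'D_(e_ k) (H x) (p + s *: xi)).
    by apply/funext => r; rewrite fct_sumE.
  exact: is_derive_sum.
pose N := \sum_k xi 0 k ^+ 2.
have g2N s : 2 * theta * N <= g2 s.
  have := hess (p + s *: xi) xi; rewrite mulmxBr mulmxBl [X in 0 <= X]mxE [X in _ + X]mxE subr_ge0.
  have -> : ((2 * theta)%:M : 'M[R]_n) = (2 * theta) *: 1%:M by rewrite scalemx1.
  rewrite -scalemxAr -scalemxAl mulmx1 mxE => L.
  have -> : N = (xi *m xi^T) 0 0.
    by rewrite mxE; apply: eq_bigr => k _; rewrite !mxE expr2.
  apply: (le_trans L); rewrite mxE le_eqVlt; apply/orP; left; apply/eqP.
  transitivity (\sum_j \sum_k xi 0 j * (xi 0 k * hessian (H x) (p + s *: xi) k j)).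
    apply: eq_bigr => j _; rewrite !mxE mulr_suml; apply: eq_bigr => k _.
    by rewrite mulrC.
  rewrite exchange_big; apply: eq_bigr => k _; rewrite mulr_sumr.
  by apply: eq_bigr => j _; rewrite [hessian _ _ _ _]mxE mulrCA.
pose m s := g s - g1 0 * s - theta * N * s ^+ 2.
have dm (s : R) : is_derive s 1 m (g1 s - g1 0 - 2 * theta * N * s).
  by apply: is_derive_eq; rewrite /GRing.scale /=; ring.
have [s /andP[s0 s1]] := mvt1 (f' := fun s => g1 s - g1 0 - 2 * theta * N * s)
  (a := 0) (h := 1) (fun c _ => dm (0 + c * 1)).
rewrite !add0r mulr1 mul1r => E1.
have [c _] := mvt1 (f' := g2) (a := 0) (h := s) (fun c _ => dg1 (0 + c * s)).
rewrite add0r => E2.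
have : 0 <= m 1 - m 0.
  rewrite E1 E2 -[X in _ - X]mulrC -mulrBr mulr_ge0 // subr_ge0.
  exact: g2N.
rewrite /m /g /g1 scale1r scale0r addr0 /xi [p + _]addrC subrK -/xi.
have -> : N = \sum_k (q 0 k - p 0 k) ^+ 2.
  by apply: eq_bigr => k _; rewrite !mxE.
have -> : \sum_k xi 0 k * 'D_(e_ k) (H x) p =
   \sum_k (q 0 k - p 0 k) * 'D_(e_ k) (H x) p.
  by apply: eq_bigr => k _; rewrite !mxE.
by lra.
Qed.
End Torus.

(** * First and second derivative tests at a maximum *)

Section MaximumTests.
Context {R : realType}.

(** [g1] is only known to be differentiable at [0]. If [l] were positive, [g1] would be positive
    just to the right of [0], and the mean value theorem would give [g s0 > g 0]. *)
Lemma second_derivative_max (g g1 : R -> R) (l d : R) : 0 < d ->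
  (forall s : R, `|s| < d -> is_derive s 1 g (g1 s)) -> is_derive (0 : R) 1 g1 l ->
  (forall s : R, `|s| < d -> g s <= g 0) -> g1 0 = 0 /\ l <= 0.
Proof.
move=> d0 dg dg1 gmax.
have absd (s : R) : s \in `]- d, d[%R -> `|s| < d.
  by rewrite in_itv /= ltr_norml.
have g10 : g1 0 = 0.
  have z0 : (0 : R) \in `]- d, d[%R by rewrite in_itv /= oppr_lt0 d0.
  have D := @derive1_at_max R g (- d) d 0 _ _ z0 _.
  have := D (ltW (lt_trans (_ : - d < 0) d0)) _ _.
  rewrite oppr_lt0 => /(_ d0) E.
  rewrite -(is_derive_val (dg 0 _)) ?normr0 //; apply: is_derive_val; apply: E.
    by move=> t /absd /dg; exact: is_derive_derivable.
  by move=> t /absd; exact: gmax.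
split=> //; rewrite leNgt; apply/negP => l0.
have /cvgrPdist_lt /(_ l l0) H : (fun h => h^-1 *: ((g1 \o shift 0) (h *: 1) - g1 0)) @ 0^' --> l.
  by case: dg1 => D <-; exact: D.
have [r r0 Hr] : exists2 r, 0 < r & forall h : R, 0 < h < r -> 0 < g1 h.
  move: H => [r /= r0 Hr]; exists r => // h /andP[h0 hr].
  have := Hr h; rewrite /ball_ /= sub0r normrN (gtr0_norm h0) gt_eqF // => /(_ hr isT).
  rewrite [h%:A]mulr1 addr0 g10 subr0 => K.
  have : 0 < h^-1 * g1 h.
    by move: K; rewrite ltr_norml => /andP[_]; rewrite gtrBl.
  by rewrite pmulr_rgt0 // invr_gt0.
pose s0 := Num.min d r / 2.
have m0 : 0 < Num.min d r by rewrite lt_min d0.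
have s00 : 0 < s0 by rewrite divr_gt0.
have : s0 < Num.min d r by rewrite ltr_pdivrMr // ltr_pMr // ltr1n.
rewrite lt_min => /andP[sd sr].
have cg : {within `[0, s0], continuous g}.
  apply: derivable_within_continuous => s; rewrite in_itv /= => /andP[a b].
  by apply: is_derive_derivable (dg _ _); rewrite ger0_norm //; exact: le_lt_trans sd.
have dg' (s : R) : s \in `]0, s0[%R -> is_derive s 1 g (g1 s).
  rewrite in_itv /= => /andP[a b]; apply: dg; rewrite gtr0_norm //.
  exact: lt_trans sd.
have [c] := MVT s00 dg' cg.
rewrite in_itv /= subr0 => /andP[c0 cs] E.
have : g s0 <= g 0 by apply: gmax; rewrite gtr0_norm.
rewrite -subr_le0 E pmulr_lle0 // leNgt => /negP; apply; apply: Hr.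
by rewrite c0 (lt_trans cs).
Qed.

Lemma local_max_direction {V : normedModType R} (f : V -> R) (x v : V) (f1 : V -> R) (l : R) :
  (forall y, is_derive y v f (f1 y)) -> is_derive x v f1 l ->
  (\forall y \near x, f y <= f x) -> f1 x = 0 /\ l <= 0.
Proof.
move=> df df1 /nbhs_ballP[d d0 H].
have v0 : 0 < `|v| + 1 by rewrite ltr_wpDl.
have Dl (s : R) : is_derive s 1 (fun s => f (x + s *: v)) (f1 (x + s *: v)).
  rewrite -(is_derive_val (df (x + s *: v))); apply: is_derive_line.
  exact: is_derive_derivable (df _).
have Dl1 : is_derive (0 : R) 1 (fun s => f1 (x + s *: v)) l.
  have D0 : is_derive (x + (0 : R) *: v) v f1 l by rewrite scale0r addr0.
  rewrite -(is_derive_val D0); apply: is_derive_line.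
  exact: is_derive_derivable D0.
have := @second_derivative_max _ _ l (d / (`|v| + 1)) _ (fun s _ => Dl s) Dl1.
rewrite scale0r addr0 divr_gt0 //; apply=> // s.
rewrite ltr_pdivlMr // => sd; apply: H.
rewrite -ball_normE /= opprD addrA subrr add0r normrN normrZ.
by apply: le_lt_trans sd; rewrite ler_wpM2l // lerDl.
Qed.

(** Only earlier times are compared, since a maximum in time may sit at the final time. *)
Lemma left_max_derive (f : R -> R) (t a d : R) : a < t ->
  is_derive t 1 f d -> (forall s, a <= s <= t -> f s <= f t) -> 0 <= d.
Proof.
move=> at0 D fmax; rewrite leNgt; apply/negP => d0.
have nd0 : 0 < - d by rewrite oppr_gt0.
have /cvgrPdist_lt /(_ _ nd0) [r /= r0 Hr] : (fun h => h^-1 *: ((f \o shift t) (h *: 1) - f t)) @ 0^' --> d.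
  by case: D => D <-; exact: D.
have m0 : 0 < Num.min r (t - a) by rewrite lt_min r0 subr_gt0.
pose h := Num.min r (t - a) / 2.
have h0 : 0 < h by rewrite divr_gt0.
have : h < Num.min r (t - a) by rewrite ltr_pdivrMr // ltr_pMr // ltr1n.
rewrite lt_min => /andP[hr ha].
have := Hr (- h); rewrite /ball_ /= sub0r opprK (gtr0_norm h0) oppr_eq0 gt_eqF //.
move=> /(_ hr isT); rewrite [(- h)%:A]mulr1 invrN ltr_norml opprK => /andP[K _].
have : f (- h + t) <= f t.
  apply: fmax; rewrite addrC lerBrDl -lerBrDr ltW //=.
  by rewrite lerBlDr lerDl ltW.
rewrite -subr_le0 => L.
have : 0 <= - h^-1 * (f (- h + t) - f t).
  by rewrite mulNr oppr_ge0 pmulr_rle0 // invr_gt0.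
set X := - h^-1 * _ => X0; have {}K : d < d - X by [].
by lra.
Qed.

End MaximumTests.

(** * Maximum principle for a pair of periodic functions with doubled space variables *)

Section MaximumPrinciple.
Context {R : realType} {n : nat}.
Local Notation vec := 'rV[R]_n.

(** Invariant under a common translation of [x] and [y], hence compact modulo integer
    translations. *)
Definition near_diag (r : R) (x y : vec) : Prop :=
  forall k, `|y 0 k - x 0 k| <= r.

Lemma cube_compact (a b : R) :
  compact [set v : vec | forall k, v 0 k \in `[a, b]].
Proof.
apply: (@rV_compact _ n (fun=> `[a, b]%classic)) => _; exact: segment_compact.
Qed.

Lemma torus_representative (x : vec) :
  exists k : 'rV[int]_n, forall j, (x + map_mx intr k) 0 j \in `[0, 1].
Proof.
exists (\row_j (- Num.floor (x 0 j))) => j; rewrite !mxE in_itv /= rmorphN /=.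
by rewrite subr_ge0 ge_floor /= lerBlDl; apply: ltW; rewrite -intrD1 lt_succ_floor.
Qed.

(** Raising the slope from [e] to [e + d'] makes the argument strict: a maximum of
    [F - (e + d') (t - a)] at a time after [a] would have a time derivative of at most [- d'],
    against [left_max_derive]. The derivative bound is asked only where [F] is maximal over both
    space variables and over the component, which is what allows a coupled system. *)
Lemma max_principle (F : bool -> R -> vec -> vec -> R) (a b r m e : R) :
  0 <= r ->
  (forall i, {within [set z : R * (vec * vec) | a <= z.1],
     continuous (fun z => F i z.1 z.2.1 z.2.2)}) ->
  (forall i t x y (k : 'rV[int]_n), a <= t ->
     F i t (x + map_mx intr k) (y + map_mx intr k) = F i t x y) ->
  (forall i x y, near_diag r x y -> F i a x y <= m) ->
  (forall i t x y, a < t <= b -> near_diag r x y ->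
     (forall j x' y', near_diag r x' y' -> F j t x' y' <= F i t x y) ->
     exists2 d, is_derive t 1 (fun s => F i s x y) d & d <= e) ->
  forall i t x y, a <= t <= b -> near_diag r x y -> F i t x y <= m + e * (t - a).
Proof.
move=> r0 cF pF Fa Fd i t x y atb xy.
apply/ler_addgt0Pr => d d0.
have [ta|nta] := eqVneq a t; first by rewrite -ta subrr mulr0 addr0 ler_wpDr ?Fa // ltW.
have at0 : 0 < t - a by rewrite subr_gt0 lt_neqAle nta; case/andP: atb.
pose d' := d / (t - a); have d'0 : 0 < d' by rewrite divr_gt0.
(* The last coordinate stands for [y - x], so that the strip around the diagonal, modulo integer
   translations, becomes a product of compact cubes. *)
pose K : set (R * (vec * vec)) := `[a, b] `*` ([set v : vec | forall k, v 0 k \in `[0, 1]]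
   `*` [set v : vec | forall k, v 0 k \in `[- r, r]]).
pose G j (z : R * (vec * vec)) := F j z.1 z.2.1 (z.2.1 + z.2.2) - (e + d') * (z.1 - a).
have cK : compact K.
  by apply: compact_setX; [exact: segment_compact|apply: compact_setX; exact: cube_compact].
have K0 : K !=set0.
  exists (t, (0, 0)); split => /=; first by rewrite in_itv.
  by split=> k /=; rewrite !mxE in_itv /= ?lexx ?ler01 // oppr_le0 r0.
have cG j : {within K, continuous (G j)}.
  apply/subspace_continuousP => z Kz; apply: cvgB; last first.
    apply: cvg_within_filter; apply: cvgM; first exact: cvg_cst.
    by apply: cvgB; [exact: cvg_fst|exact: cvg_cst].
  pose emb (z : R * (vec * vec)) := (z.1, (z.2.1, z.2.1 + z.2.2)).
  have c21 : (fun z : R * (vec * vec) => z.2.1) @ nbhs z --> z.2.1.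
    by apply: (@cvg_comp _ _ _ snd fst); [exact: cvg_snd|exact: cvg_fst].
  have c22 : (fun z : R * (vec * vec) => z.2.2) @ nbhs z --> z.2.2.
    by apply: (@cvg_comp _ _ _ snd snd); [exact: cvg_snd|exact: cvg_snd].
  have cemb : emb @ nbhs z --> emb z.
    exact: (cvg_pair (cvg_fst (F := nbhs z.1) (G := nbhs z.2)) (cvg_pair c21 (cvgD c21 c22))).
  have /subspace_continuousP /(_ (emb z)) := cF j.
  have az : a <= (emb z).1 by case: Kz; rewrite /= in_itv => /andP[].
  move=> /(_ az) cFz.
  suff ce : emb @ within K (nbhs z) `=>` within [set z | a <= z.1] (nbhs (emb z)).
    apply: (@cvg_comp _ _ _ emb (fun z => F j z.1 z.2.1 z.2.2) _ _ _ ce).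
    exact: cFz.
  move=> U HU.
  have HU2 : \forall v \near z, a <= (emb v).1 -> U (emb v) := cemb _ HU.
  change (\forall v \near z, K v -> U (emb v)).
  apply: filterS HU2 => v HUv Kv; apply: HUv.
  by case: Kv; rewrite /= in_itv => /andP[].
have KG j s u v : a <= s <= b -> near_diag r u v -> exists2 z, z \in K & G j z = F j s u v - (e + d') * (s - a)  /\ z.1 = s.
  move=> asb uv; have [k ku] := torus_representative u.
  exists (s, (u + map_mx intr k, v - u)).
    rewrite inE; split; first by rewrite /= in_itv.
    by split=> //= l; rewrite !mxE in_itv /= -ler_norml; exact: uv.
  split=> //; rewrite /G /= addrAC [u + (v - u)]addrC subrK pF //.
  by case/andP: asb.
have [c0 c0K m0] := compact_EVT_max K0 cK (cG true).
have [c1 c1K m1] := compact_EVT_max K0 cK (cG false).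
have [j [c cKc mc]] : exists j, exists2 c, c \in K & forall l z, z \in K -> G l z <= G j c.
  have [L|L] := leP (G false c1) (G true c0).
    exists true, c0 => // -[] z zK; first exact: m0.
    exact: le_trans (m1 _ zK) L.
  exists false, c1 => // -[] z zK; last exact: m1.
  exact: le_trans (m0 _ zK) (ltW L).
suff cm : G j c <= m.
  have [z zK [zE _]] := KG i t x y atb xy.
  have := le_trans (mc i z zK) cm; rewrite zE.
  by rewrite mulrDl [d' * _]divfK ?gt_eqF // lerBlDr addrA.
move: cKc; rewrite inE => -[ct [cx cd]].
have cdg : near_diag r c.2.1 (c.2.1 + c.2.2).
  by move=> k; rewrite !mxE addrAC subrr add0r ler_norml; have := cd k; rewrite in_itv.
have {}ct : a <= c.1 <= b by move: ct; rewrite /= in_itv.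
have [ca|ca] := leP c.1 a.
  have E : c.1 = a by apply/eqP; rewrite eq_le ca; case/andP: ct.
  by rewrite /G E subrr mulr0 subr0; exact: Fa.
have [|l u v uv|f Df fe] := Fd j c.1 _ _ _ cdg.
- by rewrite ca; case/andP: ct.
- have [z zK [zE zt]] := KG l c.1 u v ct uv.
  by have := mc l z zK; rewrite zE /G lerD2r.
have DG : is_derive c.1 1 (fun s => F j s c.2.1 (c.2.1 + c.2.2) - (e + d') * (s - a)) (f - (e + d')).
  by apply: is_derive_eq; rewrite /GRing.scale /=; ring.
have := left_max_derive ca DG _; suff : ~ (0 <= f - (e + d')).
  move=> N N2; exfalso; apply: N; apply: N2 => s /andP[as_ sc].
  have sb : a <= s <= b by rewrite as_ (le_trans sc) //; case/andP: ct.
  by have [z zK [zE _]] := KG j s _ _ sb cdg; rewrite -zE; exact: mc.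
apply/negP; rewrite -ltNge subr_lt0; apply: (le_lt_trans fe); by rewrite ltrDl.
Qed.

End MaximumPrinciple.

(** * Chain rule for a Hamiltonian along a curve *)

Section Curves.
Context {R : realType} {n : nat}.
Local Notation vec := 'rV[R]_n.

Lemma cvg_sumr {T : Type} {F : set_system T} {FF : Filter F} (m : nat)
    (f : 'I_m -> T -> R) (a : 'I_m -> R) :
  (forall k, f k z @[z --> F] --> a k) ->
  \sum_k f k z @[z --> F] --> \sum_k a k.
Proof. by move=> fa; apply: cvg_big => //; exact: add_continuous. Qed.

Lemma is_derive_row (P : R -> vec) (r : R) (dP : vec) :
  (forall k, is_derive r 1 (fun s => P s 0 k) (dP 0 k)) -> is_derive r 1 P dP.
Proof.
move=> dk; have D : derivable P r 1.
  by apply/derivable_mxP => i j; rewrite ord1; exact: is_derive_derivable (dk j).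
split=> //; rewrite derive_mx //; apply/rowP => j; rewrite mxE.
exact: is_derive_val (dk j).
Qed.

Lemma is_derive_coord (P : R -> vec) (r : R) (dP : vec) k :
  is_derive r 1 P dP -> is_derive r 1 (fun s => P s 0 k) (dP 0 k).
Proof.
move=> [D <-]; rewrite derive_mx // mxE; apply: derivableP.
by have /derivable_mxP := D; apply.
Qed.

Lemma is_derive_increment0 (P : R -> vec) (r : R) (dP : vec) :
  is_derive r 1 P dP -> (fun h => P (h + r) - P r) @ 0^' --> (0 : vec).
Proof.
move=> [/derivable1_diffP/differentiable_continuous cP _].
suff L0 : (fun h => P (h + r) - P r) @ (0 : R) --> (0 : vec).
  by apply: (cvg_trans _ L0); apply: cvg_app; exact: cvg_within.
have : (fun h => P (h + r)) @ (0 : R) --> P r.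
  apply: (@cvg_comp _ _ _ (fun h => h + r) P _ (nbhs r)); last exact: cP.
  have c0 : (fun h : R => h + r) @ (0 : R) --> 0 + r.
    by apply: cvgD; [exact: cvg_id|exact: cvg_cst].
  by move: c0; rewrite add0r.
by move=> L; rewrite -(subrr (P r)); exact: (cvgB L (cvg_cst (P r))).
Qed.

(** The increment is exactly linear in the increments of [X] and [P], with partial derivatives taken
    at an intermediate point [Z h]. As [h] tends to [0], [Z h] tends to [(X r, P r)] and the
    continuity of the partial derivatives concludes. *)
Lemma is_derive_curve (H : vec -> vec -> R) (X P : R -> vec) (r : R) (dX dP : vec) :
  class_C 1 (fun z : vec * vec => H z.1 z.2) ->
  is_derive r 1 X dX -> is_derive r 1 P dP ->
  is_derive r 1 (fun s => H (X s) (P s))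
    (\sum_k dX 0 k * 'D_(e_ k) (H ^~ (P r)) (X r)
     + \sum_k dP 0 k * 'D_(e_ k) (H (X r)) (P r)).
Proof.
move=> CH dX_ dP_; set L := (X in is_derive _ _ _ X).
have /choice [c Hc] : forall h : R, exists c : R, 0 <= c <= 1 /\
    H (X (h + r)) (P (h + r)) - H (X r) (P r) =
    \sum_k (X (h + r) - X r) 0 k * 'D_(e_ k) (H ^~ (P r + c *: (P (h + r) - P r))) (X r + c *: (X (h + r) - X r)) +
    \sum_k (P (h + r) - P r) 0 k * 'D_(e_ k) (H (X r + c *: (X (h + r) - X r))) (P r + c *: (P (h + r) - P r)).
  move=> h; have [c c01 E] := mean_value_pair CH (X r) (P r) (X (h + r) - X r) (P (h + r) - P r).
  have EQ (Q : R -> vec) : Q r + (Q (h + r) - Q r) = Q (h + r) by rewrite addrC subrK.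
  by exists c; split => //; rewrite -E !EQ.
pose Z h := (X r + c h *: (X (h + r) - X r), P r + c h *: (P (h + r) - P r)).
have cZ (Q : R -> vec) dQ : is_derive r 1 Q dQ ->
    (fun h => Q r + c h *: (Q (h + r) - Q r)) @ 0^' --> Q r.
  move=> /is_derive_increment0 /cvgrPdist_le Q0; apply/cvgrPdist_le => e e0.
  have := Q0 e e0; apply: filterS => h; rewrite sub0r normrN => Qh.
  have [/andP[c0 c1] _] := Hc h.
  rewrite opprD addrA subrr add0r normrN normrZ ger0_norm //.
  by apply: le_trans Qh; rewrite ler_piMl.
have cZZ : Z h @[h --> 0^'] --> (X r, P r).
  exact: (cvg_pair (cZ _ _ dX_) (cZ _ _ dP_)).
suff Lc : (fun h => h^-1 *: (((fun s => H (X s) (P s)) \o shift r) (h *: 1)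
     - H (X r) (P r))) @ 0^' --> L.
  by split; [apply/cvg_ex; exists L|exact: cvg_lim Lc].
have -> : (fun h => h^-1 *: (((fun s => H (X s) (P s)) \o shift r) (h *: 1)
     - H (X r) (P r))) = (fun h =>
   \sum_k (h^-1 *: (X (h + r) 0 k - X r 0 k)) * 'D_(e_ k) (H ^~ (Z h).2) (Z h).1 +
   \sum_k (h^-1 *: (P (h + r) 0 k - P r 0 k)) * 'D_(e_ k) (H (Z h).1) (Z h).2).
  apply/funext => h /=; rewrite [h%:A]mulr1; have [_ ->] := Hc h.
  rewrite scalerDr !scaler_sumr; congr (_ + _); apply: eq_bigr => k _.
    by rewrite -scalerAl !mxE.
  by rewrite -scalerAl !mxE.
have quot (Q : R -> vec) dQ k : is_derive r 1 Q dQ ->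
    (fun h => h^-1 *: (Q (h + r) 0 k - Q r 0 k)) @ 0^' --> dQ 0 k.
  move=> /(is_derive_coord k) [D <-]; have := D; rewrite /derivable => D1.
  apply: cvg_trans D1; apply: near_eq_cvg; apply: nearW => h /=.
  by rewrite [h%:A]mulr1.
apply: cvgD; apply: cvg_sumr => k; apply: cvgM.
- exact: quot dX_.
- have [cx _] := partials_continuous CH k.
  exact: (@cvg_comp _ _ _ Z (fun z : vec * vec => 'D_(e_ k) (H ^~ z.2) z.1) _ _ _ cZZ (cx _)).
- exact: quot dP_.
- have [_ cp] := partials_continuous CH k.
  exact: (@cvg_comp _ _ _ Z (fun z : vec * vec => 'D_(e_ k) (H z.1) z.2) _ _ _ cZZ (cp _)).
Qed.

End Curves.

(** * Exchange of derivatives of the regularized solution *)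

Section Regularity.
Context {R : realType} {n : nat}.
Local Notation vec := 'rV[R]_n.
Implicit Types w : R -> vec -> R.

Lemma class_C12_space w (t : R) (x : vec) : class_C12 w -> 0 < t ->
  forall k, is_derive x (e_ k) (w t) ('D_(e_ k) (w t) x).
Proof. by move=> /(_ t x) W /W[_ + _ _] => D k; exact: derivableP. Qed.

Lemma class_C12_space2 w (t : R) (x : vec) : class_C12 w -> 0 < t ->
  forall j k, is_derive x (e_ k) ('D_(e_ j) (w t)) ('D_(e_ k) ('D_(e_ j) (w t)) x).
Proof. by move=> /(_ t x) W /W[_ _ + _] => D j k; exact: derivableP. Qed.

Lemma class_C12_time w (t : R) (x : vec) : class_C12 w -> 0 < t ->
  is_derive t 1 (w ^~ x) (dt w t x).
Proof. by move=> /(_ t x) W /W[+ _ _ _] => D; rewrite /dt derive1E; exact: derivableP. Qed.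

(** [mixed_derivative] in the plane through [x] spanned by [e_ j] and [e_ k]. *)
Lemma space_derivatives_commute w (t : R) (x : vec) j k : class_C12 w -> 0 < t ->
  'D_(e_ k) ('D_(e_ j) (w t)) x = 'D_(e_ j) ('D_(e_ k) (w t)) x.
Proof.
move=> W t0.
have shiftD (f : vec -> R) (y v : vec) (r : R) : (forall z, derivable f z v) ->
    is_derive r 1 (fun s => f (y + s *: v)) ('D_v f (y + r *: v)).
  by move=> df; exact: is_derive_line.
have D := @mixed_derivative R (fun a b => w t (x + b *: e_ k + a *: e_ j))
  (fun a b => 'D_(e_ j) (w t) (x + b *: e_ k + a *: e_ j))
  (fun a b => 'D_(e_ k) ('D_(e_ j) (w t)) (x + a *: e_ j + b *: e_ k))
  (fun a => 'D_(e_ k) (w t) (x + a *: e_ j)) 0 0 1 ltr01.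
have h1 (a b : R) : `|a - 0| < 1 ->
    is_derive a 1 (fun a : R => w t (x + b *: e_ k + a *: e_ j))
      ('D_(e_ j) (w t) (x + b *: e_ k + a *: e_ j)).
  move=> _; apply: (shiftD (w t)) => z.
  exact: is_derive_derivable (class_C12_space z W t0 j).
have h2 (a b : R) : `|a - 0| < 1 ->
    is_derive b 1 (fun b : R => 'D_(e_ j) (w t) (x + b *: e_ k + a *: e_ j))
      ('D_(e_ k) ('D_(e_ j) (w t)) (x + a *: e_ j + b *: e_ k)).
  move=> _; have -> : (fun b => 'D_(e_ j) (w t) (x + b *: e_ k + a *: e_ j)) =
    (fun b => 'D_(e_ j) (w t) (x + a *: e_ j + b *: e_ k)).
    by apply/funext => s; rewrite addrAC.
  apply: (shiftD ('D_(e_ j) (w t))) => z.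
  exact: is_derive_derivable (class_C12_space2 z W t0 j k).
have h3 (a : R) : `|a - 0| < 1 ->
    is_derive (0 : R) 1 (fun b : R => w t (x + b *: e_ k + a *: e_ j))
      ('D_(e_ k) (w t) (x + a *: e_ j)).
  move=> _; have -> : (fun b => w t (x + b *: e_ k + a *: e_ j)) =
    (fun b => w t (x + a *: e_ j + b *: e_ k)).
    by apply/funext => s; rewrite addrAC.
  have := shiftD (w t) (x + a *: e_ j) (e_ k) 0.
  rewrite scale0r addr0; apply => z.
  exact: is_derive_derivable (class_C12_space z W t0 k).
have h4 : {for ((0 : R), (0 : R)), continuous (fun z : R * R =>
    'D_(e_ k) ('D_(e_ j) (w t)) (x + z.1 *: e_ j + z.2 *: e_ k))}.
  have [_ _ _ [_ _ _ /(_ j k) c]] := W t (x + (0 : R) *: e_ j + (0 : R) *: e_ k) t0.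
  apply: (@cvg_comp _ _ _ (fun z : R * R => (t, x + z.1 *: e_ j + z.2 *: e_ k))
    (fun z => 'D_(e_ k) ('D_(e_ j) (w z.1)) z.2) _ _ _ _ c).
  have c1 : (fun z : R * R => z.1 *: (e_ j : vec)) @ nbhs ((0 : R), (0 : R)) --> (0 : R) *: (e_ j : vec).
    by apply: cvgZr_tmp; exact: cvg_fst.
  have c2 : (fun z : R * R => z.2 *: (e_ k : vec)) @ nbhs ((0 : R), (0 : R)) --> (0 : R) *: (e_ k : vec).
    by apply: cvgZr_tmp; exact: cvg_snd.
  exact: (cvg_pair (cvg_cst t) (cvgD (cvgD (cvg_cst x) c1) c2)).
have := D h1 h2 h3 h4; rewrite !scale0r !addr0 => Dj.
have := @line_is_derive _ _ ('D_(e_ k) (w t)) x (e_ j) _ Dj.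
by move/is_derive_val => ->.
Qed.

Lemma time_derivative_commutes w (t : R) (x : vec) k : class_C12 w -> 0 < t ->
  (forall s y, 0 < s -> derivable (dt w s) y (e_ k)) ->
  cont_at (fun s => 'D_(e_ k) (dt w s)) t x ->
  is_derive t 1 (fun s => 'D_(e_ k) (w s) x) ('D_(e_ k) (dt w t) x).
Proof.
move=> W t0 dw cw.
(* The window of half-width [t] around [t] contains only positive times, where the regularity
   holds. *)
have pos a : `|a - t| < t -> 0 < a by rewrite ltr_norml => /andP[]; lra.
have := @mixed_derivative R (fun a b => w a (x + b *: e_ k))
  (fun a b => dt w a (x + b *: e_ k)) (fun a b => 'D_(e_ k) (dt w a) (x + b *: e_ k))
  (fun a => 'D_(e_ k) (w a) x) t 0 t t0.
rewrite scale0r addr0; apply.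
- by move=> a b /pos a0; exact: class_C12_time.
- by move=> a b /pos a0; apply: is_derive_line; exact: dw.
- move=> a /pos a0; have := @is_derive_line R _ (w a) x (e_ k) 0.
  by rewrite scale0r addr0; apply; exact: is_derive_derivable (class_C12_space x W a0 k).
- apply: (@cvg_comp _ _ _ (fun z : R * R => (z.1, x + z.2 *: e_ k))
      (fun z => 'D_(e_ k) (dt w z.1) z.2) _ (nbhs (t, x))); last first.
    by rewrite /= scale0r addr0; exact: cw.
  have c2 : (fun z : R * R => z.2 *: (e_ k : vec)) @ nbhs (t, (0 : R)) --> (0 : R) *: (e_ k : vec).
    by apply: cvgZr_tmp; exact: cvg_snd.
  have c3 : (fun z : R * R => (z.1, x + z.2 *: e_ k)) @ (t, (0 : R)) --> (t, x + (0 : R) *: e_ k).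
    exact: (cvg_pair (cvg_fst (F := nbhs t) (G := nbhs (0 : R))) (cvgD (cvg_cst x) c2)).
  by move: c3; rewrite scale0r addr0.
Qed.

End Regularity.

Section Smooth.
Context {R : realType} {n : nat}.
Local Notation vec := 'rV[R]_n.
Implicit Types (w : R -> vec -> R).

Lemma laplacianE (f : vec -> R) x : laplacian f x = \sum_j 'D_(e_ j) ('D_(e_ j) f) x.
Proof. by rewrite /laplacian /mxtrace; apply: eq_bigr => j _; rewrite mxE. Qed.

Lemma smooth_pos_dt_grad w (t : R) (x : vec) k : smooth_pos w -> 0 < t ->
  is_derive t 1 (fun s => 'D_(e_ k) (w s) x) ('D_(e_ k) (dt w t) x).
Proof.
move=> [W Wt _] t0; apply: time_derivative_commutes => //.
  by move=> s y s0; exact: is_derive_derivable (class_C12_space y Wt s0 k).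
by have [_ _ _ [_ _ + _]] := Wt t x t0; apply.
Qed.

Lemma smooth_pos_dt_gradE w (t : R) (x : vec) k : smooth_pos w -> 0 < t ->
  dt (fun s => 'D_(e_ k) (w s)) t x = 'D_(e_ k) (dt w t) x.
Proof.
by move=> W t0; rewrite /dt derive1E; exact: is_derive_val (smooth_pos_dt_grad x k W t0).
Qed.

Lemma cont_at_eq (f g : R -> vec -> R) (t : R) (x : vec) : 0 < t ->
  (forall s y, 0 < s -> f s y = g s y) -> cont_at f t x -> cont_at g t x.
Proof.
move=> t0 fg cf; have : (fun z => f z.1 z.2) @ (t, x) --> g t x by rewrite -fg.
apply: cvg_trans; apply: near_eq_cvg.
have : \forall z \near (t, x), 0 < z.1.
  exact: (cvg_fst (F := nbhs t) (G := nbhs x) (lt_nbhsr t0)).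
by apply: filterS => z z0; rewrite fg.
Qed.

(** Two exchanges: [time_derivative_commutes] is applied to [D_k w], whose time derivative is
    already identified with [D_k w_t]. *)
Lemma smooth_pos_dt_hess w (t : R) (x : vec) k : smooth_pos w -> 0 < t ->
  is_derive t 1 (fun s => 'D_(e_ k) ('D_(e_ k) (w s)) x)
    ('D_(e_ k) ('D_(e_ k) (dt w t)) x).
Proof.
move=> Sw t0; have [W Wt Wk] := Sw.
have E s : 0 < s -> dt (fun s => 'D_(e_ k) (w s)) s = 'D_(e_ k) (dt w s).
  by move=> s0; apply/funext => y; exact: smooth_pos_dt_gradE.
have dE s y : 0 < s -> derivable (dt (fun s => 'D_(e_ k) (w s)) s) y (e_ k).
  by move=> s0; rewrite E //; exact: is_derive_derivable (class_C12_space2 y Wt s0 k k).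
have cE : cont_at (fun s => 'D_(e_ k) (dt (fun s => 'D_(e_ k) (w s)) s)) t x.
  have [_ _ _ [_ _ _ /(_ k k) c]] := Wt t x t0.
  have F s y : 0 < s -> 'D_(e_ k) ('D_(e_ k) (dt w s)) y =
      'D_(e_ k) (dt (fun s => 'D_(e_ k) (w s)) s) y.
    by move=> s0; exact: (congr1 (fun g => 'D_(e_ k) g y) (esym (E s s0))).
  exact: (@cont_at_eq (fun s => 'D_(e_ k) ('D_(e_ k) (dt w s)))
    (fun s => 'D_(e_ k) (dt (fun s => 'D_(e_ k) (w s)) s)) t x t0 F c).
have D := time_derivative_commutes (Wk k) t0 dE cE.
exact: (is_derive_eq D (congr1 (fun g => 'D_(e_ k) g x) (E t t0))).
Qed.

Lemma smooth_pos_third w (t : R) (x : vec) j k : smooth_pos w -> 0 < t ->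
  is_derive x (e_ k) ('D_(e_ j) ('D_(e_ j) (w t)))
    ('D_(e_ j) ('D_(e_ j) ('D_(e_ k) (w t))) x).
Proof.
move=> [W _ Wk] t0.
have D := class_C12_space2 x (Wk j) t0 j k.
have E1 : 'D_(e_ j) ('D_(e_ k) (w t)) = 'D_(e_ k) ('D_(e_ j) (w t)).
  by apply/funext => y; exact: space_derivatives_commute.
have E2 := space_derivatives_commute x j k (Wk j) t0.
have E : 'D_(e_ j) ('D_(e_ j) ('D_(e_ k) (w t))) x =
    'D_(e_ k) ('D_(e_ j) ('D_(e_ j) (w t))) x.
  exact: (etrans (congr1 (fun g => 'D_(e_ j) g x) E1) (esym E2)).
exact: (is_derive_eq D (esym E)).
Qed.

End Smooth.

(** * The system differentiated once in space and once in time *)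

Section System.
Context {R : realType} {n : nat}.
Local Notation vec := 'rV[R]_n.
Variables (H : bool -> vec -> vec -> R) (w : bool -> R -> vec -> R) (eps nu : R).
Hypothesis CH : forall i, class_C 1 (fun z : vec * vec => H i z.1 z.2).
Hypothesis Sw : forall i, smooth_pos (w i).
Hypothesis PDE : forall i t x, 0 < t ->
  eps * dt (w i) t x + H i x (grad (w i t) x) + w i t x - w (~~ i) t x
    = nu * laplacian (w i t) x.

Lemma hamiltonian_derive_space i (t : R) (x : vec) k : 0 < t ->
  is_derive x (e_ k) (fun y => H i y (grad (w i t) y))
    ('D_(e_ k) (H i ^~ (grad (w i t) x)) x +
     \sum_j 'D_(e_ k) ('D_(e_ j) (w i t)) x * 'D_(e_ j) (H i x) (grad (w i t) x)).
Proof.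
move=> t0; have [W _ _] := Sw i; apply: line_is_derive.
have dX : is_derive (0 : R) 1 (fun s : R => x + s *: (e_ k : vec)) (e_ k).
  apply: is_derive_row => j.
  have -> : (fun s : R => (x + s *: e_ k) 0 j) = (fun s => x 0 j + s * (e_ k : vec) 0 j).
    by apply/funext => s; rewrite !mxE.
  exact: is_derive_affine.
have dP : is_derive (0 : R) 1 (fun s : R => grad (w i t) (x + s *: e_ k))
    (\row_j 'D_(e_ k) ('D_(e_ j) (w i t)) x).
  apply: is_derive_row => j.
  have -> : (fun s : R => grad (w i t) (x + s *: e_ k) 0 j) =
      (fun s => 'D_(e_ j) (w i t) (x + s *: e_ k)).
    by apply/funext => s; rewrite mxE.
  have := @is_derive_line _ _ ('D_(e_ j) (w i t)) x (e_ k) 0.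
  rewrite scale0r addr0 mxE; apply.
  exact: is_derive_derivable (class_C12_space2 x W t0 j k).
have := is_derive_curve (CH i) dX dP; rewrite scale0r addr0.
congr is_derive; congr (_ + _); last by apply: eq_bigr => j _; rewrite mxE.
rewrite (bigD1 k) //= big1 ?addr0; first by rewrite mxE !eqxx mul1r.
by move=> j jk; rewrite mxE (negbTE jk) andbF mul0r.
Qed.

Lemma hamiltonian_derive_time i (t : R) (x : vec) : 0 < t ->
  is_derive t 1 (fun s => H i x (grad (w i s) x))
    (\sum_j 'D_(e_ j) (dt (w i) t) x * 'D_(e_ j) (H i x) (grad (w i t) x)).
Proof.
move=> t0.
have dX : is_derive t 1 (fun s : R => x) 0 := is_derive_cst x t 1.
have dP : is_derive t 1 (fun s : R => grad (w i s) x) (\row_j 'D_(e_ j) (dt (w i) t) x).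
  apply: is_derive_row => j.
  have -> : (fun s : R => grad (w i s) x 0 j) = (fun s => 'D_(e_ j) (w i s) x).
    by apply/funext => s; rewrite mxE.
  by rewrite mxE; exact: smooth_pos_dt_grad.
have := is_derive_curve (CH i) dX dP.
congr is_derive; rewrite big1 ?add0r; last by move=> j _; rewrite mxE mul0r.
by apply: eq_bigr => j _; rewrite mxE.
Qed.

Lemma system_eq i (t : R) (x : vec) : 0 < t ->
  eps * dt (w i) t x = nu * (\sum_j 'D_(e_ j) ('D_(e_ j) (w i t)) x)
    - H i x (grad (w i t) x) - (w i t x - w (~~ i) t x).
Proof. by move=> t0; rewrite -laplacianE -PDE //; ring. Qed.

Lemma system_space_derivative i (t : R) (x : vec) k : 0 < t ->
  eps * 'D_(e_ k) (dt (w i) t) x =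
    nu * (\sum_j 'D_(e_ j) ('D_(e_ j) ('D_(e_ k) (w i t))) x)
    - ('D_(e_ k) (H i ^~ (grad (w i t) x)) x +
     \sum_j 'D_(e_ k) ('D_(e_ j) (w i t)) x * 'D_(e_ j) (H i x) (grad (w i t) x))
    - ('D_(e_ k) (w i t) x - 'D_(e_ k) (w (~~ i) t) x).
Proof.
move=> t0; have [W Wt _] := Sw i; have [W' _ _] := Sw (~~ i).
have D1 : is_derive x (e_ k) (fun y => eps * dt (w i) t y) (eps * 'D_(e_ k) (dt (w i) t) x).
  by apply: (@is_deriveZ _ _ _ (dt (w i) t) eps); exact: class_C12_space.
rewrite -(is_derive_val D1).
have -> : (fun y => eps * dt (w i) t y) =
  (nu \*: (\sum_j 'D_(e_ j) ('D_(e_ j) (w i t))) - (fun y => H i y (grad (w i t) y))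
    - (w i t - w (~~ i) t)).
  apply/funext => y; rewrite system_eq // fctE; congr (_ * _ - _ - _).
  by rewrite fct_sumE.
apply: is_derive_val; apply: is_deriveB; first apply: is_deriveB.
- apply: is_deriveZ; apply: is_derive_sum => j; exact: smooth_pos_third.
- exact: hamiltonian_derive_space.
- by apply: is_deriveB; exact: class_C12_space.
Qed.

Lemma system_time_derivative i (t : R) (x : vec) : 0 < t ->
  eps * dt (dt (w i)) t x =
    nu * (\sum_j 'D_(e_ j) ('D_(e_ j) (dt (w i) t)) x)
    - \sum_j 'D_(e_ j) (dt (w i) t) x * 'D_(e_ j) (H i x) (grad (w i t) x)
    - (dt (w i) t x - dt (w (~~ i)) t x).
Proof.
move=> t0; have [W Wt _] := Sw i; have [W' _ _] := Sw (~~ i).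
have D1 : is_derive t 1 (fun s => eps * dt (w i) s x) (eps * dt (dt (w i)) t x).
  by apply: (@is_deriveZ R R R (fun s => dt (w i) s x) eps); exact: class_C12_time.
rewrite -(is_derive_val D1); apply: is_derive_val.
apply: (@near_eq_is_derive _ _ _
  (nu \*: (\sum_j (fun s => 'D_(e_ j) ('D_(e_ j) (w i s)) x)) - (fun s => H i x (grad (w i s) x))
    - ((fun s => w i s x) - (fun s => w (~~ i) s x)))).
  have : \forall s \near t, 0 < s by exact: lt_nbhsr.
  apply: filterS => s s0; rewrite system_eq // fctE; congr (_ * _ - _ - _).
  by rewrite fct_sumE.
apply: is_deriveB; first apply: is_deriveB.
- apply: is_deriveZ; apply: is_derive_sum => j; exact: smooth_pos_dt_hess.
- exact: hamiltonian_derive_time.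
- by apply: is_deriveB; exact: class_C12_time.
Qed.

End System.

(** * The quadratic penalization and continuity in the doubled variables *)

Section SquaredDistance.
Context {R : realType} {n : nat}.
Local Notation vec := 'rV[R]_n.

(** Euclidean, because the penalization has to be smooth and the max norm is not. *)
Definition sqdist (x y : vec) : R := \sum_k (x 0 k - y 0 k) ^+ 2.

Lemma sqdist_ge0 x y : 0 <= sqdist x y.
Proof. by apply: sumr_ge0 => k _; exact: sqr_ge0. Qed.

Lemma sqdistxx x : sqdist x x = 0.
Proof. by rewrite /sqdist big1 // => k _; rewrite subrr expr0n. Qed.

Lemma sqdistC x y : sqdist x y = sqdist y x.
Proof. by apply: eq_bigr => k _; rewrite -sqrrN opprB. Qed.

Lemma sqr_coord_le_sqdist (x y : vec) k : (x 0 k - y 0 k) ^+ 2 <= sqdist x y.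
Proof.
by rewrite /sqdist (bigD1 k) //= lerDl; apply: sumr_ge0 => j _; exact: sqr_ge0.
Qed.

Lemma sqdist_near_diag r x y : 0 <= r -> near_diag r x y -> sqdist x y <= n%:R * r ^+ 2.
Proof.
move=> r0 xy; rewrite -[n in n%:R]card_ord mulr_natl -sumr_const.
apply: ler_sum => k _; rewrite -sqrrN opprB -(ger0_norm r0) -real_normK ?num_real //.
by rewrite -[leRHS]real_normK ?num_real // normr_id lerXn2r ?nnegrE // (ger0_norm r0).
Qed.

Lemma is_derive_coordinate (x v : vec) j : is_derive x v (fun y : vec => y 0 j) (v 0 j).
Proof.
apply: line_is_derive.
have -> : (fun s : R => (x + s *: v) 0 j) = (fun s => x 0 j + s * v 0 j).
  by apply/funext => s; rewrite !mxE.
exact: is_derive_affine.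
Qed.

Lemma is_derive_coord_sub (x y : vec) j k :
  is_derive x (e_ k) (fun x' : vec => x' 0 j - y 0 j) (j == k)%:R.
Proof.
have D : is_derive x (e_ k) (fun x' : vec => x' 0 j) (j == k)%:R.
  have := is_derive_coordinate x (e_ k) j.
  by rewrite [X in is_derive _ _ _ X]mxE eqxx.
have := @is_deriveB _ _ _ (fun x' : vec => x' 0 j) (cst (y 0 j)) x (e_ k) _ 0 D
  (is_derive_cst _ _ _).
by rewrite subr0.
Qed.

Lemma is_derive_sqdist (x y : vec) k :
  is_derive x (e_ k) (sqdist ^~ y) (2 * (x 0 k - y 0 k)).
Proof.
have -> : sqdist ^~ y = \sum_j ((fun x' : vec => x' 0 j - y 0 j) *
    (fun x' : vec => x' 0 j - y 0 j)).
  by apply/funext => x'; rewrite fct_sumE; apply: eq_bigr => j _; rewrite expr2.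
have D j := is_deriveM (is_derive_coord_sub x y j k) (is_derive_coord_sub x y j k).
apply: (is_derive_eq (is_derive_sum D)).
rewrite (bigD1 k) //= big1 ?addr0 => [|j /negbTE jk].
  by rewrite eqxx /GRing.scale /=; ring.
by rewrite jk scaler0 addr0.
Qed.

Lemma cvg_coord_pair (z : R * (vec * vec)) (k : 'I_n) :
  ((fun z : R * (vec * vec) => z.2.1 0 k) @ z --> z.2.1 0 k) /\
  ((fun z : R * (vec * vec) => z.2.2 0 k) @ z --> z.2.2 0 k).
Proof.
have c21 : (fun z : R * (vec * vec) => z.2.1) @ nbhs z --> z.2.1.
  by apply: (@cvg_comp _ _ _ snd fst); [exact: cvg_snd|exact: cvg_fst].
have c22 : (fun z : R * (vec * vec) => z.2.2) @ nbhs z --> z.2.2.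
  by apply: (@cvg_comp _ _ _ snd snd); [exact: cvg_snd|exact: cvg_snd].
have cc (v : vec) := @coord_continuous R 1 n 0 k v.
split.
  exact: (@cvg_comp _ _ _ (fun z : R * (vec * vec) => z.2.1) (fun v : vec => v 0 k) _ _ _ c21 (cc _)).
exact: (@cvg_comp _ _ _ (fun z : R * (vec * vec) => z.2.2) (fun v : vec => v 0 k) _ _ _ c22 (cc _)).
Qed.

Lemma cvg_sqdist (z : R * (vec * vec)) :
  sqdist z'.2.1 z'.2.2 @[z' --> z] --> sqdist z.2.1 z.2.2.
Proof.
apply: cvg_sumr => k; have [c1 c2] := cvg_coord_pair z k.
by rewrite expr2; under eq_cvg do rewrite expr2; apply: cvgM; apply: cvgB.
Qed.

Lemma sqdist_shift (x y : vec) (k : vec) : sqdist (x + k) (y + k) = sqdist x y.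
Proof. by apply: eq_bigr => j _; rewrite !mxE; congr (_ ^+ 2); ring. Qed.

(** Strictness makes the constraint inactive: a maximum over the closed strip is then a local
    maximum in [x], and the derivative tests apply. *)
Lemma near_diag_nbhs (r : R) (x y : vec) : (forall k, `|y 0 k - x 0 k| < r) ->
  \forall x' \near x, near_diag r x' y.
Proof.
move=> xy; suff : nbhs x (fun x' : vec => forall k, `|y 0 k - x' 0 k| <= r) by [].
apply: (@filter_forall vec 'I_n (fun k (x' : vec) => `|y 0 k - x' 0 k| <= r) (nbhs x) _) => k.
have c : (fun x' : vec => `|y 0 k - x' 0 k|) @ x --> `|y 0 k - x 0 k|.
  exact: (cvg_norm (cvgB (cvg_cst (y 0 k)) (@coord_continuous R 1 n 0 k x))).
have N : nbhs x (fun x' : vec => `|y 0 k - x' 0 k| < r).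
  by apply: (cvgr_lt _ c); exact: xy.
by apply: (@filterS vec (nbhs x) _ _ _ _ N) => x'; exact: ltW.
Qed.

End SquaredDistance.

Section Continuity.
Context {R : realType} {n : nat}.
Local Notation vec := 'rV[R]_n.

Lemma cvg_at1 (f : R -> vec -> R) (z : R * (vec * vec)) : cont_at f z.1 z.2.1 ->
  f z'.1 z'.2.1 @[z' --> z] --> f z.1 z.2.1.
Proof.
move=> cf; have c21 : (fun z : R * (vec * vec) => z.2.1) @ nbhs z --> z.2.1.
  by apply: (@cvg_comp _ _ _ snd fst); [exact: cvg_snd|exact: cvg_fst].
have c : (fun z : R * (vec * vec) => (z.1, z.2.1)) @ nbhs z --> (z.1, z.2.1).
  exact: (cvg_pair (cvg_fst (F := nbhs z.1) (G := nbhs z.2)) c21).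
exact: (@cvg_comp _ _ _ _ (fun z : R * vec => f z.1 z.2) _ _ _ c cf).
Qed.

Lemma cvg_at2 (f : R -> vec -> R) (b : R -> R) (z : R * (vec * vec)) :
  {for z.1, continuous b} -> cont_at f (b z.1) z.2.2 ->
  f (b z'.1) z'.2.2 @[z' --> z] --> f (b z.1) z.2.2.
Proof.
move=> cb cf; have c22 : (fun z : R * (vec * vec) => z.2.2) @ nbhs z --> z.2.2.
  by apply: (@cvg_comp _ _ _ snd snd); [exact: cvg_snd|exact: cvg_snd].
have c1 : (fun z : R * (vec * vec) => b z.1) @ nbhs z --> b z.1.
  by apply: (@cvg_comp _ _ _ fst b _ _ _ _ cb); exact: cvg_fst.
have c : (fun z : R * (vec * vec) => (b z.1, z.2.2)) @ nbhs z --> (b z.1, z.2.2).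
  exact: (cvg_pair c1 c22).
exact: (@cvg_comp _ _ _ _ (fun z : R * vec => f z.1 z.2) _ _ _ c cf).
Qed.

Lemma cvg_space2 (v : vec -> R) (z : R * (vec * vec)) : continuous v ->
  v z'.2.2 @[z' --> z] --> v z.2.2.
Proof.
move=> cv; apply: (@cvg_comp _ _ _ (fun z : R * (vec * vec) => z.2.2) v _ _ _ _ (cv _)).
by apply: (@cvg_comp _ _ _ snd snd); [exact: cvg_snd|exact: cvg_snd].
Qed.

Lemma cvg_within1 (f : R -> vec -> R) (a : R) (z : R * (vec * vec)) :
  {within [set z : R * vec | a <= z.1], continuous (fun z => f z.1 z.2)} -> a <= z.1 ->
  f z'.1 z'.2.1 @[z' --> within [set z : R * (vec * vec) | a <= z.1] (nbhs z)]
    --> f z.1 z.2.1.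
Proof.
move=> /subspace_continuousP /(_ (z.1, z.2.1)) cf az.
have c21 : (fun z : R * (vec * vec) => z.2.1) @ nbhs z --> z.2.1.
  by apply: (@cvg_comp _ _ _ snd fst); [exact: cvg_snd|exact: cvg_fst].
pose pr (z : R * (vec * vec)) := (z.1, z.2.1).
have c : pr @ nbhs z --> pr z.
  exact: (cvg_pair (cvg_fst (F := nbhs z.1) (G := nbhs z.2)) c21).
have ce : pr @ within [set z | a <= z.1] (nbhs z) `=>`
    within [set z : R * vec | a <= z.1] (nbhs (pr z)).
  move=> U HU.
  have HU2 : \forall z' \near z, a <= (pr z').1 -> U (pr z') := c _ HU.
  change (\forall z' \near z, a <= z'.1 -> U (pr z')).
  exact: HU2.
exact: (@cvg_comp _ _ _ pr (fun z => f z.1 z.2) _ _ _ ce (cf az)).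
Qed.

End Continuity.

(** * Comparison of the regularized solution with a stationary viscosity solution *)

Section Comparison.
Context {R : realType} {n : nat}.
Local Notation vec := 'rV[R]_n.
Variables (H : bool -> vec -> vec -> R) (w : bool -> R -> vec -> R) (eps nu : R).
Hypothesis eps_gt0 : 0 < eps.
Hypothesis nu_gt0 : 0 < nu.
Hypothesis Sw : forall i, smooth_pos (w i).
Hypothesis PDE : forall i t x, 0 < t ->
  eps * dt (w i) t x + H i x (grad (w i t) x) + w i t x - w (~~ i) t x
    = nu * laplacian (w i t) x.
Hypothesis w_periodic : forall i t, 0 <= t -> Defs.periodic (w i t).
Hypothesis w_cont : forall i,
  {within [set z : R * vec | 0 <= z.1], continuous (fun z => w i z.1 z.2)}.

(* Taking [s = 1] (resp. [s = -1]) and [v] a supersolution (resp. subsolution)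
   bounds [w] from above (resp. below). *)
Lemma doubling_bound (s eta r K M b : R) (v : bool -> vec -> R) :
  s ^+ 2 = 1 -> 0 < eta -> 0 < r ->
  (forall i, continuous (v i)) -> (forall i, Defs.periodic (v i)) ->
  (forall i x y, near_diag r x y ->
     (forall y', near_diag r x y' -> - s * v i y' - sqdist x y' / (2 * eta)
        <= - s * v i y - sqdist x y / (2 * eta)) ->
     (forall k, `|y 0 k - x 0 k| < r) /\
     0 <= s * (H i x ((s / eta) *: (x - y)) + v i y - v (~~ i) y) + K) ->
  (forall i x y, s * (w i 0 x - v i y) <= M) ->
  forall i t x, 0 <= t <= b ->
    s * (w i t x - v i x) <= M + (K + nu * (n%:R / eta)) / eps * t.
Proof.
move=> s2 eta0 r0 cv pv hv init i t x tb.
pose F i t x y := s * (w i t x - v i y) - sqdist x y / (2 * eta).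
have := @max_principle _ _ F 0 b r M ((K + nu * (n%:R / eta)) / eps) (ltW r0).
have D (x' y' : vec) : 0 <= sqdist x' y' / (2 * eta) by rewrite divr_ge0 ?sqdist_ge0 // mulr_ge0 // ltW.
move=> MP; have := MP _ _ _ _ i t x x tb; rewrite /F sqdistxx mul0r !subr0; apply.
- move=> j; apply/subspace_continuousP => z az; apply: cvgB; last first.
    apply: cvg_within_filter; apply: cvgM; last exact: cvg_cst.
    exact: cvg_sqdist.
  apply: cvgM; first exact: cvg_cst.
  apply: cvgB; first exact: cvg_within1.
  by apply: cvg_within_filter; exact: cvg_space2.
- move=> j u x' y' k u0; rewrite sqdist_shift.
  by rewrite (w_periodic j u0) pv.
- by move=> j x' y' _; apply: le_trans (init j x' y'); rewrite lerBlDr lerDl D.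
- move=> j u x' y' /andP[u0 ub] xy Fmax.
  have [|xyr hK] := hv j x' y' xy.
    move=> y'' xy''; have := Fmax j x' y'' xy''; rewrite /F !mulrBr !mulNr.
    by rewrite -!addrA lerD2l.
  have [W _ _] := Sw j.
  have Fnear : \forall x'' \near x', F j u x'' y' <= F j u x' y'.
    by apply: filterS (near_diag_nbhs xyr) => x''; exact: Fmax.
  have D1 k y : is_derive y (e_ k) (fun x'' => F j u x'' y')
      (s * 'D_(e_ k) (w j u) y - (y 0 k - y' 0 k) / eta).
    have Dw := class_C12_space y W u0 k; have Ds := is_derive_sqdist y y' k.
    by rewrite /F; apply: is_derive_eq; rewrite /GRing.scale /=; field; rewrite gt_eqF.
  have D2 k : is_derive x' (e_ k) (fun y => s * 'D_(e_ k) (w j u) y - (y 0 k - y' 0 k) / eta)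
      (s * 'D_(e_ k) ('D_(e_ k) (w j u)) x' - eta^-1).
    have Dw := class_C12_space2 x' W u0 k k; have Dc := is_derive_coord_sub x' y' k k.
    by apply: is_derive_eq; rewrite eqxx /GRing.scale /=; field; rewrite gt_eqF.
  have T k := local_max_direction (D1 k) (D2 k) Fnear.
  (* The first-order condition in [x] identifies [Dw] with the momentum at which [v] is tested. *)
  have gradE : grad (w j u) x' = (s / eta) *: (x' - y').
    apply/rowP => k; rewrite !mxE; have [+ _] := T k.
    by move/eqP; rewrite subr_eq0 => /eqP E; rewrite mulrAC -mulrA -E mulrA -expr2 s2 mul1r.
  exists (s * dt (w j) u x').
    have Dw := class_C12_time x' W u0.
    by apply: is_derive_eq; rewrite /GRing.scale /=; ring.
  rewrite -(ler_pM2l eps_gt0) mulrCA (system_eq PDE) // gradE.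
  rewrite [leRHS]mulrC divfK ?gt_eqF //.
  (* Since [v] need not be differentiable, the second-order condition is available in [x] only, and
     the Hessian of the penalization is left as the error [n / eta]. *)
  have L : s * (\sum_k 'D_(e_ k) ('D_(e_ k) (w j u)) x') <= n%:R / eta.
    rewrite -[n in n%:R]card_ord mulr_natl -sumr_const mulr_sumr.
    by apply: ler_sum => k _; have [_] := T k; rewrite subr_le0.
  (* Maximality over the component: [s (v - v') <= s (w - w')], so the coupling of [w] can be
     replaced by that of [v]. *)
  have := Fmax (~~ j) x' y' xy; rewrite /F lerD2r => C.
  set Lap := \sum_k _ in L *; set h := H _ _ _ in hK *.
  have := ler_wpM2l (ltW nu_gt0) L.
  by lra.
- by move=> k; rewrite subrr normr0 ltW.
Qed.

End Comparison.

(** * Uniform bound on the space gradient *)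

Section GradientBound.
Context {R : realType} {n : nat}.
Local Notation vec := 'rV[R]_n.

Lemma periodic_derive (f : vec -> R) (v : vec) : Defs.periodic f -> Defs.periodic ('D_v f).
Proof.
move=> pf x k; rewrite /derive.
have -> : (fun h : R => h^-1 *: ((f \o shift (x + map_mx intr k)) (h *: v) - f (x + map_mx intr k)))
   = (fun h => h^-1 *: ((f \o shift x) (h *: v) - f x)).
  by apply/funext => h /=; rewrite addrA !pf.
by [].
Qed.

(** [K] is chosen so that [K theta = C0 + 1]: the convexity gain [K theta N] cancels [C0 N], which
    comes from the growth of [D_x H], and one further [N], which bounds the term created by
    differentiating the time weight. *)
Lemma gradient_bound_arith (e nu theta C0 s z A B pk pk' L L3 Hh Hx S X N W W' H0 h0 : R) :
  let K := (C0 + 1) / theta in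
  0 < e -> 0 < nu -> 0 < theta -> 0 < C0 -> `|s| = 1 -> 0 <= z <= 1 ->
  e * B = nu * L - Hh - (W - W') ->
  e * A = nu * L3 - (Hx + S) - (pk - pk') ->
  s * z * S = K * X -> s * z * L3 <= K * L ->
  Hh - X + theta * N <= H0 -> H0 <= h0 ->
  `|Hx| <= C0 * (1 + N) -> s * pk <= 1 + N -> 0 <= N ->
  s * z * pk' - K * W' <= s * z * pk - K * W ->
  e * (s * (e^-1 * pk + z * A) - K * B) <= 1 + C0 + K * h0.
Proof.
move=> K e0 nu0 th0 C00 s1 /andP[z0 z1] eB eA S1 S2 cv Hh0 gr pkN N0 C.
have -> : e * (s * (e^-1 * pk + z * A) - K * B) = s * pk + s * z * (e * A) - K * (e * B).
  by field; rewrite gt_eqF.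
have K0 : 0 < K by rewrite divr_gt0 // addr_gt0.
have KN : K * (theta * N) = (C0 + 1) * N by rewrite /K; field; rewrite gt_eqF.
have KH := ler_wpM2l (ltW K0) (le_trans cv Hh0).
have nuS := ler_wpM2l (ltW nu0) S2.
have szHx : - (s * z * Hx) <= C0 * (1 + N).
  apply: le_trans gr; apply: (le_trans (ler_norm _)).
  by rewrite normrN !normrM s1 mul1r (ger0_norm z0) ler_piMl.
rewrite eA eB; nra.
Qed.

Lemma mulr_congr_assoc (a b c d h : R) : a * b = c * d -> a * (b * h) = c * (d * h).
Proof. by move=> E; rewrite mulrA E mulrA. Qed.

Lemma sign_mul_le (s p N : R) : s ^+ 2 = 1 -> p ^+ 2 <= N -> s * p <= 1 + N.
Proof. by move=> s2 pN; have := sqr_ge0 (s * p - 1); nra. Qed.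

Variables (H : bool -> vec -> vec -> R) (w : bool -> R -> vec -> R) (eps nu : R).
Hypothesis eps_gt0 : 0 < eps.
Hypothesis nu_gt0 : 0 < nu.
Hypothesis CH : forall i, class_C 1 (fun z : vec * vec => H i z.1 z.2).
Hypothesis Sw : forall i, smooth_pos (w i).
Hypothesis PDE : forall i t x, 0 < t ->
  eps * dt (w i) t x + H i x (grad (w i t) x) + w i t x - w (~~ i) t x
    = nu * laplacian (w i t) x.
Hypothesis w_periodic : forall i t, 0 <= t -> Defs.periodic (w i t).
Variables (theta C0 : R).
Hypothesis theta_gt0 : 0 < theta.
Hypothesis C0_gt0 : 0 < C0.
Hypothesis convexH : forall i x (p q : vec),
    H i x p + \sum_k (q 0 k - p 0 k) * 'D_(e_ k) (H i x) p
      + theta * \sum_k (q 0 k - p 0 k) ^+ 2 <= H i x q.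
Hypothesis growthH : forall i x (p : vec) k,
    `|'D_(e_ k) (H i ^~ p) x| <= C0 * (1 + \sum_j p 0 j ^+ 2).

(* Bernstein's method in linear form: convexity makes the linearized operator
   applied to [w] at least [theta * |Dw|^2 - C], and this absorbs the source
   [- D_x H] of the equation of [D_k w]; no bound on [w_t] is needed. *)
Lemma gradient_bound (M h0 t1 : R) : (forall i x, H i x 0 <= h0) -> eps < t1 ->
  (forall i t x, t1 - eps <= t <= t1 -> `|w i t x| <= M) ->
  forall i x k, `|'D_(e_ k) (w i t1) x| <=
    2 * ((C0 + 1) / theta) * M + (1 + C0 + (C0 + 1) / theta * h0).
Proof.
move=> Hh0 t1e wM i x k; set K := (C0 + 1) / theta.
have K0 : 0 < K by rewrite divr_gt0 // addr_gt0.
have t00 : 0 < t1 - eps by rewrite subr_gt0.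
suff main s : s ^+ 2 = 1 -> s * 'D_(e_ k) (w i t1) x <= 2 * K * M + (1 + C0 + K * h0).
  rewrite ler_norml; apply/andP; split.
    by have := main (- 1); rewrite sqrrN expr1n mulN1r lerNl => /(_ erefl).
  by have := main 1; rewrite expr1n mul1r => /(_ erefl).
move=> s2.
(* The weight rises from [0] to [1] on a window of length [eps]: nothing is needed about the
   gradient at its start, and [eps] times its derivative is [1]. The variables are not doubled: [F]
   ignores [y] and the radius is [0]. *)
pose F j t (x y : vec) := s * ((t - (t1 - eps)) / eps) * 'D_(e_ k) (w j t) x - K * w j t x.
have s1 : `|s| = 1.
  by apply/eqP; rewrite -(@pexpr_eq1 _ _ 2) // real_normK ?num_real // s2.
have := @max_principle _ _ F (t1 - eps) t1 0 (K * M) ((1 + C0 + K * h0) / eps) (lexx _).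
move=> MP; have {MP} := MP _ _ _ _ i t1 x x.
have -> : t1 - (t1 - eps) = eps by ring.
rewrite divfK ?gt_eqF // lexx andbT gerBl ltW // => MP.
have FL : F i t1 x x <= K * M + (1 + C0 + K * h0).
  apply: MP => //; last by move=> l; rewrite subrr normr0.
  - move=> j; apply: continuous_in_subspaceT => z; rewrite inE /= => az.
    have z0 : 0 < z.1 by apply: lt_le_trans az.
    have [W _ Wk] := Sw j.
    have [_ _ _ [cw _ _ _]] := W _ z.2.1 z0.
    have [_ _ _ [cwk _ _ _]] := Wk k _ z.2.1 z0.
    apply: cvgB; last by apply: cvgM; [exact: cvg_cst|exact: cvg_at1].
    apply: cvgM; last exact: (@cvg_at1 _ _ (fun t => 'D_(e_ k) (w j t))).
    apply: cvgM; first exact: cvg_cst.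
    by apply: cvgM; [apply: cvgB; [exact: cvg_fst|exact: cvg_cst]|exact: cvg_cst].
  - move=> j t x' y' l at_; rewrite /F (w_periodic j (le_trans (ltW t00) at_)).
    by rewrite (periodic_derive (e_ k) (w_periodic j (le_trans (ltW t00) at_))).
  - move=> j x' y' _; rewrite /F subrr mul0r mulr0 mul0r sub0r -mulrN ler_pM2l //.
    have := wM j (t1 - eps) x'; rewrite lexx gerBl ltW // => /(_ isT).
    by rewrite ler_norml => /andP[a _]; rewrite lerNl.
  move=> j t x' y' /andP[t0 tt1] xy Fmax.
  have t_gt0 : 0 < t by apply: lt_trans t0.
  have [W Wt Wk] := Sw j.
  pose z := (t - (t1 - eps)) / eps.
  have z01 : 0 <= z <= 1.
    apply/andP; split; first by rewrite divr_ge0 ?subr_ge0 // ltW.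
    by rewrite ler_pdivrMr // mul1r; lra.
  have D1 l y : is_derive y (e_ l) (fun x'' => F j t x'' y')
      (s * z * 'D_(e_ l) ('D_(e_ k) (w j t)) y - K * 'D_(e_ l) (w j t) y).
    have Dw := class_C12_space y W t_gt0 l; have Dk := class_C12_space y (Wk k) t_gt0 l.
    by rewrite /F; apply: is_derive_eq; rewrite /GRing.scale /= /z; ring.
  have D2 l : is_derive x' (e_ l) (fun y => s * z * 'D_(e_ l) ('D_(e_ k) (w j t)) y
      - K * 'D_(e_ l) (w j t) y)
      (s * z * 'D_(e_ l) ('D_(e_ l) ('D_(e_ k) (w j t))) x' - K * 'D_(e_ l) ('D_(e_ l) (w j t)) x').
    have Dw := class_C12_space2 x' W t_gt0 l l; have Dk := class_C12_space2 x' (Wk k) t_gt0 l l.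
    exact: (is_derive_lin2 (s * z) K Dk Dw).
  have Fnear : \forall x'' \near x', F j t x'' y' <= F j t x' y'.
    apply: (@filterE vec (nbhs x') _) => x''.
    have /(_ _) := Fmax j x'' x''; rewrite /F; apply => l.
    by rewrite subrr normr0.
  have T l := local_max_direction (D1 l) (D2 l) Fnear.
  exists (s * (eps^-1 * 'D_(e_ k) (w j t) x' + z * 'D_(e_ k) (dt (w j) t) x') - K * dt (w j) t x').
    have Dw := class_C12_time x' W t_gt0; have Dk := smooth_pos_dt_grad x' k (Sw j) t_gt0.
    by rewrite /F; apply: is_derive_eq; rewrite /GRing.scale /= /z; ring.
  rewrite -(ler_pM2l eps_gt0) [leRHS]mulrC divfK ?gt_eqF //.
  have e1 := system_eq PDE j x' t_gt0.
  have ek := system_space_derivative CH Sw PDE j x' k t_gt0.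
  (* The first-order condition [s z D_l D_k w = K D_l w] turns the transport term of the equation of
     [D_k w] into the term [Dw . D_p H] that convexity controls. *)
  have S1 : s * z * (\sum_l 'D_(e_ k) ('D_(e_ l) (w j t)) x' * 'D_(e_ l) (H j x') (grad (w j t) x'))
      = K * (\sum_l 'D_(e_ l) (w j t) x' * 'D_(e_ l) (H j x') (grad (w j t) x')).
    rewrite !mulr_sumr; apply: eq_bigr => l _.
    have /eqP := proj1 (T l); rewrite subr_eq0 => /eqP E.
    have E' := congr1 (fun D => s * z * D) (space_derivatives_commute x' l k W t_gt0).
    exact: (mulr_congr_assoc _ (etrans E' E)).
  have S2 : s * z * (\sum_l 'D_(e_ l) ('D_(e_ l) ('D_(e_ k) (w j t))) x')
      <= K * (\sum_l 'D_(e_ l) ('D_(e_ l) (w j t)) x').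
    by rewrite !mulr_sumr; apply: ler_sum => l _; have [_] := T l; rewrite subr_le0.
  have N0 : 0 <= \sum_l 'D_(e_ l) (w j t) x' ^+ 2.
    by apply: sumr_ge0 => l _; exact: sqr_ge0.
  have cv : H j x' (grad (w j t) x')
      - \sum_l 'D_(e_ l) (w j t) x' * 'D_(e_ l) (H j x') (grad (w j t) x')
      + theta * (\sum_l 'D_(e_ l) (w j t) x' ^+ 2) <= H j x' 0.
    have := convexH j x' (grad (w j t) x') 0.
    under eq_bigr => l _ do rewrite !mxE sub0r mulNr.
    under [X in theta * X]eq_bigr => l _ do rewrite !mxE sub0r sqrrN.
    by rewrite sumrN.
  have gr : `|'D_(e_ k) (H j ^~ (grad (w j t) x')) x'|
      <= C0 * (1 + \sum_l 'D_(e_ l) (w j t) x' ^+ 2).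
    have := growthH j x' (grad (w j t) x') k.
    by under eq_bigr => l _ do rewrite mxE.
  have pkN : s * 'D_(e_ k) (w j t) x' <= 1 + \sum_l 'D_(e_ l) (w j t) x' ^+ 2.
    apply: sign_mul_le s2 _.
    by rewrite (bigD1 k) //= lerDl; apply: sumr_ge0 => l _; exact: sqr_ge0.
  have C : F (~~ j) t x' x' <= F j t x' y'.
    by apply: Fmax => l; rewrite subrr normr0.
  exact: (gradient_bound_arith eps_gt0 nu_gt0 theta_gt0 C0_gt0 s1 z01 e1 ek S1 S2 cv
    (Hh0 j x') gr pkN N0 C).
move: FL; rewrite /F.
have -> : t1 - (t1 - eps) = eps by ring.
rewrite divff ?gt_eqF // mulr1.
have := wM i t1 x; rewrite lexx gerBl ltW // => /(_ isT); rewrite ler_norml => /andP[_ b].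
have := ler_wpM2l (ltW K0) b.
by lra.
Qed.

End GradientBound.

(** * Derivatives of the functional used to bound the time derivative *)

Section DoublingCalculus.
Context {R : realType}.

Section Abstract.
Context {V : normedModType R} {m : nat}.

(** The space [V] is abstract because the same formula serves for the space derivatives and for the
    time derivative. *)
Lemma is_derive_functional (u phi : V -> R) (p : 'I_m -> V -> R) (x v : V)
    (c K du dphi : R) (dp : 'I_m -> R) :
  is_derive x v u du -> is_derive x v phi dphi ->
  (forall j, is_derive x v (p j) (dp j)) ->
  is_derive x v (fun y => u y - (phi y - c * (phi y * phi y))
      + K / 2 * \sum_j (p j y * p j y))
    (du - (1 - 2 * c * phi x) * dphi + K * \sum_j (p j x * dp j)).
Proof.
move=> Du Dphi Dp.
have Ds : is_derive x v (\sum_j (p j * p j)) (\sum_j (p j x *: dp j + p j x *: dp j)).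
  by apply: is_derive_sum => j; exact: is_deriveM.
have -> : (fun y => u y - (phi y - c * (phi y * phi y)) + K / 2 * \sum_j (p j y * p j y))
  = u - (phi - c \*: (phi * phi)) + (K / 2) \*: (\sum_j (p j * p j)).
  by apply/funext => y; rewrite !fctE fct_sumE.
have Dc := is_deriveZ c (is_deriveM Dphi Dphi).
have DK := is_deriveZ (K / 2) Ds.
apply: (is_derive_eq (is_deriveD (is_deriveB Du (is_deriveB Dphi Dc)) DK)).
rewrite /GRing.scale /=.
have -> : \sum_j (p j x * dp j + p j x * dp j) = 2 * \sum_j (p j x * dp j).
  by rewrite mulr_sumr; apply: eq_bigr => j _; ring.
by field.
Qed.

Lemma is_derive_functional2 (u1 phi phi1 : V -> R) (p p1 : 'I_m -> V -> R) (x v : V)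
    (c K du1 dphi1 : R) (dp1 : 'I_m -> R) :
  is_derive x v u1 du1 -> is_derive x v phi (phi1 x) -> is_derive x v phi1 dphi1 ->
  (forall j, is_derive x v (p j) (p1 j x)) -> (forall j, is_derive x v (p1 j) (dp1 j)) ->
  is_derive x v (fun y => u1 y - (1 - 2 * c * phi y) * phi1 y
      + K * \sum_j (p j y * p1 j y))
    (du1 - (1 - 2 * c * phi x) * dphi1 + 2 * c * phi1 x ^+ 2
      + K * \sum_j (p1 j x ^+ 2 + p j x * dp1 j)).
Proof.
move=> Du Dphi Dphi1 Dp Dp1.
have Ds : is_derive x v (\sum_j (p j * p1 j)) (\sum_j (p j x *: dp1 j + p1 j x *: p1 j x)).
  by apply: is_derive_sum => j; exact: is_deriveM.
have -> : (fun y => u1 y - (1 - 2 * c * phi y) * phi1 y + K * \sum_j (p j y * p1 j y))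
  = u1 - (cst 1 - (2 * c) \*: phi) * phi1 + K \*: (\sum_j (p j * p1 j)).
  by apply/funext => y; rewrite !fctE fct_sumE.
have D1 := is_deriveM (is_deriveB (is_derive_cst (1 : R) x v) (is_deriveZ (2 * c) Dphi)) Dphi1.
apply: (is_derive_eq (is_deriveD (is_deriveB Du D1) (is_deriveZ K Ds))).
rewrite !fctE /GRing.scale /=.
have -> : \sum_j (p1 j x ^+ 2 + p j x * dp1 j) = \sum_j (p j x * dp1 j + p1 j x * p1 j x).
  by apply: eq_bigr => j _; ring.
rewrite -[(2 * c) *: phi x]/(2 * c * phi x).
by ring.
Qed.

End Abstract.

Lemma is_derive_weighted (f : R -> R) (t s tau a df : R) : is_derive t 1 f df ->
  is_derive t 1 (fun r => s * (tau * (r - a)) * f r) (s * tau * f t + s * (tau * (t - a)) * df).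
Proof. by move=> Df; apply: is_derive_eq; rewrite /GRing.scale /=; ring. Qed.

Lemma is_derive_penalized {n : nat} (f : 'rV[R]_n -> R) (x y : 'rV[R]_n) k (eta g0 df : R) :
  eta != 0 -> is_derive x (e_ k) f df ->
  is_derive x (e_ k) (fun x => f x - g0 + sqdist x y / (2 * eta)) (df + (x 0 k - y 0 k) / eta).
Proof.
move=> eta0 Df.
have -> : (fun x => f x - g0 + sqdist x y / (2 * eta)) =
  f - cst g0 + (2 * eta)^-1 \*: sqdist ^~ y.
  by apply/funext => z; rewrite !fctE /GRing.scale /= [_ / _]mulrC.
have Ds := is_deriveZ (2 * eta)^-1 (is_derive_sqdist x y k).
apply: (is_derive_eq (is_deriveD (is_deriveB Df (is_derive_cst g0 x (e_ k))) Ds)).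
by rewrite /GRing.scale /=; field.
Qed.

Lemma is_derive_penalized2 {n : nat} (f1 : 'rV[R]_n -> R) (x y : 'rV[R]_n) k (eta df1 : R) :
  is_derive x (e_ k) f1 df1 ->
  is_derive x (e_ k) (fun x => f1 x + (x 0 k - y 0 k) / eta) (df1 + eta^-1).
Proof.
move=> Df.
have -> : (fun x => f1 x + (x 0 k - y 0 k) / eta) =
  f1 + eta^-1 \*: (fun x : 'rV[R]_n => x 0 k - y 0 k).
  by apply/funext => z; rewrite !fctE /GRing.scale /= [_ / _]mulrC.
apply: (is_derive_eq (is_deriveD Df (is_deriveZ eta^-1 (is_derive_coord_sub x y k k)))).
by rewrite eqxx /GRing.scale /= mulr1.
Qed.

End DoublingCalculus.

(** * Algebra at a maximum point *)

Section Arithmetic.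
Context {R : realType}.

(** Each summand is the price of one step. [nu nn / eta]: Hessian of the penalization.
    [tau^2 / (4 kappa)]: Laplacian against [kappa nu |D^2 w|^2]. [tau^2 / (4 c)]: coupling against
    [c (phi - phi')^2]. The terms with [c tau Phi]: weight [1 - 2 c phi] replaced by [1].
    [kappa (nn G^2 + U)]: cost of the gradient correction. [L^2 / (2 theta)]: change of momentum in
    [H] against the convexity gain. [2 err]: residual of [g]. *)
Definition error_bound (nn nu theta M G L B U tau c kappa eta Phi err : R) : R :=
  2 * (nu * (nn / eta)) + nu * (nn * tau ^+ 2 / (4 * kappa)) + tau ^+ 2 / (4 * c)
  + 4 * c * tau * Phi * M + kappa * (nn * G ^+ 2 + U)
  + nn * tau ^+ 2 * L ^+ 2 / (2 * theta) + 2 * c * tau * Phi * B + 2 * err.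

(* The variables are the values, at a maximum point, of the functional of
   [time_derivative_bound] and of the terms of the differentiated equations:
   [u1], [A] stand for [w_t], [w_tt], [h] for the time weight, [X] for
   [D_pH . Dphi], [N] for [|Dphi|^2], [Y], [Z], [V] for the [kappa] terms;
   primes refer to the other component of the system. *)
Lemma max_point_estimate (nn eps nu theta M G L B U tau c kappa eta Phi err : R)
  (s h u1 u1' A A1 B1 D1 Hv Hq W W' g g' gs phi phi' X Y Z V N S Uv Wv Np Np' pE : R) :
  0 < nn -> 0 < eps -> 0 < nu -> 0 < theta -> 0 <= M -> 0 < tau -> 0 < c -> 0 < kappa ->
  0 < eta -> 0 <= err -> `|s| = 1 ->
  eps * u1 = nu * D1 - Hv - (W - W') ->
  eps * A = nu * B1 - A1 - (u1 - u1') ->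
  eps * pE = nu * V - (Uv + Y) - Wv ->
  eps * gs <= - (1 - s * tau) * (Hq + g - g') + err ->
  s * h * A1 - (1 - 2 * c * phi) * X + kappa * Y = 0 ->
  s * h * B1 - (1 - 2 * c * phi) * (D1 + nn / eta) + 2 * c * N + kappa * (Z + V) <= 0 ->
  s * tau * D1 <= kappa * Z + nn * tau ^+ 2 / (4 * kappa) ->
  Hv - X + theta * N <= Hq ->
  `|Hq - Hv| <= L * S -> S ^+ 2 <= nn * N -> 0 <= N -> `|Hq| <= B ->
  s * h * u1' - (phi' - c * phi' ^+ 2) + kappa / 2 * Np' <=
    s * h * u1 - (phi - c * phi ^+ 2) + kappa / 2 * Np ->
  0 <= Np' -> Np <= nn * G ^+ 2 ->
  phi - phi' = (W - W') - (g - g') -> `|phi| <= Phi -> 4 * c * Phi <= 1 ->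
  `|g| <= M -> `|g'| <= M -> `|Uv| + `|Wv| <= U ->
  eps * (s * tau * u1 + s * h * A - (1 - 2 * c * phi) * (u1 - gs) + kappa * pE)
    <= error_bound nn nu theta M G L B U tau c kappa eta Phi err.
Proof.
move=> n0 e0 nu0 th0 M0 tau0 c0 k0 eta0 err0 s1 eu eA ep eg F1 F2 FD cv HL SN N0 HB C Np'0 NpG.
move=> chi phiP cP gM g'M UW.
set f1 := 1 - 2 * c * phi.
have /andP[phil phiu] : - Phi <= phi <= Phi by rewrite -ler_norml.
(* [f1] is the derivative of [z - c z^2] at [phi]; the condition [4 c Phi <= 1] keeps it near [1],
   so that at least half of the convexity gain survives. *)
have /andP[f1l f1u] : 2^-1 <= f1 <= 2.
  have cl := ler_wpM2l (ltW c0) phil; have cu := ler_wpM2l (ltW c0) phiu.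
  by rewrite /f1; apply/andP; split; lra.
have f10 : 0 <= f1 by apply: le_trans f1l.
have -> : eps * (s * tau * u1 + s * h * A - f1 * (u1 - gs) + kappa * pE) =
  s * tau * (eps * u1) + s * h * (eps * A) - f1 * (eps * u1) + f1 * (eps * gs) + kappa * (eps * pE).
  by ring.
have eg1 := ler_wpM2l f10 eg.
rewrite eu eA ep.
have nuF2 := ler_wpM2l (ltW nu0) F2.
have nuFD := ler_wpM2l (ltW nu0) FD.
have nuN : 0 <= nu * (2 * c * N) by rewrite !mulr_ge0 // ltW.
have ne : nu * (f1 * (nn / eta)) <= 2 * (nu * (nn / eta)).
  rewrite mulrCA ler_wpM2r // mulr_ge0 ?divr_ge0 // ltW //.
have cvf := ler_wpM2l f10 cv.
have thN : 2^-1 * (theta * N) <= f1 * (theta * N) by rewrite ler_wpM2r // mulr_ge0 // ltW.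
have errf : f1 * err <= 2 * err by rewrite ler_wpM2r.
have Np2 : kappa / 2 * Np - kappa / 2 * Np' <= kappa * (nn * G ^+ 2).
  have := ler_wpM2l (ltW k0) NpG; have := mulr_ge0 (ltW k0) Np'0.
  have : 0 <= kappa * (nn * G ^+ 2).
    by apply: mulr_ge0 (ltW k0) _; apply: mulr_ge0 (ltW n0) _; exact: sqr_ge0.
  by lra.
have kU : kappa * (- Uv - Wv) <= kappa * U.
  apply: ler_wpM2l; [exact: ltW|apply: le_trans UW].
  by rewrite lerD // -normrN ler_norm.
have ab (z Q : R) : `|z| <= Q -> s * tau * z <= tau * Q.
  move=> zQ; apply: (le_trans (ler_norm _)).
  by rewrite !normrM s1 mul1r (gtr0_norm tau0) ler_pM2l.
(* Split into the change of momentum from [Dw] to that of [g], bounded by [L S], and the deviation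
   of [f1] from [1], bounded by [2 c Phi]. *)
have h1 : s * tau * (f1 * Hq - Hv) <= tau * (L * S + 2 * c * Phi * B).
  apply: ab; have -> : f1 * Hq - Hv = (Hq - Hv) - (2 * c * phi) * Hq by rewrite /f1; ring.
  apply: (le_trans (ler_normB _ _)); rewrite lerD // !normrM.
  rewrite (gtr0_norm c0) (gtr0_norm (ltr0n _ 2)).
  have c20 : 0 < 2 * c by rewrite mulr_gt0.
  apply: ler_pM => //; first by rewrite mulr_ge0 // ltW.
  by rewrite ler_pM2l.
(* Cauchy-Schwarz in the form [S^2 <= nn N], then completion of the square: half of [theta N] pays
   for the change of momentum. *)
have h2 : tau * (L * S) - 2^-1 * (theta * N) <= nn * tau ^+ 2 * L ^+ 2 / (2 * theta).
  have : 2^-1 * (theta * (S ^+ 2 / nn)) <= 2^-1 * (theta * N).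
    by rewrite ler_pM2l // ler_pM2l // ler_pdivrMr // mulrC.
  suff : tau * (L * S) - 2^-1 * (theta * (S ^+ 2 / nn)) <= nn * tau ^+ 2 * L ^+ 2 / (2 * theta).
    by lra.
  rewrite -subr_ge0.
  have -> : nn * tau ^+ 2 * L ^+ 2 / (2 * theta) - (tau * (L * S) - 2^-1 * (theta * (S ^+ 2 / nn)))
    = (nn * tau * L - theta * S) ^+ 2 / (2 * theta * nn).
    by field; rewrite !gt_eqF.
  by rewrite divr_ge0 ?sqr_ge0 // !mulr_ge0 // ltW.
(* The square left over by the concavity of [z - c z^2] absorbs the difference of the two
   couplings. *)
have h3 : s * tau * (- (phi - phi')) - c * (phi - phi') ^+ 2 <= tau ^+ 2 / (4 * c).
  have s2 : s ^+ 2 = 1 by rewrite -real_normK ?num_real // s1 expr1n.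
  rewrite -subr_ge0.
  have -> : tau ^+ 2 / (4 * c) - (s * tau * (- (phi - phi')) - c * (phi - phi') ^+ 2)
    = (s * tau + 2 * c * (phi - phi')) ^+ 2 / (4 * c) + (1 - s ^+ 2) * tau ^+ 2 / (4 * c).
    by field; rewrite gt_eqF.
  by rewrite s2 subrr !mul0r addr0 divr_ge0 ?sqr_ge0 // mulr_ge0 // ltW.
have h4 : s * tau * (- (2 * c * phi) * (g - g')) <= tau * (2 * c * Phi * (2 * M)).
  apply: ab; rewrite normrM normrN; apply: ler_pM => //.
    by rewrite !normrM (gtr0_norm c0) (gtr0_norm (ltr0n _ 2)) ler_pM2l // mulr_gt0.
  by apply: (le_trans (ler_normB _ _)); lra.
have fphi : phi' - c * phi' ^+ 2 - (phi - c * phi ^+ 2) =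
  - f1 * (phi - phi') - c * (phi - phi') ^+ 2 by rewrite /f1; ring.
rewrite /error_bound.
move: F1 F2 nuF2; rewrite -/f1 => F1 F2 nuF2.
have e1 : s * tau * (f1 * Hq - Hv) = s * tau * f1 * Hq - s * tau * Hv by ring.
have e2 : s * tau * (- (phi - phi')) = - (s * tau * (W - W')) + s * tau * (g - g') by rewrite chi; ring.
have e3 : s * tau * (- (2 * c * phi) * (g - g')) = s * tau * f1 * (g - g') - s * tau * (g - g') by rewrite /f1; ring.
have e4 : - f1 * (phi - phi') = - f1 * (W - W') + f1 * (g - g') by rewrite chi; ring.
rewrite e1 in h1; rewrite e2 in h3; rewrite e3 in h4; rewrite e4 in fphi.
clear eu eA ep e1 e2 e3 e4.
lra.
Qed.

End Arithmetic.

Section ArithmeticSums.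
Context {R : realType} {n : nat}.
Implicit Types p : 'I_n -> R.

Lemma sum_le_const p (G : R) : (forall k, p k <= G) -> \sum_k p k <= n%:R * G.
Proof.
move=> pG; rewrite -[n in n%:R]card_ord mulr_natl -sumr_const.
by apply: ler_sum => k _; exact: pG.
Qed.

Lemma sqr_le_norm (z G : R) : `|z| <= G -> z ^+ 2 <= G ^+ 2.
Proof.
move=> zG; rewrite -real_normK ?num_real // lerXn2r // nnegrE //.
exact: le_trans zG.
Qed.

Lemma sqr_sum_le p : (0 < n)%N -> (\sum_k p k) ^+ 2 <= n%:R * \sum_k p k ^+ 2.
Proof.
move=> n0; have nn0 : 0 < n%:R :> R by rewrite ltr0n.
set m := (\sum_k p k) / n%:R.
have : 0 <= \sum_k (p k - m) ^+ 2 by apply: sumr_ge0 => k _; exact: sqr_ge0.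
have -> : \sum_k (p k - m) ^+ 2 = \sum_k p k ^+ 2 - (\sum_k p k) ^+ 2 / n%:R.
  transitivity (\sum_k (p k ^+ 2 - 2 * m * p k + m ^+ 2)).
    by apply: eq_bigr => k _; ring.
  rewrite big_split sumrB -mulr_sumr /= sumr_const card_ord -mulr_natl /m.
  by field; rewrite gt_eqF.
by rewrite subr_ge0 ler_pdivrMr // mulrC.
Qed.

(** Contraction of the coordinatewise relations into the scalars of [max_point_estimate]: the
    equation of each [D_l w] is multiplied by [p l], the first-order condition by [Hp k], and
    everything is summed. [Q] is the Hessian of [w] and [T k l] stands for [D_k D_k D_l w]. *)
Lemma max_point_estimate_sums (eps nu theta C0 M G L B tau c kappa eta Phi err : R)
  (s h u1 u1' A Hv Hq W W' g g' gs phi phi' : R)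
  (p p' E Ed D qd Hx Hp : 'I_n -> R) (Q T : 'I_n -> 'I_n -> R) :
  (0 < n)%N -> 0 < eps -> 0 < nu -> 0 < theta -> 0 < C0 -> 0 <= M -> 0 < tau ->
  0 < c -> 0 < kappa -> 0 < eta -> 0 <= err -> `|s| = 1 ->
  eps * u1 = nu * (\sum_j D j) - Hv - (W - W') ->
  eps * A = nu * (\sum_j Ed j) - \sum_j E j * Hp j - (u1 - u1') ->
  (forall l, eps * E l = nu * (\sum_k T k l) - (Hx l + \sum_k Q l k * Hp k)
     - (p l - p' l)) ->
  (forall k l, Q k l = Q l k) -> (forall k, D k = Q k k) ->
  eps * gs <= - (1 - s * tau) * (Hq + g - g') + err ->
  (forall k, s * h * E k - (1 - 2 * c * phi) * qd k + kappa * \sum_l p l * Q k l = 0) ->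
  (forall k, s * h * Ed k - (1 - 2 * c * phi) * (D k + eta^-1) + 2 * c * qd k ^+ 2
     + kappa * \sum_l (Q k l ^+ 2 + p l * T k l) <= 0) ->
  Hv - \sum_k qd k * Hp k + theta * \sum_k qd k ^+ 2 <= Hq ->
  `|Hq - Hv| <= L * \sum_k `|qd k| -> `|Hq| <= B ->
  s * h * u1' - (phi' - c * (phi' * phi')) + kappa / 2 * \sum_l p' l * p' l <=
    s * h * u1 - (phi - c * (phi * phi)) + kappa / 2 * \sum_l p l * p l ->
  phi - phi' = (W - W') - (g - g') -> `|phi| <= Phi -> 4 * c * Phi <= 1 ->
  `|g| <= M -> `|g'| <= M -> (forall l, `|p l| <= G) -> (forall l, `|p' l| <= G) ->
  (forall l, `|Hx l| <= C0 * (1 + \sum_j p j ^+ 2)) ->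
  eps * (s * tau * u1 + s * h * A - (1 - 2 * c * phi) * (u1 - gs)
      + kappa * \sum_l p l * E l)
    <= error_bound n%:R nu theta M G L B
         (n%:R * (G * (C0 * (1 + n%:R * G ^+ 2))) + n%:R * (2 * G ^+ 2))
         tau c kappa eta Phi err.
Proof.
move=> n0 e0 nu0 th0 C00 M0 tau0 c0 k0 eta0 err0 s1 eu eA ek sym Dd eg F1 F2 cv HL HB C.
move=> chi phiP cP gM g'M pG p'G HxG.
have nn0 : 0 < n%:R :> R by rewrite ltr0n.
have p2 l : p l ^+ 2 <= G ^+ 2 by exact: sqr_le_norm.
have sp2 : \sum_l p l ^+ 2 <= n%:R * G ^+ 2 by exact: sum_le_const.
pose V := \sum_k \sum_l p l * T k l.
pose Y := \sum_k \sum_l p l * Q k l * Hp k.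
pose Z := \sum_k \sum_l Q k l ^+ 2.
pose Uv := \sum_l p l * Hx l; pose Wv := \sum_l p l * (p l - p' l).
(* The Laplacian sees only the diagonal of the Hessian, which the full sum of squares dominates. *)
have Z0 : \sum_k D k ^+ 2 <= Z.
  apply: ler_sum => k _; rewrite Dd (bigD1 k) //= lerDl.
  by apply: sumr_ge0 => l _; exact: sqr_ge0.
apply: (@max_point_estimate _ _ _ _ _ _ _ _ _ _ _ _ _ _ _ _ s h u1 u1' A _ _ _ Hv Hq W W' g g' gs
  phi phi' (\sum_k qd k * Hp k) Y Z V (\sum_k qd k ^+ 2) (\sum_k `|qd k|) Uv Wv
  (\sum_l p l * p l) (\sum_l p' l * p' l) _ nn0 e0 nu0 th0 M0 tau0 c0 k0 eta0 err0 s1 eu eA _ eg)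
  => //.
- rewrite mulr_sumr; transitivity (\sum_l (nu * (\sum_k p l * T k l)
      - (p l * Hx l + \sum_k p l * Q k l * Hp k) - p l * (p l - p' l))).
    apply: eq_bigr => l _; rewrite mulrCA ek !mulrBr mulrDr [p l * (nu * _)]mulrCA.
    rewrite [p l * \sum_k T k l]mulr_sumr [p l * \sum_k Q l k * Hp k]mulr_sumr.
    do 2 congr (_ - _); congr (_ + _); apply: eq_bigr => k _.
    by rewrite sym mulrA.
  rewrite !sumrB big_split /= -mulr_sumr /V /Y.
  by rewrite [X in nu * X]exchange_big [X in Uv + X]exchange_big.
- have -> : Y = \sum_k (\sum_l p l * Q k l) * Hp k.
    by apply: eq_bigr => k _; rewrite mulr_suml.
  rewrite !mulr_sumr -sumrB -big_split /= big1 // => k _.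
  have -> : s * h * (E k * Hp k) - (1 - 2 * c * phi) * (qd k * Hp k) +
     kappa * ((\sum_l p l * Q k l) * Hp k) =
    (s * h * E k - (1 - 2 * c * phi) * qd k + kappa * \sum_l p l * Q k l) * Hp k by ring.
  by rewrite F1 mul0r.
- have -> : Z + V = \sum_k \sum_l (Q k l ^+ 2 + p l * T k l).
    by rewrite -big_split; apply: eq_bigr => k _; rewrite big_split.
  have -> : \sum_j D j + n%:R / eta = \sum_j (D j + eta^-1).
    by rewrite big_split /= sumr_const card_ord mulr_natl.
  rewrite !mulr_sumr -sumrB -!big_split /=; apply: sumr_le0 => k _; exact: F2.
- rewrite mulr_sumr; apply: le_trans (_ : kappa * (\sum_k D k ^+ 2) + n%:R * tau ^+ 2 / (4 * kappa) <= _).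
    rewrite -lerBlDl mulr_sumr -sumrB -mulrA; apply: sum_le_const => k.
    rewrite -subr_ge0.
    have s2 : s ^+ 2 = 1 by rewrite -real_normK ?num_real // s1 expr1n.
    have -> : tau ^+ 2 / (4 * kappa) - (s * tau * D k - kappa * D k ^+ 2) =
      (s * tau - 2 * kappa * D k) ^+ 2 / (4 * kappa) + (1 - s ^+ 2) * tau ^+ 2 / (4 * kappa).
      by field; rewrite gt_eqF.
    by rewrite s2 subrr !mul0r addr0 divr_ge0 ?sqr_ge0 // mulr_ge0 // ltW.
  by rewrite lerD2r ler_pM2l.
- have -> : \sum_k qd k ^+ 2 = \sum_k `|qd k| ^+ 2.
    by apply: eq_bigr => k _; rewrite real_normK ?num_real.
  exact: sqr_sum_le.
- by apply: sumr_ge0 => k _; exact: sqr_ge0.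
- by apply: sumr_ge0 => k _; rewrite -expr2; exact: sqr_ge0.
- rewrite lerD //.
    apply: (le_trans (ler_norm_sum _ _ _)); apply: sum_le_const => l.
    rewrite normrM; apply: ler_pM => //; apply: (le_trans (HxG l)).
    by rewrite ler_pM2l // lerD2l.
  apply: (le_trans (ler_norm_sum _ _ _)); apply: sum_le_const => l.
  have -> : 2 * G ^+ 2 = G * (G + G) by ring.
  rewrite normrM; apply: ler_pM => //.
  by apply: (le_trans (ler_normB _ _)); rewrite lerD.
Qed.

End ArithmeticSums.

(** * One-sided bounds on the time derivative *)

Section TimeDerivativeBound.
Context {R : realType} {n : nat}.
Local Notation vec := 'rV[R]_n.

Lemma periodic_dt (f : R -> vec -> R) (t : R) : 0 < t ->
  (forall s, 0 <= s -> Defs.periodic (f s)) -> Defs.periodic (dt f t).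
Proof.
move=> t0 pf x k; rewrite /dt !derive1E; apply: near_eq_derive.
have : \forall s \near t, 0 < s by exact: lt_nbhsr.
by apply: filterS => s s0; exact: (pf s (ltW s0)).
Qed.

(** Under [4 c Phi <= 1] the map [z - c z^2] is increasing on [[- Phi, Phi]]. As [y] enters the
    functional only through [phi - c phi^2], its maximality in [y] thus becomes maximality of [g]
    minus the penalization. *)
Lemma concave_quadratic_mono (c Phi u v : R) : 0 < c -> 4 * c * Phi <= 1 ->
  `|u| <= Phi -> `|v| <= Phi -> u - c * (u * u) <= v - c * (v * v) -> u <= v.
Proof.
rewrite !ler_norml => c0 cP /andP[u0 u1] /andP[v0 v1] L; rewrite leNgt; apply/negP => vu.
have cu := ler_wpM2l (ltW c0) u1; have cv := ler_wpM2l (ltW c0) v1.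
have : 0 < (u - v) * (1 - c * (u + v)).
  by apply: mulr_gt0; lra.
by lra.
Qed.

Variables (H : bool -> vec -> vec -> R) (w : bool -> R -> vec -> R) (eps nu : R).
Hypothesis n_gt0 : (0 < n)%N.
Hypothesis eps_gt0 : 0 < eps.
Hypothesis nu_gt0 : 0 < nu.
Hypothesis CH : forall i, class_C 1 (fun z : vec * vec => H i z.1 z.2).
Hypothesis Sw : forall i, smooth_pos (w i).
Hypothesis PDE : forall i t x, 0 < t ->
  eps * dt (w i) t x + H i x (grad (w i t) x) + w i t x - w (~~ i) t x
    = nu * laplacian (w i t) x.
Hypothesis w_periodic : forall i t, 0 <= t -> Defs.periodic (w i t).
Variables (theta C0 : R).
Hypothesis theta_gt0 : 0 < theta.
Hypothesis C0_gt0 : 0 < C0.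
Hypothesis convexH : forall i x (p q : vec),
    H i x p + \sum_k (q 0 k - p 0 k) * 'D_(e_ k) (H i x) p
      + theta * \sum_k (q 0 k - p 0 k) ^+ 2 <= H i x q.
Hypothesis growthH : forall i x (p : vec) k,
    `|'D_(e_ k) (H i ^~ p) x| <= C0 * (1 + \sum_j p 0 j ^+ 2).
Variables (G L B : R).
Hypothesis lipH : forall i x (p q : vec), (forall k, `|p 0 k| <= G) ->
  (forall k, `|q 0 k| <= G) -> `|H i x q - H i x p| <= L * \sum_k `|p 0 k - q 0 k|.
Hypothesis boundH : forall i x (q : vec), (forall k, `|q 0 k| <= G) -> `|H i x q| <= B.

(* Maximum principle for [s tau (t - a) w_t - (phi - c phi^2) + kappa/2 |Dw|^2]
   with [phi = w(t, x) - g(t, y) + |x - y|^2 / (2 eta)]. The hypothesis on [g]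
   is tested only at the points where the maximum over [y] is attained, so it
   also makes sense for a viscosity solution. *)
Lemma time_derivative_bound (s tau c kappa eta r a b M Phi err : R)
    (g : bool -> R -> vec -> R) :
  `|s| = 1 -> 0 < tau -> 0 < c -> 0 < kappa -> 0 < eta -> 0 <= err -> 0 <= M ->
  0 < r -> 0 < a -> a <= b ->
  2 * M + n%:R * r ^+ 2 / (2 * eta) <= Phi -> 4 * c * Phi <= 1 ->
  (forall i t x, a <= t <= b -> `|w i t x| <= M) ->
  (forall i t x, a <= t <= b -> `|g i t x| <= M) ->
  (forall i t x k, a <= t <= b -> `|'D_(e_ k) (w i t) x| <= G) ->
  (forall i t, a <= t -> Defs.periodic (g i t)) ->
  (forall i (z : R * (vec * vec)), a <= z.1 -> g i z'.1 z'.2.2 @[z' --> z] --> g i z.1 z.2.2) ->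
  (forall i t x y, a < t <= b -> near_diag r x y ->
     (forall y', near_diag r x y' -> g i t y' - sqdist x y' / (2 * eta)
        <= g i t y - sqdist x y / (2 * eta)) ->
     [/\ forall k, `|y 0 k - x 0 k| < r, forall k, `|y 0 k - x 0 k| <= eta * G &
       exists2 gs, is_derive t 1 (g i ^~ y) gs &
       eps * gs <= - (1 - s * tau) * (H i x (eta^-1 *: (y - x)) + g i t y - g (~~ i) t y) + err]) ->
  forall i x, s * (tau * (b - a)) * dt (w i) b x <=
    3 * Phi + kappa * (n%:R * G ^+ 2) + error_bound n%:R nu theta M G L B
         (n%:R * (G * (C0 * (1 + n%:R * G ^+ 2))) + n%:R * (2 * G ^+ 2))
         tau c kappa eta Phi err / eps * (b - a).
Proof.
move=> s1 tau0 c0 k0 eta0 err0 M0 r0 a0 ab PhiM cP wM gM wG pg cg hg i x.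
set E := error_bound _ _ _ _ _ _ _ _ _ _ _ _ _ _.
pose phi j t x y := w j t x - g j t y + sqdist x y / (2 * eta).
have e20 : 0 < 2 * eta by rewrite mulr_gt0.
have phiP j t x' y' : a <= t <= b -> near_diag r x' y' -> `|phi j t x' y'| <= Phi.
  move=> tab xy; apply: le_trans PhiM; apply: (le_trans (ler_normD _ _)); rewrite lerD //.
    apply: (le_trans (ler_normB _ _)); have := wM j t x' tab; have := gM j t y' tab; lra.
  rewrite ger0_norm ?divr_ge0 ?sqdist_ge0 ?(ltW e20) // ler_pM2r ?invr_gt0 //.
  exact: sqdist_near_diag (ltW r0) xy.
have Phi0 : 0 <= Phi.
  by apply: le_trans (phiP true a x x _ _); rewrite ?normr_ge0 // ?lexx // => k; rewrite subrr normr0 ltW.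
pose F j t x y := s * (tau * (t - a)) * dt (w j) t x - (phi j t x y - c * (phi j t x y * phi j t x y))
  + kappa / 2 * \sum_l 'D_(e_ l) (w j t) x * 'D_(e_ l) (w j t) x.
(* Used once at each end of the time interval, which produces the [3 * Phi] of the conclusion. *)
have quad z : `|z| <= Phi -> `|z - c * (z * z)| <= 3 / 2 * Phi.
  rewrite !ler_norml => /andP[z0 z1]; have cz := ler_wpM2l (ltW c0) z1.
  have cz' := ler_wpM2l (ltW c0) z0.
  have : 0 <= c * (z * z) by rewrite mulr_ge0 ?(ltW c0) // -expr2 sqr_ge0.
  have : c * (z * z) <= c * (Phi * Phi).
    rewrite ler_pM2l // -!expr2 sqr_le_norm // ler_norml z0 z1 //.
  have := ler_wpM2r Phi0 cP.
  by move=> *; apply/andP; split; lra.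
have sumG j t x' : a <= t <= b ->
    0 <= \sum_l 'D_(e_ l) (w j t) x' * 'D_(e_ l) (w j t) x' <= n%:R * G ^+ 2.
  move=> tab; apply/andP; split.
    by apply: sumr_ge0 => l _; rewrite -expr2 sqr_ge0.
  by apply: sum_le_const => l; rewrite -expr2 sqr_le_norm // wG.
have := @max_principle _ _ F a b r (3 / 2 * Phi + kappa / 2 * (n%:R * G ^+ 2)) (E / eps) (ltW r0).
move=> MP.
have bab : a <= b <= b by rewrite ab lexx.
have aab : a <= a <= b by rewrite ab lexx.
have xx : near_diag r x x by move=> k; rewrite subrr normr0 ltW.
have {MP} FL : F i b x x <= 3 / 2 * Phi + kappa / 2 * (n%:R * G ^+ 2) + E / eps * (b - a).
  apply: MP => //.
  - move=> j; apply: continuous_in_subspaceT => z; rewrite inE /= => az.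
    have z0 : 0 < z.1 by apply: lt_le_trans az.
    have [W Wt Wk] := Sw j.
    have [_ _ _ [cw _ _ _]] := W _ z.2.1 z0.
    have [_ _ _ [cwt _ _ _]] := Wt _ z.2.1 z0.
    have cphi : phi j z'.1 z'.2.1 z'.2.2 @[z' --> z] --> phi j z.1 z.2.1 z.2.2.
      apply: cvgD; first by apply: cvgB; [exact: cvg_at1|exact: cg].
      by apply: cvgM; [exact: cvg_sqdist|exact: cvg_cst].
    have cDw l : 'D_(e_ l) (w j z'.1) z'.2.1 @[z' --> z] --> 'D_(e_ l) (w j z.1) z.2.1.
      have [_ _ _ [cwk _ _ _]] := Wk l _ z.2.1 z0.
      exact: (@cvg_at1 _ _ (fun t => 'D_(e_ l) (w j t))).
    apply: cvgD; last first.
      apply: cvgM; first exact: cvg_cst.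
      by apply: cvg_sumr => l; apply: cvgM.
    apply: cvgB; last by apply: cvgB => //; apply: cvgM; [exact: cvg_cst|apply: cvgM].
    apply: cvgM; last exact: cvg_at1.
    apply: cvgM; first exact: cvg_cst.
    apply: cvgM; first exact: cvg_cst.
    by apply: cvgB; [exact: cvg_fst|exact: cvg_cst].
  - move=> j t x' y' k at_; have t0 : 0 < t by apply: lt_le_trans at_.
    rewrite /F /phi (w_periodic j (ltW t0)) (pg j t at_) sqdist_shift.
    rewrite (periodic_dt t0 (w_periodic j)); congr (_ + _ * _); apply: eq_bigr => l _.
    by rewrite (periodic_derive (e_ l) (w_periodic j (ltW t0))).
  - move=> j x' y' xy; rewrite /F subrr mulr0 mulr0 mul0r sub0r lerD //.
      by have := quad _ (phiP j a x' y' aab xy); rewrite ler_norml => /andP[]; lra.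
    by rewrite ler_pM2l ?divr_gt0 //; case/andP: (sumG j a x' aab).
  move=> j t x' y' /andP[t_a tb] xy Fmax.
  have tab : a <= t <= b by rewrite ltW.
  have t0 : 0 < t by apply: lt_trans t_a.
  have [W Wt Wk] := Sw j.
  have [||xyr xyG [gs Dg gsE]] := hg j t x' y' _ xy; first by rewrite t_a.
    move=> y'' xy''; have := Fmax j x' y'' xy''; rewrite /F lerD2r lerD2l lerN2 => K.
    have := concave_quadratic_mono c0 cP (phiP j t x' y' tab xy) (phiP j t x' y'' tab xy'') K.
    by rewrite /phi; lra.
  (* The momentum of [g] read off the penalization: [D_x phi = Dw - Q], so convexity is used between
     [Dw] and [Q]. *)
  pose Q : vec := eta^-1 *: (y' - x').
  have D1 k y : is_derive y (e_ k) (fun x => F j t x y')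
      (s * (tau * (t - a)) * 'D_(e_ k) (dt (w j) t) y
       - (1 - 2 * c * phi j t y y') * ('D_(e_ k) (w j t) y + (y 0 k - y' 0 k) / eta)
       + kappa * \sum_l 'D_(e_ l) (w j t) y * 'D_(e_ k) ('D_(e_ l) (w j t)) y).
    exact: (is_derive_functional c kappa (is_deriveZ (s * (tau * (t - a))) (class_C12_space y Wt t0 k))
      (is_derive_penalized y' (g j t y') (lt0r_neq0 eta0) (class_C12_space y W t0 k))
      (fun l => class_C12_space2 y W t0 l k)).
  have D2 k : is_derive x' (e_ k) (fun y => s * (tau * (t - a)) * 'D_(e_ k) (dt (w j) t) y
       - (1 - 2 * c * phi j t y y') * ('D_(e_ k) (w j t) y + (y 0 k - y' 0 k) / eta)
       + kappa * \sum_l 'D_(e_ l) (w j t) y * 'D_(e_ k) ('D_(e_ l) (w j t)) y)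
      (s * (tau * (t - a)) * 'D_(e_ k) ('D_(e_ k) (dt (w j) t)) x'
       - (1 - 2 * c * phi j t x' y') * ('D_(e_ k) ('D_(e_ k) (w j t)) x' + eta^-1)
       + 2 * c * ('D_(e_ k) (w j t) x' + (x' 0 k - y' 0 k) / eta) ^+ 2
       + kappa * \sum_l ('D_(e_ k) ('D_(e_ l) (w j t)) x' ^+ 2
          + 'D_(e_ l) (w j t) x' * 'D_(e_ k) ('D_(e_ k) ('D_(e_ l) (w j t))) x')).
    exact: (@is_derive_functional2 _ _ _ _ _ (fun y => 'D_(e_ k) (w j t) y + (y 0 k - y' 0 k) / eta)
      (fun l => 'D_(e_ l) (w j t)) (fun l => 'D_(e_ k) ('D_(e_ l) (w j t))) x' (e_ k) c kappa _ _ _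
      (is_deriveZ (s * (tau * (t - a))) (class_C12_space2 x' Wt t0 k k))
      (is_derive_penalized y' (g j t y') (lt0r_neq0 eta0) (class_C12_space x' W t0 k))
      (is_derive_penalized2 y' eta (class_C12_space2 x' W t0 k k))
      (fun l => class_C12_space2 x' W t0 l k) (fun l => class_C12_space2 x' (Wk l) t0 k k)).
  have Fnear : \forall x'' \near x', F j t x'' y' <= F j t x' y'.
    by apply: filterS (near_diag_nbhs xyr) => x''; exact: Fmax.
  have T k := local_max_direction (D1 k) (D2 k) Fnear.
  exists (s * tau * dt (w j) t x' + s * (tau * (t - a)) * dt (dt (w j)) t x'
      - (1 - 2 * c * phi j t x' y') * (dt (w j) t x' - gs)
      + kappa * \sum_l 'D_(e_ l) (w j t) x' * 'D_(e_ l) (dt (w j) t) x').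
    have Dphi : is_derive t 1 (fun r => phi j r x' y') (dt (w j) t x' - gs).
      have D0 := is_derive_cst (sqdist x' y' / (2 * eta)) t 1.
      apply: (is_derive_eq (is_deriveD (is_deriveB (class_C12_time x' W t0) Dg) D0)).
      by rewrite addr0.
    exact: (@is_derive_functional _ _ _ _ _ (fun l r => 'D_(e_ l) (w j r) x') t 1 c kappa _ _ _
      (is_derive_weighted s tau a (class_C12_time x' Wt t0)) Dphi
      (fun l => smooth_pos_dt_grad x' l (Sw j) t0)).
  have Qk k : Q 0 k - grad (w j t) x' 0 k = - ('D_(e_ k) (w j t) x' + (x' 0 k - y' 0 k) / eta).
    by rewrite !mxE; ring.
  have QG k : `|Q 0 k| <= G.
    rewrite !mxE normrM gtr0_norm ?invr_gt0 // mulrC ler_pdivrMr // mulrC; exact: xyG.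
  have gradG k : `|grad (w j t) x' 0 k| <= G by rewrite mxE; exact: wG.
  have cv : H j x' (grad (w j t) x')
      - \sum_k ('D_(e_ k) (w j t) x' + (x' 0 k - y' 0 k) / eta) * 'D_(e_ k) (H j x') (grad (w j t) x')
      + theta * (\sum_k ('D_(e_ k) (w j t) x' + (x' 0 k - y' 0 k) / eta) ^+ 2) <= H j x' Q.
    have := convexH j x' (grad (w j t) x') Q.
    under eq_bigr => k _ do rewrite Qk mulNr.
    under [X in theta * X]eq_bigr => k _ do rewrite Qk sqrrN.
    by rewrite sumrN.
  have HL : `|H j x' Q - H j x' (grad (w j t) x')|
      <= L * \sum_k `|'D_(e_ k) (w j t) x' + (x' 0 k - y' 0 k) / eta|.
    have := lipH j x' gradG QG.
    by under eq_bigr => k _ do rewrite distrC Qk normrN.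
  have Hx l : `|'D_(e_ l) (H j ^~ (grad (w j t) x')) x'|
      <= C0 * (1 + \sum_k 'D_(e_ k) (w j t) x' ^+ 2).
    have := growthH j x' (grad (w j t) x') l.
    by under eq_bigr => k _ do rewrite mxE.
  have chi : phi j t x' y' - phi (~~ j) t x' y' =
     (w j t x' - w (~~ j) t x') - (g j t y' - g (~~ j) t y') by rewrite /phi; ring.
  rewrite -(ler_pM2l eps_gt0) [leRHS]mulrC divfK ?gt_eqF //.
  exact: (@max_point_estimate_sums R n eps nu theta C0 M G L B tau c kappa eta Phi err
    s (tau * (t - a)) (dt (w j) t x') (dt (w (~~ j)) t x') (dt (dt (w j)) t x')
    (H j x' (grad (w j t) x')) (H j x' Q) (w j t x') (w (~~ j) t x') (g j t y') (g (~~ j) t y') gs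
    (phi j t x' y') (phi (~~ j) t x' y')
    (fun k => 'D_(e_ k) (w j t) x') (fun k => 'D_(e_ k) (w (~~ j) t) x')
    (fun k => 'D_(e_ k) (dt (w j) t) x') (fun k => 'D_(e_ k) ('D_(e_ k) (dt (w j) t)) x')
    (fun k => 'D_(e_ k) ('D_(e_ k) (w j t)) x')
    (fun k => 'D_(e_ k) (w j t) x' + (x' 0 k - y' 0 k) / eta)
    (fun k => 'D_(e_ k) (H j ^~ (grad (w j t) x')) x')
    (fun k => 'D_(e_ k) (H j x') (grad (w j t) x'))
    (fun k l => 'D_(e_ k) ('D_(e_ l) (w j t)) x')
    (fun k l => 'D_(e_ k) ('D_(e_ k) ('D_(e_ l) (w j t))) x')
    n_gt0 eps_gt0 nu_gt0 theta_gt0 C0_gt0 M0 tau0 c0 k0 eta0 err0 s1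
    (system_eq PDE j x' t0) (system_time_derivative CH Sw PDE j x' t0)
    (fun l => system_space_derivative CH Sw PDE j x' l t0)
    (fun k l => space_derivatives_commute x' l k W t0) (fun k => erefl) gsE
    (fun k => proj1 (T k)) (fun k => proj2 (T k)) cv HL (boundH j x' QG)
    (Fmax (~~ j) x' y' xy) chi (phiP j t x' y' tab xy) cP (gM j t y' tab) (gM (~~ j) t y' tab)
    (fun l => wG j t x' l tab) (fun l => wG (~~ j) t x' l tab) Hx).
have := quad _ (phiP i b x x bab xx); rewrite ler_norml => /andP[_ q].
have := sumG i b x bab => /andP[q2 q3].
move: FL q2 q3; rewrite /F; move: q.
generalize (\sum_l 'D_(e_ l) (w i b) x * 'D_(e_ l) (w i b) x) (dt (w i) b x) (phi i b x x).
move=> Np u f qf FL q2 q3.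
have := mulr_ge0 (ltW k0) q2; have := mulr_ge0 (ltW k0) (le_trans q2 q3).
by lra.
Qed.

End TimeDerivativeBound.

(** * Constants extracted from the assumptions and viscosity tests *)

Section Constants.
Context {R : realType} {n : nat}.
Local Notation vec := 'rV[R]_n.

Lemma periodic_bounded_pair (h : vec * vec -> R) (G : R) : continuous h ->
  (forall p, Defs.periodic (fun x => h (x, p))) ->
  exists2 B, 0 <= B & forall x (p : vec), (forall k, `|p 0 k| <= G) -> `|h (x, p)| <= B.
Proof.
move=> ch ph.
(* The absolute value keeps the cube nonempty when [G] is negative. *)
pose K : set (vec * vec) := [set v : vec | forall k, v 0 k \in `[0, 1]]
   `*` [set v : vec | forall k, v 0 k \in `[- `|G|, `|G|]].
have cK : compact K by apply: compact_setX; exact: cube_compact.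
have K0 : K !=set0.
  exists (0, 0); split=> k /=; rewrite mxE in_itv /= ?lexx ?ler01 //.
  by rewrite oppr_le0 normr_ge0.
have cn : {within K, continuous (fun z => `|h z|)}.
  by apply: continuous_subspaceT => z; apply: cvg_norm; exact: ch.
have [c _ cmax] := compact_EVT_max K0 cK cn.
exists `|h c| => // x p pG.
have [k xk] := torus_representative x.
rewrite -(ph p x k); apply: cmax; rewrite inE; split=> // l /=.
by rewrite in_itv /= -ler_norml (le_trans (pG l)) // ler_norm.
Qed.

Lemma periodic_bounded (v : vec -> R) : continuous v -> Defs.periodic v ->
  exists2 B, 0 <= B & forall x, `|v x| <= B.
Proof.
move=> cv pv; have [||B B0 hB] := @periodic_bounded_pair (fun z => v z.1) 0.
- by move=> z; apply: (@cvg_comp _ _ _ fst v _ _ _ _ (cv _)); exact: cvg_fst.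
- by [].
by exists B => // x; apply: (hB x 0) => k; rewrite mxE normr0.
Qed.

Lemma lipschitz_torusP (u : vec -> R) : lipschitz_torus u ->
  [/\ continuous u, Defs.periodic u &
    exists2 L, 0 < L & forall x y, `|u x - u y| <= L * `|x - y|].
Proof.
move=> [pu lu].
have [L L0 hL] : exists2 L, 0 < L & forall x y, `|u x - u y| <= L * `|x - y|.
  have [M [_ HM]] := lu.
  exists (Num.max 1 (M + 1)) => [|x y]; first by rewrite lt_max ltr01.
  have MM : M < Num.max 1 (M + 1) by rewrite lt_max ltrDl ltr01 orbT.
  exact: (HM _ MM (x, y)).
split=> //; last by exists L.
suff cu (x : vec) : u @ x --> u x by move=> x; exact: cu.
apply/(@cvgrPdist_le _ _ _ (nbhs x) _) => e e0.
have eL : 0 < e / L by rewrite divr_gt0.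
apply: (@filterS vec (nbhs x) _ _ _ _ (nbhsx_ballx x _ eL)) => y.
rewrite -ball_normE /= => xy; apply: (le_trans (hL x y)).
by rewrite mulrC -ler_pdivlMr // ltW.
Qed.

Lemma norm_row_le (v : vec) (r : R) : 0 <= r -> (forall k, `|v 0 k| <= r) -> `|v| <= r.
Proof.
move=> r0 vr; rewrite /Num.Def.normr /= mx_normrE; apply: bigmax_le => // -[i k] _ /=.
by rewrite ord1.
Qed.

Lemma coord_le_norm (v : vec) k : `|v 0 k| <= `|v|.
Proof.
by rewrite [leRHS]/Num.Def.normr /= mx_normrE; exact: (le_bigmax _ (fun ij : 'I_1 * 'I_n => `|v ij.1 ij.2|) (0, k)).
Qed.

Lemma sqr_norm_le_sqdist (x y : vec) : `|x - y| ^+ 2 <= sqdist x y.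
Proof.
have -> : sqdist x y = Num.sqrt (sqdist x y) ^+ 2 by rewrite sqr_sqrtr // sqdist_ge0.
rewrite lerXn2r ?nnegrE ?sqrtr_ge0 //; apply: norm_row_le => [|k]; first exact: sqrtr_ge0.
by rewrite !mxE -sqrtr_sqr ler_wsqrtr // sqr_coord_le_sqdist.
Qed.

Lemma is_derive_sqdist_dir (x y v : vec) :
  is_derive y v (sqdist x) (\sum_k 2 * (y 0 k - x 0 k) * v 0 k).
Proof.
have -> : sqdist x = \sum_j ((fun y : vec => y 0 j) - cst (x 0 j)) *
    ((fun y : vec => y 0 j) - cst (x 0 j)).
  by apply/funext => z; rewrite fct_sumE; apply: eq_bigr => j _; rewrite !fctE; ring.
have Dj j := is_deriveB (is_derive_coordinate y v j) (is_derive_cst (x 0 j) y v).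
apply: (is_derive_eq (is_derive_sum (fun j => is_deriveM (Dj j) (Dj j)))).
by apply: eq_bigr => j _; rewrite !fctE /GRing.scale /= subr0; ring.
Qed.

Lemma cvg_quadratic {T : Type} {F : set_system T} {FF : Filter F} (f : T -> vec)
    (a : R) (x z v : vec) : (forall k, f t 0 k @[t --> F] --> z 0 k) ->
  (a * sqdist x (f t) @[t --> F] --> a * sqdist x z) /\
  (a * (\sum_k 2 * (f t 0 k - x 0 k) * v 0 k) @[t --> F]
     --> a * \sum_k 2 * (z 0 k - x 0 k) * v 0 k).
Proof.
move=> cf; split; (apply: cvgM; [exact: cvg_cst|apply: cvg_sumr => k]).
  rewrite expr2; under eq_cvg do rewrite expr2.
  by apply: cvgM; apply: cvgB => //; exact: cvg_cst.
apply: cvgM; last exact: cvg_cst.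
by apply: cvgM; [exact: cvg_cst|apply: cvgB => //; exact: cvg_cst].
Qed.

Lemma class_C1_sqdist (a : R) (x : vec) : class_C 1 (fun y => a * sqdist x y) /\
  forall y, grad (fun y => a * sqdist x y) y = (2 * a) *: (y - x).
Proof.
have D y v : is_derive y v (fun y => a * sqdist x y) (a * \sum_k 2 * (y 0 k - x 0 k) * v 0 k).
  exact: (is_deriveZ a (is_derive_sqdist_dir x y v)).
have cc (z : vec) k : (fun y : vec => y 0 k) @ z --> z 0 k := @coord_continuous R 1 n 0 k z.
split; last first.
  move=> y; apply/rowP => k; rewrite !mxE (is_derive_val (D y (e_ k))).
  rewrite (bigD1 k) //= big1 ?addr0 => [|j /negbTE jk]; rewrite mxE ?eqxx ?jk /=.
    by ring.
  by rewrite mulr0.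
split.
  suff cs (z : vec) : (fun y => a * sqdist x y) @ z --> a * sqdist x z.
    by move=> z; exact: cs.
  exact: (proj1 (@cvg_quadratic _ (nbhs z) _ id a x z 0 (cc z))).
move=> v; split; first by move=> y; exact: is_derive_derivable (D y v).
split=> //.
have -> : 'D_v (fun y => a * sqdist x y) = (fun y => a * \sum_k 2 * (y 0 k - x 0 k) * v 0 k).
  by apply/funext => y; exact: is_derive_val (D y v).
suff cs (z : vec) : (fun y : vec => a * \sum_k 2 * (y 0 k - x 0 k) * v 0 k) @ z
    --> a * \sum_k 2 * (z 0 k - x 0 k) * v 0 k by move=> z; exact: cs.
exact: (proj2 (@cvg_quadratic _ (nbhs z) _ id a x z v (cc z))).
Qed.

Variables (theta C0 : R) (H : vec -> vec -> R).
Hypothesis C0_gt0 : 0 < C0.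
Hypothesis hH : hamiltonian_assumptions theta C0 H.

Lemma enorm_sqr (p : vec) : enorm p ^+ 2 = \sum_j p 0 j ^+ 2.
Proof. by rewrite sqr_sqrtr // sumr_ge0 // => k _; exact: sqr_ge0. Qed.

Lemma hamiltonian_C1 : class_C 1 (fun z : vec * vec => H z.1 z.2).
Proof. by case: hH => _ C2 _ _; exact: class_C_le. Qed.

Lemma hamiltonian_convex x (p q : vec) :
  H x p + \sum_k (q 0 k - p 0 k) * 'D_(e_ k) (H x) p
      + theta * \sum_k (q 0 k - p 0 k) ^+ 2 <= H x q.
Proof.
case: hH => _ C2 hess _; apply: convex_taylor => //.
exact: (class_C_slice2 x C2).
Qed.

Lemma hamiltonian_growth x (p : vec) k :
  `|'D_(e_ k) (H ^~ p) x| <= C0 * (1 + \sum_j p 0 j ^+ 2).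
Proof.
case: hH => _ _ _ /(_ x p); rewrite enorm_sqr; apply: le_trans.
have -> : 'D_(e_ k) (H ^~ p) x = grad (H ^~ p) x 0 k by rewrite mxE.
rewrite /enorm -sqrtr_sqr ler_wsqrtr //.
by rewrite (bigD1 k) //= lerDl; apply: sumr_ge0 => j _; exact: sqr_ge0.
Qed.

Lemma hamiltonian_bounded (G : R) : exists2 B, 0 <= B &
  forall x (q : vec), (forall k, `|q 0 k| <= G) -> `|H x q| <= B.
Proof.
case: hH => pH [cH _] _ _.
by have [//|B B0 hB] := @periodic_bounded_pair (fun z => H z.1 z.2) G cH; exists B.
Qed.

Lemma hamiltonian_lipschitz_momentum (G : R) : exists2 L, 0 <= L &
  forall x (p q : vec), (forall k, `|p 0 k| <= G) -> (forall k, `|q 0 k| <= G) ->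
    `|H x q - H x p| <= L * \sum_k `|p 0 k - q 0 k|.
Proof.
have /choice [B hB] : forall k, exists B, 0 <= B /\
    forall x (q : vec), (forall k, `|q 0 k| <= G) -> `|'D_(e_ k) (H x) q| <= B.
  move=> k; have [_ cp] := partials_continuous hamiltonian_C1 k.
  have [p|B B0 hB] := periodic_bounded_pair G cp.
    move=> x l /=; case: hH => pH _ _ _.
    by have -> : H (x + map_mx intr l) = H x by apply/funext => q; exact: pH.
  by exists B; split=> // x q; exact: hB.
exists (\sum_k B k); first by apply: sumr_ge0 => k _; exact: (hB k).1.
move=> x p q pG qG.
have [c /andP[c0 c1]] := mean_value_pair hamiltonian_C1 x p 0 (q - p).
rewrite addr0 [p + _]addrC subrK scaler0 addr0 big1 ?add0r => [->|k _]; last by rewrite mxE mul0r.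
apply: (le_trans (ler_norm_sum _ _ _)); rewrite mulr_sumr; apply: ler_sum => k _.
rewrite normrM mulrC ler_pM //; last by rewrite !mxE distrC.
apply: (@le_trans _ _ (B k)).
  apply: (hB k).2 => l; rewrite !mxE.
  have -> : p 0 l + c * (q 0 l - p 0 l) = (1 - c) * p 0 l + c * q 0 l by ring.
  apply: (le_trans (ler_normD _ _)); rewrite !normrM (ger0_norm c0) ger0_norm ?subr_ge0 //.
  have h1 : (1 - c) * `|p 0 l| <= (1 - c) * G by rewrite ler_wpM2l // subr_ge0.
  have h2 : c * `|q 0 l| <= c * G by rewrite ler_wpM2l.
  by lra.
by rewrite (bigD1 k) //= lerDl; apply: sumr_ge0 => j _; exact: (hB j).1.
Qed.

Lemma hamiltonian_lipschitz_space (G d : R) (x y p : vec) :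
  (forall k, `|p 0 k| <= G) -> (forall k, `|y 0 k - x 0 k| <= d) ->
  `|H y p - H x p| <= n%:R * (d * (C0 * (1 + n%:R * G ^+ 2))).
Proof.
move=> pG xy.
have [c _] := mean_value_pair hamiltonian_C1 x p (y - x) 0.
rewrite addr0 [x + _]addrC subrK scaler0 addr0 [X in _ = _ + X]big1 ?addr0 => [->|k _]; last by rewrite mxE mul0r.
apply: (le_trans (ler_norm_sum _ _ _)); apply: sum_le_const => k.
rewrite normrM ler_pM //; first by rewrite !mxE.
apply: (le_trans (hamiltonian_growth _ _ _)); rewrite ler_pM2l // lerD2l.
by apply: sum_le_const => l; exact: sqr_le_norm.
Qed.

(** The penalization is itself the test function at [y], from below for [s = 1] and from above for
    [s = -1]. Comparison with [y' = x] and the Lipschitz bound force [|x - y| <= 2 L eta]; the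
    momentum is then at most [2 L], and moving [H] from [y] to [x] costs [O(eta)]. The implication
    leading to [r] is the only constraint on the radius, so [y] may be known to be interior either
    from the size of [r] or beforehand. *)
Lemma viscosity_at_doubling_max (g v : vec -> R) (s eta L r : R) (x y : vec) :
  s = 1 \/ s = -1 -> 0 < eta -> 0 < L -> 0 < r ->
  (forall x y, `|v x - v y| <= L * `|x - y|) -> visc_sol H g 0 v ->
  near_diag r x y -> (forall k, `|y 0 k - x 0 k| <= 2 * L * eta -> `|y 0 k - x 0 k| < r) ->
  (forall y', near_diag r x y' -> - s * v y' - sqdist x y' / (2 * eta)
        <= - s * v y - sqdist x y / (2 * eta)) ->
  (forall k, `|y 0 k - x 0 k| <= 2 * L * eta) /\
  - (n%:R * (2 * L * eta * (C0 * (1 + n%:R * (2 * L) ^+ 2)))) <=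
    s * (H x ((s / eta) *: (x - y)) + v y - g y).
Proof.
move=> s1 eta0 L0 r0 vL [vsub vsup] xy xyr ymax.
have sn : `|s| = 1 by case: s1 => ->; rewrite ?normrN normr1.
have e20 : 0 < 2 * eta by rewrite mulr_gt0.
have xyL : `|x - y| <= 2 * L * eta.
  have /ymax : near_diag r x x by move=> k; rewrite subrr normr0 ltW.
  rewrite sqdistxx mul0r subr0 => h.
  have h1 : sqdist x y / (2 * eta) <= L * `|x - y|.
    apply: (@le_trans _ _ (s * v x - s * v y)); first by lra.
    rewrite -mulrBr; apply: (le_trans (ler_norm _)); rewrite normrM sn mul1r; exact: vL.
  move: h1; rewrite ler_pdivrMr // => h1.
  have := le_trans (sqr_norm_le_sqdist x y) h1.
  have [->|xy0] := eqVneq (`|x - y|) 0; first by move=> _; rewrite !mulr_ge0 // ltW.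
  have {}xy0 : 0 < `|x - y| by rewrite lt_neqAle eq_sym xy0 normr_ge0.
  by rewrite expr2 mulrAC ler_pM2r // mulrCA mulrA.
have coord k : `|y 0 k - x 0 k| <= 2 * L * eta.
  by rewrite distrC; apply: le_trans xyL; have := coord_le_norm (x - y) k; rewrite !mxE.
split=> //.
have near_y : \forall y' \near y, near_diag r x y'.
  have : \forall y' \near y, near_diag r y' x.
    by apply: near_diag_nbhs => k; rewrite distrC; apply: xyr.
  by apply: filterS => y' h k; rewrite distrC.
set q := (s / eta) *: (x - y).
have Hy : 0 <= s * (H y q + v y - g y).
  have [C1 gradE] := class_C1_sqdist (- s / (2 * eta)) x.
  have gq : grad (fun y => - s / (2 * eta) * sqdist x y) y = q.
    rewrite gradE /q; apply/rowP => k; rewrite !mxE; field; rewrite gt_eqF //.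
  case: s1 => E.
    have := vsup _ y C1; rewrite gq E mul1r; apply.
    by apply: filterS near_y => y' /ymax; rewrite E; lra.
  have := vsub _ y C1; rewrite gq E mulN1r oppr_ge0; apply.
  by apply: filterS near_y => y' /ymax; rewrite E; lra.
have qL k : `|q 0 k| <= 2 * L.
  rewrite !mxE normrM normrM sn mul1r gtr0_norm ?invr_gt0 // mulrC ler_pdivrMr //.
  by rewrite distrC.
have := hamiltonian_lipschitz_space qL coord.
have : s * (H y q - H x q) <= `|H y q - H x q|.
  by apply: (le_trans (ler_norm _)); rewrite normrM sn mul1r.
by lra.
Qed.

End Constants.

(** [rho ^+ 4 <= 4^-1] is the range of [eps] in [uniform_gradient_bound]; [4 * rho * Phi <= 1] is
    the smallness of [c = rho]. *)
Lemma small_parameter (R : realType) (rho Phi : R) : 0 <= Phi -> 0 < rho < (4 * Phi + 2)^-1 ->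
  [/\ rho <= 1, rho ^+ 4 <= 4^-1 & 4 * rho * Phi <= 1].
Proof.
move=> Phi0 /andP[rho0]; have P2 : 0 < 4 * Phi + 2 by rewrite ltr_wpDl // mulr_ge0.
rewrite -[X in _ < X]mul1r ltr_pdivlMr // => rP.
have rPhi : 0 <= rho * Phi by rewrite mulr_ge0 // ltW.
have r2 : rho <= 2^-1 by lra.
have r1 : rho <= 1 by lra.
split=> //; last by lra.
have -> : (4^-1 : R) = 2^-1 ^+ 2 by field.
apply: (@le_trans _ _ (rho ^+ 2)); first by apply: ler_wiXn2l => //; exact: ltW.
by rewrite ler_pXn2r // ?nnegrE ltW.
Qed.

Lemma delayed_time_bounds (R : realType) (tau a b t : R) : 0 <= tau <= 1 -> a <= t <= b ->
  a <= t - tau * (t - a) <= b.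
Proof.
move=> /andP[tau0 tau1] /andP[ta tb]; have d0 : 0 <= t - a by rewrite subr_ge0.
have := mulr_ge0 tau0 d0; have := ler_piMl d0 tau1.
by move: (tau * (t - a)) => m h1 h2; apply/andP; split; lra.
Qed.

Lemma supersolution_slack (R : realType) (tau X A E : R) : 0 <= tau <= 1 -> 0 <= A ->
  2 * A <= E -> - A <= - 1 * X -> 0 <= - (1 - - 1 * tau) * X + E.
Proof.
move=> /andP[tau0 tau1] A0 AE h.
have t0 : 0 <= 1 + tau by rewrite addr_ge0.
have := ler_wpM2l t0 h; have := ler_piMl A0 tau1.
by lra.
Qed.

(** * Estimates uniform in the regularization parameter, and choice of the scales *)

Section Asymptotics.
Context {R : realType} {n : nat}.
Local Notation vec := 'rV[R]_n.
Variables (theta C0 : R) (H : bool -> vec -> vec -> R) (u0 v : bool -> vec -> R).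
Hypothesis n_gt0 : (0 < n)%N.
Hypothesis theta_gt0 : 0 < theta.
Hypothesis C0_gt0 : 0 < C0.
Hypothesis hH : forall i, hamiltonian_assumptions theta C0 (H i).
Hypothesis hu0 : forall i, lipschitz_torus (u0 i).
Hypothesis hv : forall i, lipschitz_torus (v i).
Hypothesis vsol : forall i, visc_sol (H i) (v (~~ i)) 0 (v i).

Definition regularized_family (eps : R) (w : bool -> R -> vec -> R) : Prop :=
  [/\ forall i t, 0 <= t -> Defs.periodic (w i t),
      forall i, {within [set z : R * vec | 0 <= z.1], continuous (fun z => w i z.1 z.2)},
      forall i, smooth_pos (w i),
      forall i t x, 0 < t ->
        eps * dt (w i) t x + H i x (grad (w i t) x) + w i t x - w (~~ i) t x
          = eps ^+ 4 * laplacian (w i t) x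
    & forall i x, w i 0 x = u0 i x].

Lemma common_lipschitz : exists2 L, 0 < L & forall i x y, `|v i x - v i y| <= L * `|x - y|.
Proof.
have [_ _ [L1 L10 h1]] := lipschitz_torusP (hv true).
have [_ _ [L2 L20 h2]] := lipschitz_torusP (hv false).
exists (L1 + L2); first exact: addr_gt0.
move=> i x y; rewrite mulrDl; have p1 := mulr_ge0 (ltW L10) (normr_ge0 (x - y)).
have p2 := mulr_ge0 (ltW L20) (normr_ge0 (x - y)).
by case: i; [apply: (le_trans (h1 x y)); rewrite lerDl|apply: (le_trans (h2 x y)); rewrite lerDr].
Qed.

Lemma common_bound (f : bool -> vec -> R) : (forall i, lipschitz_torus (f i)) ->
  exists2 M, 0 <= M & forall i x, `|f i x| <= M.
Proof.
move=> hf; have [c1 p1 _] := lipschitz_torusP (hf true).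
have [c2 p2 _] := lipschitz_torusP (hf false).
have [B1 B10 h1] := periodic_bounded c1 p1; have [B2 B20 h2] := periodic_bounded c2 p2.
exists (B1 + B2); first exact: addr_ge0.
by case=> x; [apply: (le_trans (h1 x)); rewrite lerDl|apply: (le_trans (h2 x)); rewrite lerDr].
Qed.

(** This is where the ergodic constant [0] matters: [v] solves the stationary system with right-hand
    side [0], so the comparison does not drift like [t / eps]. *)
Lemma uniform_bound : exists M, [/\ 0 <= M, forall i x, `|v i x| <= M &
  forall eps w, 0 < eps <= 1 -> regularized_family eps w ->
    forall i t x, 0 <= t <= 1 -> `|w i t x| <= M].
Proof.
have [L L0 vL] := common_lipschitz.
have [Mv Mv0 vM] := common_bound hv; have [Mu Mu0 uM] := common_bound hu0.
set K := n%:R * (2 * L * (C0 * (1 + n%:R * (2 * L) ^+ 2))).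
have K0 : 0 <= K.
  by rewrite !mulr_ge0 // ?(ltW L0) ?(ltW C0_gt0) // addr_ge0 // mulr_ge0 // sqr_ge0.
exists (2 * Mv + Mu + K + n%:R); split.
- by rewrite !addr_ge0 // mulr_ge0.
- by move=> i x; apply: (le_trans (vM i x)); have := ler0n R n; lra.
move=> eps w /andP[eps0 eps1] [pw cw sw PDE w0] i t x t01.
(* With [eta = eps^2], the residual of [v] and the viscous error [eps^4 n / eta] are both
   [O(eps^2)], hence still bounded after division by [eps]. The radius chosen next exceeds the
   displacement [2 L eta] of the maximum points. *)
have eta0 : 0 < eps ^+ 2 by rewrite exprn_gt0.
have r0 : 0 < (2 * L + 1) * eps ^+ 2 by rewrite mulr_gt0 // addr_gt0 // mulr_gt0.
have main s : s = 1 \/ s = -1 -> s * (w i t x - v i x) <= Mu + Mv + K + n%:R.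
  move=> s1.
  have sn : `|s| = 1 by case: s1 => ->; rewrite ?normrN normr1.
  have := @doubling_bound _ _ H w eps (eps ^+ 4) eps0 (exprn_gt0 _ eps0) sw PDE pw cw
    s (eps ^+ 2) ((2 * L + 1) * eps ^+ 2) (K * eps ^+ 2) (Mu + Mv) 1 v.
  have s2 : s ^+ 2 = 1 by rewrite -real_normK ?num_real // sn expr1n.
  move=> /(_ s2 eta0 r0) D.
  have {D} := D _ _ _ _ i t x t01.
  have -> : (K * eps ^+ 2 + eps ^+ 4 * (n%:R / eps ^+ 2)) / eps * t = (K + n%:R) * (eps * t).
    by field; rewrite gt_eqF.
  have et1 : eps * t <= 1 by case/andP: t01 => t0 t1; rewrite mulr_ile1 // ltW.
  have Kn : (K + n%:R) * (eps * t) <= K + n%:R by rewrite ler_piMr // addr_ge0.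
  move=> D; apply: le_trans (D _ _ _ _) _; last by lra.
  - by move=> j; have [] := lipschitz_torusP (hv j).
  - by move=> j; have [] := lipschitz_torusP (hv j).
  - move=> j x' y' xy ymax.
    have xyr k : `|y' 0 k - x' 0 k| <= 2 * L * eps ^+ 2 ->
        `|y' 0 k - x' 0 k| < (2 * L + 1) * eps ^+ 2.
      by move=> h; apply: (le_lt_trans h); rewrite ltr_pM2r // ltrDl.
    have [h1 h2] := viscosity_at_doubling_max C0_gt0 (hH j) s1 eta0 L0 r0 (vL j) (vsol j) xy xyr ymax.
    split; first by move=> k; exact: xyr.
    have -> : K * eps ^+ 2 = n%:R * (2 * L * eps ^+ 2 * (C0 * (1 + n%:R * (2 * L) ^+ 2))).
      by rewrite /K; ring.
    by rewrite -lerBlDr sub0r.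
  - move=> j x' y'; rewrite w0; apply: (le_trans (ler_norm _)).
    by rewrite normrM sn mul1r (le_trans (ler_normB _ _)) // lerD.
have := main 1 (or_introl erefl); have := main (- 1) (or_intror erefl).
have := vM i x; rewrite !ler_norml => /andP[a b] c d.
by apply/andP; split; lra.
Qed.

(** For [eps <= 1/4] and [t >= 1/2], the window of length [eps] before [t] stays at positive times,
    so the gradient of the initial data never enters. *)
Lemma uniform_gradient_bound : exists2 G, 0 <= G &
  forall eps w, 0 < eps <= 4^-1 -> regularized_family eps w ->
    forall i t x k, 2^-1 <= t <= 1 -> `|'D_(e_ k) (w i t) x| <= G.
Proof.
have [M [M0 _ wM]] := uniform_bound.
have [B1 B10 hB1] := hamiltonian_bounded (hH true) 0.
have [B2 B20 hB2] := hamiltonian_bounded (hH false) 0.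
have h0 i x : H i x 0 <= B1 + B2.
  have z (k : 'I_n) : `|(0 : vec) 0 k| <= 0 by rewrite mxE normr0.
  apply: (le_trans (ler_norm _)).
  by case: i; [apply: (le_trans (hB1 x 0 z)); rewrite lerDl|apply: (le_trans (hB2 x 0 z)); rewrite lerDr].
exists (2 * ((C0 + 1) / theta) * M + (1 + C0 + (C0 + 1) / theta * (B1 + B2))).
  have K0 : 0 <= (C0 + 1) / theta by rewrite divr_ge0 ?addr_ge0 // ltW.
  have := mulr_ge0 K0 M0; have := mulr_ge0 K0 (addr_ge0 B10 B20).
  by have := ltW C0_gt0; lra.
move=> eps w /andP[eps0 eps1] reg i t x k /andP[t0 t1].
have [pw cw sw PDE w0] := reg.
apply: (gradient_bound eps0 (exprn_gt0 4 eps0) (fun i => hamiltonian_C1 (hH i)) sw PDE pw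
  theta_gt0 C0_gt0 (fun i => hamiltonian_convex (hH i)) (fun i => hamiltonian_growth (hH i)) h0) => //.
  by lra.
move=> j r y /andP[ra rb]; apply: (wM eps w) => //; last by apply/andP; split; lra.
by rewrite eps0 /=; lra.
Qed.

(** The slowest terms are [tau^2 / c] and [c tau], both of order [rho^3]; all others carry a power
    of at least [4]. *)
Lemma error_bound_scaling (nn M G L B U Phi K rho : R) : 0 < rho -> rho <= 1 ->
  0 <= nn -> 0 <= M -> 0 <= B -> 0 <= U -> 0 <= Phi -> 0 <= K ->
  error_bound nn ((rho ^+ 4) ^+ 4) theta M G L B U (rho ^+ 2) rho (rho ^+ 4) (rho ^+ 8) Phi
      (K * rho ^+ 8) <=
  (2 * nn + nn / 4 + 4^-1 + 4 * Phi * M + (nn * G ^+ 2 + U) + nn * L ^+ 2 / (2 * theta)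
    + 2 * Phi * B + 2 * K) * rho ^+ 3.
Proof.
move=> r0 r1 n0 M0 B0 U0 P0 K0.
have -> : error_bound nn ((rho ^+ 4) ^+ 4) theta M G L B U (rho ^+ 2) rho (rho ^+ 4) (rho ^+ 8)
    Phi (K * rho ^+ 8) =
  (2 * nn) * rho ^+ 8 + nn / 4 * rho ^+ 16 + 4^-1 * rho ^+ 3 + 4 * Phi * M * rho ^+ 3
  + (nn * G ^+ 2 + U) * rho ^+ 4 + nn * L ^+ 2 / (2 * theta) * rho ^+ 4 + 2 * Phi * B * rho ^+ 3
  + 2 * K * rho ^+ 8.
  by rewrite /error_bound; field; rewrite !gt_eqF.
have up (c : R) (m : nat) : (3 <= m)%N -> 0 <= c -> c * rho ^+ m <= c * rho ^+ 3.
  by move=> m3 c0; rewrite ler_wpM2l //; apply: ler_wiXn2l => //; exact: ltW.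
rewrite 7!(@mulrDl _ _ _ (rho ^+ 3)); apply: lerD; last exact: up (mulr_ge0 _ _).
do ?[apply: lerD => //].
all: try (apply: up => //).
- by rewrite mulr_ge0.
- by rewrite divr_ge0.
- by rewrite addr_ge0 // mulr_ge0 // sqr_ge0.
- by rewrite divr_ge0 // mulr_ge0 ?sqr_ge0 // ltW.
Qed.

Lemma rescaled_bound (s rho d Phi N E Ce : R) : 0 < rho -> rho <= 1 -> 0 <= Phi -> 0 <= N ->
  E <= Ce * rho ^+ 3 ->
  s * (rho ^+ 2 * (1 - 2^-1)) * d <= 3 * Phi + rho ^+ 4 * N + E / rho ^+ 4 * (1 - 2^-1) ->
  s * (rho ^+ 4 * d) <= (2 * (3 * Phi + N) + Ce) * rho.
Proof.
move=> r0 r1 P0 N0 hE h.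
(* The factor [2 rho^2] is [eps / (tau (b - a))] with [b - a = 1/2]. *)
have r20 : 0 < 2 * rho ^+ 2 by rewrite mulr_gt0 // exprn_gt0.
have := ler_wpM2l (ltW r20) h.
have -> : 2 * rho ^+ 2 * (s * (rho ^+ 2 * (1 - 2^-1)) * d) = s * (rho ^+ 4 * d) by field.
have -> : 2 * rho ^+ 2 * (3 * Phi + rho ^+ 4 * N + E / rho ^+ 4 * (1 - 2^-1)) =
  6 * Phi * rho ^+ 2 + 2 * N * rho ^+ 6 + E / rho ^+ 2 by field; rewrite gt_eqF.
have hE2 : E / rho ^+ 2 <= Ce * rho.
  by rewrite ler_pdivrMr ?exprn_gt0 // -mulrA -exprS.
have le1 m : (1 <= m)%N -> rho ^+ m <= rho.
  by move=> hm; rewrite -[leRHS]expr1; apply: ler_wiXn2l => //; exact: ltW.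
have a1 : 6 * Phi * rho ^+ 2 <= 6 * Phi * rho by rewrite ler_wpM2l ?le1 // mulr_ge0.
have a2 : 2 * N * rho ^+ 6 <= 2 * N * rho by rewrite ler_wpM2l ?le1 // mulr_ge0.
by lra.
Qed.

(** Comparison with [y' = x] using only the bound on [f] gives [|x - y|^2 <= 4 M eta], so a radius
    of order [sqrt eta] makes the maximum interior. *)
Lemma doubling_max_interior (f : vec -> R) (M eta r : R) (x y : vec) : 0 < eta -> 0 < r ->
  4 * M * eta < r ^+ 2 -> (forall z, `|f z| <= M) ->
  (forall y', near_diag r x y' -> f y' - sqdist x y' / (2 * eta) <= f y - sqdist x y / (2 * eta)) ->
  forall k, `|y 0 k - x 0 k| < r.
Proof.
move=> eta0 r0 Mr fM ymax k.
have := ymax x; rewrite sqdistxx mul0r subr0 => /(_ _) h.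
have {}h : f x <= f y - sqdist x y / (2 * eta).
  by apply: h => l; rewrite subrr normr0 ltW.
have h2 : sqdist x y / (2 * eta) <= 2 * M.
  by have := fM x; have := fM y; rewrite !ler_norml => /andP[a b] /andP[c d]; lra.
move: h2; rewrite ler_pdivrMr ?mulr_gt0 // => h2.
have h3 : (x 0 k - y 0 k) ^+ 2 < r ^+ 2.
  apply: (le_lt_trans (sqr_coord_le_sqdist x y k)); apply: le_lt_trans Mr.
  by apply: (le_trans h2); lra.
rewrite distrC -(@ltr_pXn2r _ 2) ?nnegrE ?normr_ge0 ?(ltW r0) //.
by rewrite real_normK ?num_real.
Qed.

(** The delay slows time by the factor [1 - tau]. At the maximum over [y], the first-order condition
    gives [Dw = (y - x) / eta] and the second-order one bounds the Laplacian from above, the side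
    that is needed. The two errors come from that bound and from moving [H] from [y] to [x]. *)
Lemma delayed_solution_at_max (eps tau G a eta r : R) (w : bool -> R -> vec -> R)
  (i : bool) (t : R) (x y : vec) :
  0 < eps -> 0 <= tau <= 1 -> 0 < eta -> 0 < a -> a <= t -> 0 <= G ->
  regularized_family eps w ->
  (forall k, `|'D_(e_ k) (w i (t - tau * (t - a))) y| <= G) ->
  (forall k, `|y 0 k - x 0 k| < r) ->
  (forall y', near_diag r x y' -> w i (t - tau * (t - a)) y' - sqdist x y' / (2 * eta)
     <= w i (t - tau * (t - a)) y - sqdist x y / (2 * eta)) ->
  (forall k, `|y 0 k - x 0 k| <= eta * G) /\
  exists2 gs, is_derive t 1 (fun s => w i (s - tau * (s - a)) y) gs &
    eps * gs <= - (1 - tau) * (H i x (eta^-1 *: (y - x))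
       + w i (t - tau * (t - a)) y - w (~~ i) (t - tau * (t - a)) y)
     + (eps ^+ 4 * (n%:R / eta) + n%:R * (eta * G * (C0 * (1 + n%:R * G ^+ 2)))).
Proof.
move=> eps0 /andP[tau0 tau1] eta0 a0 at0 G0 [pw cw sw PDE _] wG xyr ymax.
set b := t - tau * (t - a) in wG ymax *.
have b0 : 0 < b.
  have := mulr_ge0 tau0 (ltW a0); have : 0 <= (1 - tau) * (t - a) by rewrite mulr_ge0 // subr_ge0.
  by rewrite /b; lra.
have [W Wt _] := sw i.
have D1 k z : is_derive z (e_ k) (fun y => w i b y - sqdist x y / (2 * eta))
    ('D_(e_ k) (w i b) z - (z 0 k - x 0 k) / eta).
  have -> : (fun y => w i b y - sqdist x y / (2 * eta)) = w i b - (2 * eta)^-1 \*: sqdist ^~ x.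
    by apply/funext => y'; rewrite !fctE /GRing.scale /= sqdistC mulrC.
  apply: (is_derive_eq (is_deriveB (class_C12_space z W b0 k)
    (is_deriveZ (2 * eta)^-1 (is_derive_sqdist z x k)))).
  by rewrite /GRing.scale /=; field; rewrite gt_eqF.
have D2 k : is_derive y (e_ k) (fun z => 'D_(e_ k) (w i b) z - (z 0 k - x 0 k) / eta)
    ('D_(e_ k) ('D_(e_ k) (w i b)) y - eta^-1).
  have -> : (fun z => 'D_(e_ k) (w i b) z - (z 0 k - x 0 k) / eta) =
      'D_(e_ k) (w i b) - eta^-1 \*: (fun z : vec => z 0 k - x 0 k).
    by apply/funext => z; rewrite [_ / eta]mulrC.
  apply: (is_derive_eq (is_deriveB (class_C12_space2 y W b0 k k)
    (is_deriveZ eta^-1 (is_derive_coord_sub y x k k)))).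
  by rewrite eqxx /GRing.scale /= mulr1.
have near_y : \forall y' \near y, near_diag r x y'.
  have N : \forall y' \near y, near_diag r y' x.
    by apply: near_diag_nbhs => k; rewrite distrC; exact: xyr.
  by apply: filterS N => y' h k; rewrite distrC.
have ynear : \forall y' \near y, w i b y' - sqdist x y' / (2 * eta)
     <= w i b y - sqdist x y / (2 * eta).
  by apply: filterS near_y => y'; exact: ymax.
have T k := local_max_direction (D1 k) (D2 k) ynear.
have gk k : (y 0 k - x 0 k) / eta = 'D_(e_ k) (w i b) y.
  by have /eqP := proj1 (T k); rewrite subr_eq0 => /eqP.
have coord k : `|y 0 k - x 0 k| <= eta * G.
  have := wG k; rewrite -gk normrM [X in _ * X]gtr0_norm ?invr_gt0 //.
  by rewrite ler_pdivrMr // mulrC.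
split=> //.
have gradE : grad (w i b) y = eta^-1 *: (y - x).
  by apply/rowP => k; rewrite !mxE -gk mulrC.
exists ((1 - tau) * dt (w i) b y).
  have -> : (fun s => w i (s - tau * (s - a)) y) = (w i ^~ y) \o (fun s => tau * a + s * (1 - tau)).
    by apply/funext => s /=; congr (w i _ y); ring.
  have Eb : tau * a + t * (1 - tau) = b by rewrite /b; ring.
  rewrite [X in is_derive _ _ _ X]mulrC; apply: is_derive1_comp; last exact: is_derive_affine.
  by rewrite Eb; exact: class_C12_time.
rewrite mulrCA (system_eq PDE) // gradE.
have L : \sum_k 'D_(e_ k) ('D_(e_ k) (w i b)) y <= n%:R / eta.
  by apply: sum_le_const => k; have := proj2 (T k); rewrite subr_le0.
have HL := hamiltonian_lipschitz_space C0_gt0 (hH i) (p := eta^-1 *: (y - x)) _ coord.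
have {}HL := HL G _.
move: L; generalize (\sum_k 'D_(e_ k) ('D_(e_ k) (w i b)) y) => Lap L.
have qG k : `|(eta^-1 *: (y - x)) 0 k| <= G by rewrite -gradE mxE.
have := HL qG; rewrite ler_norml => /andP[HL1 _].
have eL := ler_wpM2l (ltW (exprn_gt0 4 eps0)) L.
have t1 : 0 <= 1 - tau by rewrite subr_ge0.
set E1 := eps ^+ 4 * (n%:R / eta) in eL *; set E2 := n%:R * _ in HL1 *.
have E10 : 0 <= E1 by rewrite mulr_ge0 ?exprn_ge0 ?divr_ge0 // ltW.
have E20 : 0 <= E2.
  by rewrite /E2 !mulr_ge0 // ?(ltW eta0) ?(ltW C0_gt0) // addr_ge0 // mulr_ge0 // sqr_ge0.
have s1 : (1 - tau) * (eps ^+ 4 * Lap - H i y (eta^-1 *: (y - x)))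
    <= (1 - tau) * (E1 + E2 - H i x (eta^-1 *: (y - x))).
  by rewrite ler_wpM2l //; lra.
have s2 : (1 - tau) * (E1 + E2) <= E1 + E2 by rewrite ler_piMl ?addr_ge0 // gerBl.
by lra.
Qed.

(* With [eps = rho ^ 4] and doubling length [eta = rho ^ 8], the choices
   [tau = rho ^ 2], [c = rho], [kappa = rho ^ 4] make [error_bound] of order
   [rho ^ 3 = tau * rho]; dividing by [tau] leaves [rho]. For [s = 1] the
   comparison function is the delayed solution, for [s = -1] the solution [v]
   of the ergodic problem. *)
Lemma time_derivative_decay : exists C rho0, [/\ 0 <= C, 0 < rho0 &
  forall (rho : R) w, 0 < rho < rho0 -> regularized_family (rho ^+ 4) w ->
    forall i x, `|rho ^+ 4 * dt (w i) 1 x| <= C * rho].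
Proof.
have [M [M0 vM wM]] := uniform_bound.
have [Gw Gw0 wG] := uniform_gradient_bound.
have [L L0 vL] := common_lipschitz.
(* One momentum bound for both comparison functions: [Gw] for the delayed solution, [2 L] for
   [v]. *)
pose G := Gw + 2 * L.
have L20 : 0 <= 2 * L by rewrite mulr_ge0 // ltW.
have G0 : 0 <= G by rewrite addr_ge0.
have GwG : Gw <= G by rewrite lerDl.
have LG : 2 * L <= G by rewrite lerDr.
have [B1 B10 hB1] := hamiltonian_bounded (hH true) G.
have [B2 B20 hB2] := hamiltonian_bounded (hH false) G.
have [K1 K10 hK1] := hamiltonian_lipschitz_momentum (hH true) G.
have [K2 K20 hK2] := hamiltonian_lipschitz_momentum (hH false) G.
pose B := B1 + B2; pose Lp := K1 + K2.
have B0 : 0 <= B by rewrite addr_ge0.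
have boundH i x (q : vec) : (forall k, `|q 0 k| <= G) -> `|H i x q| <= B.
  by case: i => qG; [apply: (le_trans (hB1 x q qG)); rewrite lerDl|apply: (le_trans (hB2 x q qG)); rewrite lerDr].
have lipH i x (p q : vec) : (forall k, `|p 0 k| <= G) -> (forall k, `|q 0 k| <= G) ->
    `|H i x q - H i x p| <= Lp * \sum_k `|p 0 k - q 0 k|.
  have S0 : 0 <= \sum_k `|p 0 k - q 0 k| by apply: sumr_ge0.
  move=> pG qG; case: i; [apply: (le_trans (hK1 x p q pG qG))|apply: (le_trans (hK2 x p q pG qG))];
    by rewrite ler_wpM2r // /Lp ?lerDl ?lerDr.
(* The second summand is [n r^2 / (2 eta)] for the [r] chosen below; it does not depend on [rho],
   since [r] scales like [rho^4] and [eta = rho^8]. *)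
pose Phi := 2 * M + n%:R * (2 * M + 1) ^+ 2 / 2.
have Phi0 : 0 <= Phi.
  by rewrite addr_ge0 ?(mulr_ge0 _ M0) // divr_ge0 // mulr_ge0 // sqr_ge0.
pose U := n%:R * (G * (C0 * (1 + n%:R * G ^+ 2))) + n%:R * (2 * G ^+ 2).
have nG0 : 0 <= n%:R * G ^+ 2 by rewrite mulr_ge0 // sqr_ge0.
have CG0 : 0 <= C0 * (1 + n%:R * G ^+ 2) by rewrite mulr_ge0 ?(ltW C0_gt0) // addr_ge0.
have U0 : 0 <= U.
  apply: addr_ge0; apply: mulr_ge0 => //; first exact: mulr_ge0.
  by apply: mulr_ge0 => //; exact: sqr_ge0.
pose K3 := n%:R * (2 * L * (C0 * (1 + n%:R * (2 * L) ^+ 2))).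
have K30 : 0 <= K3.
  by rewrite !mulr_ge0 ?(ltW L0) ?(ltW C0_gt0) // addr_ge0 // mulr_ge0 // sqr_ge0.
pose K4 := n%:R * (G * (C0 * (1 + n%:R * G ^+ 2))).
have K40 : 0 <= K4 by apply: mulr_ge0 => //; exact: mulr_ge0.
(* A common residual constant: [n + K4] for the delayed solution, [2 K3] for [v], where [2] bounds
   the factor [1 + tau]. *)
pose K := n%:R + 2 * K3 + K4.
have K0 : 0 <= K by rewrite !addr_ge0 // mulr_ge0.
pose Ce := 2 * n%:R + n%:R / 4 + 4^-1 + 4 * Phi * M + (n%:R * G ^+ 2 + U)
  + n%:R * Lp ^+ 2 / (2 * theta) + 2 * Phi * B + 2 * K.
have Ce0 : 0 <= Ce.
  have th0 : 0 <= 2 * theta by rewrite mulr_ge0 // ltW.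
  apply: addr_ge0; last exact: mulr_ge0.
  apply: addr_ge0; last by apply: mulr_ge0 => //; exact: mulr_ge0.
  apply: addr_ge0; last by apply: divr_ge0 => //; apply: mulr_ge0 => //; exact: sqr_ge0.
  apply: addr_ge0; last exact: addr_ge0.
  apply: addr_ge0; last by apply: mulr_ge0 => //; exact: mulr_ge0.
  apply: addr_ge0; last by rewrite invr_ge0.
  by apply: addr_ge0; [exact: mulr_ge0|exact: divr_ge0].
exists (2 * (3 * Phi + n%:R * G ^+ 2) + Ce), (4 * Phi + 2)^-1; split.
- by rewrite addr_ge0 // mulr_ge0 // addr_ge0 // mulr_ge0.
- by rewrite invr_gt0 ltr_wpDl // mulr_ge0.
move=> rho w rhoR reg i x; have /andP[rho0 _] := rhoR.
have [r1 e4 cP] := small_parameter Phi0 rhoR.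
have rx m : 0 < rho ^+ m by rewrite exprn_gt0.
have le1 m : rho ^+ m <= 1 by rewrite exprn_ile1 // ltW.
have tau01 : 0 <= rho ^+ 2 <= 1 by rewrite ltW ?le1.
have [pw cw sw PDE w0] := reg.
have wM' j t y : 2^-1 <= t <= 1 -> `|w j t y| <= M.
  move=> /andP[ta tb]; apply: (wM (rho ^+ 4) w) => //; first by rewrite rx le1.
  by rewrite tb andbT; apply: le_trans ta; rewrite invr_ge0.
have wG' j t y k : 2^-1 <= t <= 1 -> `|'D_(e_ k) (w j t) y| <= G.
  move=> tb; apply: le_trans GwG; apply: (wG (rho ^+ 4) w) => //.
  by rewrite rx e4.
pose r := (2 * M + 1) * rho ^+ 4.
have r0 : 0 < r by rewrite mulr_gt0 // ltr_wpDl // mulr_ge0.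
have rsq : r ^+ 2 = (2 * M + 1) ^+ 2 * rho ^+ 8 by rewrite exprMn -exprM.
have Mr : 4 * M * rho ^+ 8 < r ^+ 2.
  have -> : r ^+ 2 = 4 * M * rho ^+ 8 + (4 * M ^+ 2 + 1) * rho ^+ 8 by rewrite rsq; ring.
  by rewrite ltrDl mulr_gt0 // ltr_wpDl // mulr_ge0 // sqr_ge0.
have PhiE : 2 * M + n%:R * r ^+ 2 / (2 * rho ^+ 8) <= Phi.
  rewrite rsq /Phi lerD2l le_eqVlt; apply/orP; left; apply/eqP.
  by field; rewrite gt_eqF.
have aha : (2^-1 : R) <= 1 by rewrite invf_le1 // ler1n.
have h0 : (0 : R) < 2^-1 by [].
have err0 : 0 <= K * rho ^+ 8 by rewrite mulr_ge0 // ltW.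
suff main s : s = 1 \/ s = -1 ->
    s * (rho ^+ 4 * dt (w i) 1 x) <= (2 * (3 * Phi + n%:R * G ^+ 2) + Ce) * rho.
  have := main 1 (or_introl erefl); have := main (- 1) (or_intror erefl).
  by rewrite mulN1r mul1r => h1 h2; rewrite ler_norml lerNl h1 h2.
have bnd s g := @time_derivative_bound _ _ H w (rho ^+ 4) ((rho ^+ 4) ^+ 4) n_gt0 (rx 4)
  (exprn_gt0 4 (rx 4)) (fun i => hamiltonian_C1 (hH i)) sw PDE pw theta C0 theta_gt0 C0_gt0
  (fun i => hamiltonian_convex (hH i)) (fun i => hamiltonian_growth (hH i)) G Lp B lipH boundH
  s (rho ^+ 2) rho (rho ^+ 4) (rho ^+ 8) r 2^-1 1 M Phi (K * rho ^+ 8) g.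
have EB := @error_bound_scaling n%:R M G Lp B U Phi K rho rho0 r1
  (ler0n _ _) M0 B0 U0 Phi0 K0.
move=> s1; have sn : `|s| = 1 by case: s1 => ->; rewrite ?normrN normr1.
apply: (rescaled_bound rho0 r1 Phi0 nG0 EB).
case: s1 => sE.
  have bE t : 2^-1 <= t <= 1 -> 2^-1 <= t - rho ^+ 2 * (t - 2^-1) <= 1.
    exact: delayed_time_bounds.
  have b0 t : 2^-1 <= t -> 0 < t - rho ^+ 2 * (t - 2^-1).
    move=> ta; have := @delayed_time_bounds _ _ 2^-1 t t tau01; rewrite ta lexx /=.
    by move=> /(_ isT) /andP[h _]; apply: lt_le_trans h.
  apply: (bnd s (fun j t y => w j (t - rho ^+ 2 * (t - 2^-1)) y)) => //.
  - by move=> j t y tab; apply: wM'; exact: bE.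
  - by move=> j t ta; apply: pw; exact/ltW/b0.
  - move=> j z za.
    apply: (@cvg_at2 _ _ (w j) (fun t => t - rho ^+ 2 * (t - 2^-1)) z).
      apply: cvgB; first exact: cvg_id.
      by apply: cvgMr; apply: cvgB; [exact: cvg_id|exact: cvg_cst].
    have [Wj _ _] := sw j.
    by have [_ _ _ [cj _ _ _]] := Wj _ z.2.2 (b0 _ za).
  - move=> j t y z /andP[ta tb] yz zmax.
    have tab : 2^-1 <= t <= 1 by rewrite ltW.
    have zr := doubling_max_interior (rx 8) r0 Mr (fun z => wM' j _ z (bE _ tab)) zmax.
    have [zG [gs gsd gsle]] := delayed_solution_at_max (rx 4) tau01 (rx 8) h0 (ltW ta) G0 reg
      (fun k => wG' j _ z k (bE _ tab)) zr zmax.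
    split=> //; exists gs => //; rewrite sE mul1r.
    apply: (le_trans gsle); rewrite lerD2l.
    have -> : (rho ^+ 4) ^+ 4 * (n%:R / rho ^+ 8) +
        n%:R * (rho ^+ 8 * G * (C0 * (1 + n%:R * G ^+ 2))) = (n%:R + K4) * rho ^+ 8.
      by rewrite /K4; field; rewrite gt_eqF.
    by rewrite ler_pM2r // /K [leRHS]addrAC lerDl mulr_ge0.
apply: (bnd s (fun j t y => v j y)) => //.
- by move=> j t _; have [] := hv j.
- by move=> j z _; apply: cvg_space2; have [] := lipschitz_torusP (hv j).
- move=> j t y z _ yz zmax.
  have zr := doubling_max_interior (rx 8) r0 Mr (vM j) zmax.
  have zmax' y' : near_diag r y y' -> - -1 * v j y' - sqdist y y' / (2 * rho ^+ 8)
      <= - -1 * v j z - sqdist y z / (2 * rho ^+ 8).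
    by rewrite opprK !mul1r; exact: zmax.
  have [zL visc] := viscosity_at_doubling_max C0_gt0 (hH j) (or_intror erefl) (rx 8) L0 r0
    (vL j) (vsol j) yz (fun k _ => zr k) zmax'.
  split=> //; first by move=> k; apply: (le_trans (zL k)); rewrite mulrC ler_pM2l.
  (* [v] is stationary, so only an upper bound on the residual [X] is required: the subsolution
     property. *)
  exists 0; first exact: is_derive_cst.
  have E : (- 1 / rho ^+ 8) *: (y - z) = (rho ^+ 8)^-1 *: (z - y).
    by rewrite mulN1r scaleNr -scalerN opprB.
  move: visc; rewrite E sE mulr0.
  move: (H j y _ + v j z - v (~~ j) z) => X.
  have -> : n%:R * (2 * L * rho ^+ 8 * (C0 * (1 + n%:R * (2 * L) ^+ 2))) = K3 * rho ^+ 8.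
    by rewrite /K3; ring.
  apply: supersolution_slack => //; first by rewrite mulr_ge0 // ltW.
  by rewrite mulrA ler_pM2r // /K -addrA [leRHS]addrCA lerDl addr_ge0.
Qed.

End Asymptotics.

(** * Essential supremum norms and the limit *)

Lemma maxe_between (R : realType) (a b x y : \bar R) :
  (a <= x)%E -> (x <= b)%E -> (y <= b)%E -> (a <= maxe x y <= b)%E.
Proof. by rewrite le_max ge_max => -> -> ->. Qed.

Lemma Linfty_norm_ge0 (R : realType) (n : nat) (f : 'rV[R]_n -> R) : (0 <= Linfty_norm f)%E.
Proof. by apply: le_ereal_inf_tmp => _ [M [M0 _] <-]; rewrite lee_fin. Qed.

Lemma Linfty_norm_le (R : realType) (n : nat) (f : 'rV[R]_n -> R) (M : R) : (0 < n)%N ->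
  0 <= M -> (forall x, `|f x| <= M) -> (Linfty_norm f <= M%:E)%E.
Proof.
move=> n0 M0 fM; apply: ereal_inf_lbound; exists M => //; split=> // e e0.
exists (fun=> 0), (fun=> 0); split=> //.
- by move=> x /=; rewrite ltNge fM.
(* The exceptional set is empty and cubes of side [0] cover it; their volume [0 ^+ n] vanishes
   because [n] is positive. *)
- by rewrite expr0n eqn0Ngt n0 /= eseries0 // lee_fin ltW.
Qed.

Theorem theorem3p5 (R : realType) (n : nat) (n_gt0 : (0 < n)%N)
  (theta C0 : R) (theta_gt0 : 0 < theta) (C0_gt0 : 0 < C0)
  (H1 H2 : 'rV[R]_n -> 'rV[R]_n -> R)
  (hH1 : hamiltonian_assumptions theta C0 H1)
  (hH2 : hamiltonian_assumptions theta C0 H2)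
  (u01 u02 : 'rV[R]_n -> R)
  (hu01 : lipschitz_torus u01) (hu02 : lipschitz_torus u02)
  (hc : is_ergodic_constant H1 H2 0)
  (w1 w2 : R -> R -> 'rV[R]_n -> R)
  (hw : forall eps : R, 0 < eps ->
     regularized_solution H1 H2 u01 u02 eps (w1 eps) (w2 eps)) :
  (fun eps : R => maxe (eps%:E * Linfty_norm (dt (w1 eps) 1))%E
                       (eps%:E * Linfty_norm (dt (w2 eps) 1))%E)
    @ 0^'+ --> 0%E.
Proof.
have [[v1 [v2 [hv1 hv2 sol1 sol2]]] _] := hc.
pose H (b : bool) := if b then H1 else H2.
pose u0 (b : bool) := if b then u01 else u02.
pose v (b : bool) := if b then v1 else v2.
pose w (eps : R) (b : bool) := if b then w1 eps else w2 eps.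
have hH i : hamiltonian_assumptions theta C0 (H i) by case: i.
have hu0 i : lipschitz_torus (u0 i) by case: i.
have hv i : lipschitz_torus (v i) by case: i.
have vsol i : visc_sol (H i) (v (~~ i)) 0 (v i) by case: i.
have reg eps : 0 < eps -> regularized_family H u0 eps (w eps).
  move=> /hw [p [c1 c2] [s1 s2] pde ini]; split.
  - by case=> t t0; [exact: (p t t0).1|exact: (p t t0).2].
  - by case; [exact: c1|exact: c2].
  - by case; [exact: s1|exact: s2].
  - by case=> t x t0; [exact: (pde t x t0).1|exact: (pde t x t0).2].
  - by case=> x; [exact: (ini x).1|exact: (ini x).2].
have [C [r0 [C_ge0 r0_gt0 decay]]] := time_derivative_decay n_gt0 theta_gt0 C0_gt0 hH hu0 hv vsol.
have norm_le (rho : R) (i : bool) : 0 < rho < r0 ->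
    ((rho ^+ 4)%:E * Linfty_norm (dt (w (rho ^+ 4)%R i) 1%R) <= (C * rho)%:E)%E.
  move=> rr; have /andP[rho0 _] := rr; have e0 : 0 < rho ^+ 4 by rewrite exprn_gt0.
  have -> : C * rho = rho ^+ 4 * (C * rho / rho ^+ 4) by field; rewrite gt_eqF.
  rewrite (EFinM (rho ^+ 4)); apply: lee_wpmul2l; first by rewrite lee_fin ltW.
  apply: Linfty_norm_le => //.
    by rewrite divr_ge0 ?mulr_ge0 // ltW.
  move=> x; rewrite ler_pdivlMr // mulrC.
  have := decay rho _ rr (reg _ e0) i x.
  by rewrite normrM (gtr0_norm e0).
(* [rho] is the fourth root of [eps], written as an iterated square root; the limit then follows by
   squeezing between [0] and [C eps^(1/4)]. *)
have sqrt0 (x : R) : 0 < x -> Num.sqrt (Num.sqrt x) ^+ 4 = x.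
  move=> x0; have -> : (4 = 2 * 2)%N by [].
  by rewrite exprM !sqr_sqrtr ?sqrtr_ge0 // ltW.
have sq : (fun x : R => Num.sqrt (Num.sqrt x)) @ 0^'+ --> (0 : R).
  have c := @continuous_comp _ _ _ Num.sqrt Num.sqrt (0 : R) (@sqrt_continuous R 0)
    (@sqrt_continuous R _).
  by move: (cvg_at_right_filter c); rewrite /= !sqrtr0.
have upper : (fun eps : R => (C * Num.sqrt (Num.sqrt eps))%:E) @ 0^'+ --> 0%E.
  apply: cvg_EFin; first by near=> x.
  have h : C * Num.sqrt (Num.sqrt x) @[x --> 0^'+] --> C * 0 by exact: cvgMr sq.
  by move: h; rewrite mulr0.
apply: (@squeeze_cvge _ _ _ _ (cst 0%E) _ _ _ _ _ upper); last exact: cvg_cst.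
near=> eps.
have e0 : 0 < eps by near: eps; exact: nbhs_right_gt.
have rr : 0 < Num.sqrt (Num.sqrt eps) < r0.
  rewrite !sqrtr_gt0 e0 /= -(@ltr_pXn2r _ 4) ?nnegrE ?sqrtr_ge0 ?(ltW r0_gt0) //.
  rewrite sqrt0 //; near: eps; apply: nbhs_right_lt; exact: exprn_gt0.
have := norm_le _ false rr; have := norm_le _ true rr; rewrite sqrt0 //= => h1 h2.
apply: maxe_between; [|exact: h1|exact: h2].
by apply: mule_ge0; [rewrite lee_fin ltW|exact: Linfty_norm_ge0].
Unshelve. all: by end_near.
Qed.
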